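(* Let $\mathcal{H}$ be a Krein space with fundamental symmetry $J$, and let $Q_0,Q\in\mathcal{Q}$ be $J$-normal projections. The following assertions are equivalent: (i) $Q\in\mathcal{U}_J\cdot Q_0=\{UQ_0U^{\#}:U\in\mathcal{U}_J\}$. (ii) $R(Q)$ and $R(Q_0)$ have the same three signatures and the same two cosignatures, i.e. $\kappa_{+}(R(Q))=\kappa_{+}(R(Q_0))$, $\kappa_{-}(R(Q))=\kappa_{-}(R(Q_0))$, $\kappa_{0}(R(Q))=\kappa_{0}(R(Q_0))$, $c\kappa_{+}(R(Q))=c\kappa_{+}(R(Q_0))$ and $c\kappa_{-}(R(Q))=c\kappa_{-}(R(Q_0))$. Moreover, the connected component of $Q_0$ in $\mathcal{Q}$ (with the norm topology inherited from $L(\mathcal{H})$) coincides with $\mathcal{U}_J\cdot Q_0$.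
   Context: $(\mathcal{H},\langle\cdot,\cdot\rangle)$ is a complex separable Hilbert space and $L(\mathcal{H})$ is the algebra of bounded operators on it. $J\in L(\mathcal{H})$ is a fixed symmetry ($J=J^*=J^{-1}$), and the Krein space structure is given by the indefinite inner product $[f,g]=\langle Jf,g\rangle$. For $T\in L(\mathcal{H})$ the $J$-adjoint is $T^{\#}=JT^*J$, and $R(T)$ is the range of $T$. The set of $J$-normal projections is $\mathcal{Q}=\{Q\in L(\mathcal{H}): Q^2=Q,\ QQ^{\#}=Q^{\#}Q\}$, and $\mathcal{U}_J=\{U\in L(\mathcal{H}):UU^{\#}=U^{\#}U=I\}$ is the group of bounded $J$-unitary operators. For a subspace $\mathcal{S}$, $\mathcal{S}^{[\perp]}=\{f:[f,g]=0\ \forall g\in\mathcal{S}\}$ and $\mathcal{S}^{\circ}=\mathcal{S}\cap\mathcal{S}^{[\perp]}$ is its isotropic part; $[\dot{+}]$ denotes a $J$-orthogonal direct sum. A closed subspace $\mathcal{M}$ is regular if $\mathcal{M}[\dot{+}]\mathcal{M}^{[\perp]}=\mathcal{H}$. A closed subspace $\mathcal{S}$ is pseudo-regular if $\mathcal{S}=\mathcal{S}^{\circ}[\dot{+}]\mathcal{M}$ for some regular subspace $\mathcal{M}$. A subspace is uniformly $J$-positive (resp. uniformly $J$-negative) if there is $c>0$ with $[f,f]\geq c\|f\|^2$ (resp. $-[f,f]\geq c\|f\|^2$) for all $f$ in it. The range of every $J$-normal projection is pseudo-regular. If $\mathcal{S}$ is pseudo-regular, write $\mathcal{S}=\mathcal{S}^{\circ}[\dot{+}]\mathcal{M}_+[\dot{+}]\mathcal{M}_-$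 with $\mathcal{M}_+$ uniformly $J$-positive, $\mathcal{M}_-$ uniformly $J$-negative, and $\mathcal{M}_+[\dot{+}]\mathcal{M}_-$ regular. The positive, negative and isotropic signatures of $\mathcal{S}$ are $\kappa_+(\mathcal{S})=\dim\mathcal{M}_+$, $\kappa_-(\mathcal{S})=\dim\mathcal{M}_-$, $\kappa_0(\mathcal{S})=\dim\mathcal{S}^{\circ}$ (Hilbert space dimensions; they do not depend on the decomposition). In this case $\mathcal{S}^{[\perp]}$ is also pseudo-regular, and the positive and negative cosignatures of $\mathcal{S}$ are $c\kappa_{\pm}(\mathcal{S})=\kappa_{\pm}(\mathcal{S}^{[\perp]})$. *)

(* Defs.v *)
From HB Require Import structures.
From mathcomp Require Import all_boot all_order all_algebra.
From mathcomp Require Import complex.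
From mathcomp Require Import all_classical all_reals all_analysis.

Set Implicit Arguments.
Unset Strict Implicit.
Unset Printing Implicit Defensive.

Import Order.TTheory GRing.Theory Num.Theory Num.Def.
Import numFieldNormedType.Exports.

Local Open Scope classical_set_scope.
Local Open Scope complex_scope.
Local Open Scope ring_scope.

HB.mixin Record CompleteNormedModule_isHilbert (R : realType) H
    & CompleteNormedModule R[i] H := {
  dotp : {dot H for @conjC R[i]} ;
  dotpE : forall f : H, dotp f f = `|f| ^+ 2 }.

#[short(type="hilbertType")]
HB.structure Definition Hilbert (R : realType) :=
  {H of CompleteNormedModule_isHilbert R H & CompleteNormedModule R[i] H}.

Definition separable (T : topologicalType) :=
  exists D : set T, countable D /\ dense D.

Definition bounded_linear (R : realType) (H : normedModType R[i]) :
    {pred H -> H} :=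
  mem [set T : H -> H | linear T /\ exists M, forall f, `|T f| <= M * `|f|].
Arguments bounded_linear {R} H : simpl never.

Record bounded_op (R : realType) (H : normedModType R[i]) := BoundedOp {
  bounded_op_fun :> H -> H ;
  bounded_op_subproof : bounded_op_fun \in bounded_linear H }.

Section bounded_op_lmodule.
Context {R : realType} {H : normedModType R[i]}.
Local Notation L := (bounded_op H).

HB.instance Definition _ := [isSub of L for @bounded_op_fun R H].
HB.instance Definition _ := [Choice of L by <:].

Lemma bounded_linearP (T : H -> H) : T \in bounded_linear H ->
  linear T /\ exists2 M : R, 0 <= M & forall f, `|T f| <= M%:C * `|f|.
Proof.
move=> /set_mem[linT [M TM]]; split=> //; exists (complex.Re `|M|).
  by rewrite -lecR RRe_real ?normr_real// normr_ge0.
move=> f; rewrite RRe_real ?normr_real//.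
have Mf0 : 0 <= M * `|f| := le_trans (normr_ge0 _) (TM f).
by rewrite -(normr_id f) -normrM ger0_norm.
Qed.

Lemma bounded_linear_submod : submod_closed (bounded_linear H).
Proof.
split.
  apply/mem_set; split=> [a u v|]; first by rewrite /= scaler0 addr0.
  by exists 0 => f; rewrite normr0 mul0r.
move=> a S T /bounded_linearP[linS [M _ SM]] /bounded_linearP[linT [N _ TN]].
apply/mem_set; split=> [b u v|].
  rewrite !fctE linS linT !scalerDr !scalerA (mulrC a b) -!addrA.
  by congr (_ + _); rewrite addrCA.
exists (`|a| * M%:C + N%:C) => f; rewrite fctE.
rewrite (le_trans (ler_normD _ _))// mulrDl lerD// normrZ -mulrA.
exact: ler_wpM2l.
Qed.

HB.instance Definition _ :=
  GRing.isSubmodClosed.Build _ _ (bounded_linear H) bounded_linear_submod.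
HB.instance Definition _ := [SubChoice_isSubLmodule of L by <:].

Lemma bounded_op_linear (T : L) : linear T.
Proof. by have /bounded_linearP[] := bounded_op_subproof T. Qed.

HB.instance Definition _ (T : L) :=
  GRing.isLinear.Build R[i] H H *:%R T (@bounded_op_linear T).

Lemma bounded_op_ext (S T : L) : S =1 T -> S = T.
Proof. by move=> ST; apply/val_inj/funext. Qed.

End bounded_op_lmodule.

Section bounded_op_norm.
Context {R : realType} {H : normedModType R[i]}.
Local Notation L := (bounded_op H).
Implicit Types S T : L.

(* The norm of a normedModType over R[i] takes its values in R[i], hence the
   real part and the embedding. *)
Definition opnorm T : R[i] :=
  (sup [set complex.Re `|T f| | f in [set f | `|f| <= 1]])%:C.

Lemma opnorm_has_sup T :
  has_sup [set complex.Re `|T f| | f in [set f | `|f| <= 1]].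
Proof.
split; first by exists (complex.Re `|T 0|), 0 => //=; rewrite normr0.
have /bounded_linearP[_ [M M0 TM]] := bounded_op_subproof T.
exists M => _ [f /= f1 <-]; rewrite -lecR RRe_real ?normr_real//.
by rewrite (le_trans (TM f))// ler_piMr// lecR.
Qed.

Lemma opnorm_ge T f : `|T f| <= opnorm T * `|f|.
Proof.
have [->|f0] := eqVneq f 0; first by rewrite linear0 !normr0 mulr0.
rewrite -ler_pdivrMr ?normr_gt0// mulrC.
have -> : `|f|^-1 * `|T f| = `|T (`|f|^-1 *: f)|.
  by rewrite linearZ normrZ normfV normr_id.
rewrite -[leLHS](@RRe_real R) ?normr_real// lecR.
apply: (sup_upper_bound (opnorm_has_sup T)).
exists (`|f|^-1 *: f) => //=.
by rewrite normrZ normfV normr_id mulVf// normr_eq0.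
Qed.

Lemma opnorm_le T (M : R[i]) : 0 <= M ->
  (forall f, `|f| <= 1 -> `|T f| <= M) -> opnorm T <= M.
Proof.
move=> /ger0_real Mr TM; rewrite -(RRe_real Mr) lecR.
apply: ge_sup; first by case: (opnorm_has_sup T).
by move=> _ [f /= f1 <-]; rewrite -lecR !RRe_real ?normr_real ?TM.
Qed.

Lemma opnorm_ge0 T : 0 <= opnorm T.
Proof.
rewrite lecR; apply: (@le_trans _ _ (complex.Re `|T 0|)).
  by rewrite linear0 normr0.
by apply: (sup_upper_bound (opnorm_has_sup T)); exists 0 => //=; rewrite normr0.
Qed.

Lemma opnormD S T : opnorm (S + T) <= opnorm S + opnorm T.
Proof.
apply: opnorm_le => [|f f1]; first by rewrite addr_ge0 ?opnorm_ge0.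
rewrite (le_trans (ler_normD _ _))// lerD//.
- by rewrite (le_trans (opnorm_ge S f))// ler_piMr// opnorm_ge0.
- by rewrite (le_trans (opnorm_ge T f))// ler_piMr// opnorm_ge0.
Qed.

Lemma opnormZ_le (a : R[i]) T : opnorm (a *: T) <= `|a| * opnorm T.
Proof.
apply: opnorm_le => [|f f1]; first by rewrite mulr_ge0 ?opnorm_ge0.
rewrite normrZ ler_wpM2l// (le_trans (opnorm_ge T f))//.
by rewrite ler_piMr// opnorm_ge0.
Qed.

Lemma opnorm0_eq0 T : opnorm T = 0 -> T = 0.
Proof.
move=> T0; apply: bounded_op_ext => f; apply/eqP.
by rewrite -normr_le0 (le_trans (opnorm_ge T f))// T0 mul0r.
Qed.

Lemma opnormZ (a : R[i]) T : opnorm (a *: T) = `|a| * opnorm T.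
Proof.
apply/eqP; rewrite eq_le opnormZ_le/=.
have [->|a0] := eqVneq a 0; first by rewrite normr0 mul0r opnorm_ge0.
rewrite -ler_pdivlMl ?normr_gt0// -normfV.
by rewrite (le_trans _ (opnormZ_le _ _))// scalerA mulVf// scale1r.
Qed.

HB.instance Definition _ :=
  Lmodule_isNormed.Build R[i] L opnormD opnormZ opnorm0_eq0.

End bounded_op_norm.

Section bounded_op_ring.
Context {R : realType} {H : normedModType R[i]}.
Local Notation L := (bounded_op H).
Implicit Types S T : L.

Lemma bounded_linear_id : @idfun H \in bounded_linear H.
Proof. by apply/mem_set; split=> //; exists 1 => f; rewrite mul1r. Qed.

Lemma bounded_linear_comp S T : S \o T \in bounded_linear H.
Proof.
apply/mem_set; split=> [a u v|]; first by rewrite /= !linearP.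
exists (opnorm S * opnorm T) => f; rewrite /= (le_trans (opnorm_ge _ _))//.
by rewrite -mulrA ler_wpM2l ?opnorm_ge0// opnorm_ge.
Qed.

Definition op_one : L := BoundedOp bounded_linear_id.
Definition op_comp S T : L := BoundedOp (bounded_linear_comp S T).

Lemma op_compA : associative op_comp.
Proof. by move=> S T U; apply: bounded_op_ext. Qed.
Lemma op_comp1l : left_id op_one op_comp.
Proof. by move=> T; apply: bounded_op_ext. Qed.
Lemma op_comp1r : right_id op_one op_comp.
Proof. by move=> T; apply: bounded_op_ext. Qed.
Lemma op_compDl : left_distributive op_comp +%R.
Proof. by move=> S T U; apply: bounded_op_ext. Qed.
Lemma op_compDr : right_distributive op_comp +%R.
Proof. by move=> S T U; apply: bounded_op_ext => f /=; rewrite linearD. Qed.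

HB.instance Definition _ := GRing.Zmodule_isPzRing.Build L
  op_compA op_comp1l op_comp1r op_compDl op_compDr.

End bounded_op_ring.

Section krein.
Context {R : realType} {H : hilbertType R}.
Local Notation L := (bounded_op H).
Implicit Types (J T U Q : L) (S M N : set H).

(* The set below is a singleton, by the Riesz representation theorem. *)
Definition adjoint T : L :=
  xget 0 [set T' : L | forall f g, dotp (T f) g = dotp f (T' g)].

Definition symmetry J := J = adjoint J /\ J * J = 1.

Definition kdot J (f g : H) : R[i] := dotp (J f) g.

Definition Jadjoint J T : L := J * adjoint T * J.

Definition Jnormal_projection J : set L :=
  [set Q | Q * Q = Q /\ Q * Jadjoint J Q = Jadjoint J Q * Q].

Definition Junitary J : set L :=
  [set U | U * Jadjoint J U = 1 /\ Jadjoint J U * U = 1].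

Definition Jorbit J Q : set L :=
  [set U * Q * Jadjoint J U | U in Junitary J].

Definition subspace S := submod_closed (mem S).

Definition Jorthocomp J S : set H :=
  [set f | forall g, S g -> kdot J f g = 0].

Definition isotropic_part J S : set H := S `&` Jorthocomp J S.

Definition Jdirect_sum J M N S :=
  [/\ forall f g, M f -> N g -> kdot J f g = 0, M `&` N = [set 0] &
      S = [set f + g | f in M & g in N]].

Definition regular J M :=
  [/\ subspace M, closed M & Jdirect_sum J M (Jorthocomp J M) setT].

Definition uniformly_positive J M := exists2 c : R, 0 < c &
  forall f, M f -> c%:C * `|f| ^+ 2 <= kdot J f f.

Definition uniformly_negative J M := exists2 c : R, 0 < c &
  forall f, M f -> c%:C * `|f| ^+ 2 <= - kdot J f f.

Definition linear_span (B : set H) : set H := smallest subspace B.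

Definition orthonormal_set (B : set H) :=
  (forall f, B f -> dotp f f = 1) /\
  (forall f g, B f -> B g -> f != g -> dotp f g = 0).

Definition orthonormal_basis M (B : set H) :=
  orthonormal_set B /\ closure (linear_span B) = M.

(* All infinite orthonormal bases have the value +oo here: this is the Hilbert
   dimension only when the ambient space is separable. *)
Definition hilbert_dim M : \bar R :=
  counting (xget set0 [set B | orthonormal_basis M B]).

Definition signature_decomposition J S Mp Mn :=
  [/\ subspace Mp /\ uniformly_positive J Mp,
      subspace Mn /\ uniformly_negative J Mn &
      exists M, [/\ Jdirect_sum J Mp Mn M, regular J M &
                    Jdirect_sum J (isotropic_part J S) M S]].

(* A decomposition exists when S is pseudo-regular; the dimensions of its
   components do not depend on the choice made here. *)
Definition definite_parts J S : set H * set H :=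
  xget (set0, set0) [set M | signature_decomposition J S M.1 M.2].

Definition kappa_pos J S := hilbert_dim (definite_parts J S).1.
Definition kappa_neg J S := hilbert_dim (definite_parts J S).2.
Definition kappa_iso J S := hilbert_dim (isotropic_part J S).
Definition cokappa_pos J S := kappa_pos J (Jorthocomp J S).
Definition cokappa_neg J S := kappa_neg J (Jorthocomp J S).

End krein.

(* Main.v *)
(* A J-normal projection Q is determined by the commuting projections Q and Q^#:
   with E = Q Q^#, P = Q (1 - Q^#) and F = (1 - Q) (1 - Q^#), the identity is the
   sum of E, P, P^# and F, where E and F are J-selfadjoint and P has the neutral
   range R(Q)^o.  The J-selfadjoint E splits as E+ + E- along the spectral
   projections of the Hilbert selfadjoint operator E J, and likewise F; these
   ranges realize the signatures of R(Q) and of R(Q)^[perp] = R(1 - Q^#).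

   Signatures only distinguish finite dimensions, so they are compared by counting
   independent vectors; two uniformly definite closed subspaces of equal dimension
   are J-isometric through Gram-Schmidt bases for the form [., .].  Together with
   any isomorphism V between the neutral ranges and the J-adjoint of V^-1, such
   isometries add up to a J-unitary conjugating Q0 to Q.

   The orbit is connected because every J-unitary is a product of three J-unitaries
   with nonnegative real part, each joined to 1 by a Cayley path; it is open in the
   set of J-normal projections because, for Q close to Q0, the intertwiner
   E E0 + P P0 + P^# P0^# + F F0 is close to 1 and has a J-unitary part.  Orbits
   being open, each is also closed. *)

Require Import Defs.
From mathcomp Require Import all_boot all_order all_algebra.
From mathcomp Require Import complex.
From mathcomp Require Import all_classical all_reals all_analysis.
From mathcomp Require Import ring lra.

Set Implicit Arguments.
Unset Strict Implicit.
Unset Printing Implicit Defensive.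

Import Order.TTheory GRing.Theory Num.Theory.
Import numFieldNormedType.Exports.
Import Defs.

Local Open Scope classical_set_scope.
Local Open Scope card_scope.
Local Open Scope complex_scope.
Local Open Scope ring_scope.

(** * Norms, projections and Riesz representation *)

Section RealNorm.
Context {R : realType}.

(** All spectral theory is drawn from one construction: the square root of an operator within
    distance 1 of the identity, obtained as a limit of polynomials, so that it inherits commutation
    and [J]-selfadjointness. It serves twice: for [adjoint S * S], suitably scaled, it gives the
    modulus, hence signs and polar decompositions; for [G^# * G] near 1 it gives the [J]-unitary
    part of an intertwiner, where no Hilbert positivity is at hand.

    Positivity of a modulus [D] is carried in the form [c * nm (D f) ^+ 2 <= rdot (D f) f]. This
    yields [D f = 0] as soon as [rdot (D f) f] vanishes, and on vectors [D h] it is exactly the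
    uniform definiteness that signatures require.

    A conjugation by a [J]-unitary that carries [Q0] to [Q] carries [Q0^#] to [Q^#] as well. An
    intertwiner must therefore respect two idempotents at once, which a single sum of corners does
    not; nesting two such sums does, because each projection commutes with its [J]-adjoint.

    The projection [1 - Q^#] is [J]-normal too, with range R(Q)^[perp], so cosignatures need no
    argument of their own. *)

Lemma monotone_bounded_cauchy (s : nat -> R) b :
  {homo s : m n / (m <= n)%N >-> m <= n} -> (forall n, s n <= b) ->
  forall e, 0 < e -> exists N, forall m n, (N <= m)%N -> s n - s m < e.
Proof.
move=> smono sb e e0.
have hs : has_sup [set s n | n in setT].
  by split; [exists (s 0), 0%N | exists b => _ [n _ <-]].
have [_ [N _ <-] sN] := sup_adherent e0 hs.
exists N => m n Nm; have := smono _ _ Nm.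
have : s n <= sup [set s n | n in setT] by apply: (sup_upper_bound hs); exists n.
by move: sN; move: (sup _) (s N) (s m) (s n) => *; lra.
Qed.

Lemma natSinv_small (e : R) : 0 < e ->
  exists N, forall n, (N <= n)%N -> n.+1%:R^-1 < e.
Proof.
move=> e0; have [N _ NP] := near_infty_natSinv_lt (PosNum e0).
by exists N => n /NP.
Qed.

(* The norm of a normedModType over R[i] is R[i]-valued; this is its value in
   R. *)
Definition nm (V : normedModType R[i]) (x : V) : R := complex.Re `|x|.

Section NormedModule.
Context {V : normedModType R[i]}.
Implicit Types x y : V.

Lemma nmE x : `|x| = (nm x)%:C.
Proof. by rewrite /nm RRe_real ?normr_real. Qed.

Lemma nm_ge0 x : 0 <= nm x.
Proof. by rewrite -lecR -nmE normr_ge0. Qed.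

Lemma nm0 : nm (0 : V) = 0.
Proof. by rewrite /nm normr0. Qed.

Lemma nmN x : nm (- x) = nm x.
Proof. by rewrite /nm normrN. Qed.

Lemma nmBC x y : nm (x - y) = nm (y - x).
Proof. by rewrite /nm distrC. Qed.

Lemma nmD x y : nm (x + y) <= nm x + nm y.
Proof. by rewrite -lecR rmorphD /= -!nmE ler_normD. Qed.

Lemma nmB x y : nm (x - y) <= nm x + nm y.
Proof. by rewrite (le_trans (nmD _ _)) // nmN. Qed.

Lemma nmBD x y z : nm (x - z) <= nm (x - y) + nm (y - z).
Proof. by rewrite (le_trans _ (nmD _ _)) // addrA subrK. Qed.

Lemma nm_eq0 x : nm x = 0 -> x = 0.
Proof. by move=> h; apply/eqP; rewrite -normr_eq0 nmE h. Qed.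

Lemma nm_small x : (forall e : R, 0 < e -> nm x <= e) -> x = 0.
Proof.
move=> h; apply: nm_eq0; apply/eqP; rewrite eq_le nm_ge0 andbT.
by apply/ler_addgt0Pr => e e0; rewrite add0r h.
Qed.

Lemma nm_closureP (A : set V) x :
  closure A x <-> forall e : R, 0 < e -> exists2 y, A y & nm (x - y) < e.
Proof.
split=> [cA e e0|h B].
  have := cA (ball x e%:C) (nbhsx_ballx _ _ _).
  rewrite ltcR => /(_ e0)[y [Ay]]; rewrite -ball_normE /= => xy.
  by exists y => //; rewrite -ltcR -nmE.
move=> /nbhs_ballP[e /= e0 eB].
have eR : e = (complex.Re e)%:C by rewrite RRe_real// gtr0_real.
have [|y Ay xy] := h (complex.Re e); first by rewrite -ltcR -eR.
by exists y; split=> //; apply: eB; rewrite -ball_normE /= nmE eR ltcR.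
Qed.

Lemma nm_closed (A : set V) x : closed A ->
  (forall e : R, 0 < e -> exists2 y, A y & nm (x - y) < e) -> A x.
Proof. by move=> + /nm_closureP; apply. Qed.

Definition ncvg (u : nat -> V) x :=
  forall e : R, 0 < e -> exists N, forall n, (N <= n)%N -> nm (u n - x) < e.

Definition ncauchy (u : nat -> V) :=
  forall e : R, 0 < e ->
  exists N, forall m n, (N <= m)%N -> (N <= n)%N -> nm (u m - u n) < e.

Lemma nm_cvg_bound (u : nat -> V) x (b : R) y N : ncvg u x ->
  (forall n, (N <= n)%N -> nm (u n - y) <= b) -> nm (x - y) <= b.
Proof.
move=> ux ub; apply/ler_addgt0Pr => e /ux[M uM].
have := nmBD x (u (maxn N M)) y.
have := ub (maxn N M) (leq_maxl _ _).
by have := uM (maxn N M) (leq_maxr _ _); rewrite nmBC; lra.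
Qed.

Lemma ncvg_uniq (u : nat -> V) x y : ncvg u x -> ncvg u y -> x = y.
Proof.
move=> ux uy; apply/eqP; rewrite -subr_eq0; apply/eqP/nm_small => e /uy[N uN].
by apply: (@nm_cvg_bound u x e y N ux) => n /uN /ltW.
Qed.

Lemma ncvgD (u v : nat -> V) x y : ncvg u x -> ncvg v y ->
  ncvg (fun n => u n + v n) (x + y).
Proof.
move=> ux vy e e0; have e2 : 0 < e / 2 by lra.
have [N uN] := ux _ e2; have [M vM] := vy _ e2.
exists (maxn N M) => n; rewrite geq_max => /andP[/uN ? /vM ?].
by have := nmD (u n - x) (v n - y); rewrite addrACA -opprD; lra.
Qed.

Lemma nmZ (a : R[i]) x : nm (a *: x) = complex.Re `|a| * nm x.
Proof.
by rewrite /nm normrZ nmE -[X in X * _](@RRe_real R) ?normr_real// -rmorphM /=.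
Qed.

Lemma Re_norm_ge0 (a : R[i]) : 0 <= complex.Re `|a|.
Proof. by rewrite -lecR RRe_real ?normr_real ?normr_ge0. Qed.

Lemma nmZR (a : R) x : nm (a%:C *: x) = `|a| * nm x.
Proof.
rewrite nmZ; congr (_ * _).
have -> : `|a%:C| = (`|a|)%:C :> R[i] by rewrite normc_def /= expr0n addr0 sqrtr_sqr.
by [].
Qed.

Lemma ncvgZ (a : R[i]) (u : nat -> V) x : ncvg u x ->
  ncvg (fun n => a *: u n) (a *: x).
Proof.
move=> ux e e0; have a0 := Re_norm_ge0 a.
have a1 : 0 < complex.Re `|a| + 1 by lra.
have [N uN] := ux (e / (complex.Re `|a| + 1)) (divr_gt0 e0 a1).
exists N => n /uN; rewrite -scalerBr nmZ ltr_pdivlMr // => h.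
by have := nm_ge0 (u n - x); nra.
Qed.

Lemma ncvg_ext (u v : nat -> V) x : u =1 v -> ncvg u x -> ncvg v x.
Proof. by move=> uv ux e /ux[N uN]; exists N => n /uN; rewrite uv. Qed.

Lemma ncvg_cst x : ncvg (fun=> x) x.
Proof. by move=> e e0; exists 0%N => n _; rewrite subrr nm0. Qed.

Lemma ncvgS (u : nat -> V) x : ncvg u x -> ncvg (fun n => u n.+1) x.
Proof. by move=> ux e /ux[N uN]; exists N => n Nn; apply/uN/leqW. Qed.

Lemma ncvg_le (u : nat -> V) x (b : R) :
  ncvg u x -> (forall n, nm (u n) <= b) -> nm x <= b.
Proof.
move=> ux ub; have := @nm_cvg_bound u x b 0 0 ux; rewrite subr0; apply.
by move=> n _; rewrite subr0.
Qed.

End NormedModule.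

Lemma nm_complete (V : completeNormedModType R[i]) (u : nat -> V) :
  ncauchy u -> exists x, ncvg u x.
Proof.
move=> cu; have : cvg (u @ \oo).
  apply/cauchy_cvgP/cauchy_exP => e e0.
  have eR : e = (complex.Re e)%:C by rewrite RRe_real// gtr0_real.
  have [|N uN] := cu (complex.Re e); first by rewrite -ltcR -eR.
  exists (u N); exists N => // n /= Nn.
  by rewrite -ball_normE /= nmE eR ltcR uN.
move=> /cvgrPdist_lt ux; exists (lim (u @ \oo)) => e e0.
have [|N _ uN] := ux e%:C; first by rewrite ltcR.
by exists N => n /uN; rewrite /= distrC nmE ltcR.
Qed.

End RealNorm.

Section Inner.
Context {R : realType} {H : hilbertType R}.
Implicit Types (f g h : H) (a : R[i]).

Lemma dotC f g : dotp f g = (dotp g f)^*%C.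
Proof. by rewrite (hermC (@dotp R H)) expr0 mul1r. Qed.
Lemma dot0l f : dotp 0 f = 0. Proof. exact: linear0l. Qed.
Lemma dot0r f : dotp f 0 = 0. Proof. exact: linear0r. Qed.
Lemma dotDl f g h : dotp (f + g) h = dotp f h + dotp g h.
Proof. exact: linearDl. Qed.
Lemma dotDr f g h : dotp h (f + g) = dotp h f + dotp h g.
Proof. exact: linearDr. Qed.
Lemma dotNl f h : dotp (- f) h = - dotp f h. Proof. exact: linearNl. Qed.
Lemma dotNr f h : dotp h (- f) = - dotp h f. Proof. exact: linearNr. Qed.
Lemma dotBl f g h : dotp (f - g) h = dotp f h - dotp g h.
Proof. exact: linearBl. Qed.
Lemma dotBr f g h : dotp h (f - g) = dotp h f - dotp h g.
Proof. exact: linearBr. Qed.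
Lemma dotZl a f g : dotp (a *: f) g = a * dotp f g.
Proof. exact: linearZl_LR. Qed.
Lemma dotZr a f g : dotp f (a *: g) = a^*%C * dotp f g.
Proof. exact: linearZr_LR. Qed.

Definition rdot f g : R := complex.Re (dotp f g).
Definition mc a : R := complex.Re `|a|.

Lemma mcE a : `|a| = (mc a)%:C. Proof. by rewrite /mc RRe_real ?normr_real. Qed.
Lemma mc_ge0 a : 0 <= mc a. Proof. by rewrite -lecR -mcE normr_ge0. Qed.
Lemma mc2E a : a * a^*%C = (mc a ^+ 2)%:C.
Proof. by rewrite rmorphXn /= -mcE normCK. Qed.
Lemma mc_eq0 a : mc a = 0 -> a = 0.
Proof. by move=> h; apply/eqP; rewrite -normr_eq0 mcE h. Qed.
Lemma Re_le_mc a : complex.Re a <= mc a.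
Proof.
case: a => x y; rewrite /mc normc_def /=.
by rewrite (le_trans (ler_norm x)) // -sqrtr_sqr ler_wsqrtr // lerDl sqr_ge0.
Qed.
Lemma mcN a : mc (- a) = mc a. Proof. by rewrite /mc normrN. Qed.
Lemma mcD a b : mc (a + b) <= mc a + mc b.
Proof. by rewrite -lecR rmorphD /= -!mcE ler_normD. Qed.
Lemma mcM a b : mc (a * b) = mc a * mc b.
Proof. by apply: complexI; rewrite rmorphM /= -!mcE normrM. Qed.

Lemma dotpE' f : dotp f f = (nm f ^+ 2)%:C.
Proof. by rewrite dotpE nmE -rmorphXn. Qed.
Lemma rdotE f : rdot f f = nm f ^+ 2. Proof. by rewrite /rdot dotpE'. Qed.
Lemma rdotC f g : rdot f g = rdot g f.
Proof. by rewrite /rdot dotC; case: (dotp g f). Qed.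
Lemma rdotDl f g h : rdot (f + g) h = rdot f h + rdot g h.
Proof. by rewrite /rdot dotDl raddfD. Qed.
Lemma rdotDr f g h : rdot h (f + g) = rdot h f + rdot h g.
Proof. by rewrite /rdot dotDr raddfD. Qed.
Lemma rdotNl f h : rdot (- f) h = - rdot f h.
Proof. by rewrite /rdot dotNl raddfN. Qed.
Lemma rdotNr f h : rdot h (- f) = - rdot h f.
Proof. by rewrite /rdot dotNr raddfN. Qed.
Lemma rdot0l f : rdot 0 f = 0. Proof. by rewrite /rdot dot0l. Qed.
Lemma rdot0r f : rdot f 0 = 0. Proof. by rewrite /rdot dot0r. Qed.
Lemma rdotZl (t : R) f g : rdot (t%:C *: f) g = t * rdot f g.
Proof. by rewrite /rdot dotZl; case: (dotp f g) => x y /=; rewrite mul0r subr0. Qed.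

Lemma nmD2 f g : nm (f + g) ^+ 2 = nm f ^+ 2 + nm g ^+ 2 + 2 * rdot f g.
Proof. by rewrite -!rdotE rdotDl !rdotDr [rdot g f]rdotC; ring. Qed.
Lemma nmB2 f g : nm (f - g) ^+ 2 = nm f ^+ 2 + nm g ^+ 2 - 2 * rdot f g.
Proof. by rewrite nmD2 nmN rdotNr; ring. Qed.
Lemma parallelogram f g :
  nm (f + g) ^+ 2 + nm (f - g) ^+ 2 = 2 * nm f ^+ 2 + 2 * nm g ^+ 2.
Proof. by rewrite nmD2 nmB2; ring. Qed.

(** Serves twice: [t = nm g ^- 2] gives Cauchy-Schwarz, [t = (nm g ^+ 2 + 1)^-1] gives the
    orthogonality of a minimiser. *)
Lemma nm_proj (t : R) f g (z := dotp f g) :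
  nm (f - (t%:C * z) *: g) ^+ 2 =
  nm f ^+ 2 - 2 * t * mc z ^+ 2 + t ^+ 2 * mc z ^+ 2 * nm g ^+ 2.
Proof.
rewrite nmB2 nmZ -/(mc _) exprMn.
have -> : rdot f ((t%:C * z) *: g) = t * mc z ^+ 2.
  rewrite /rdot dotZr rmorphM /= -mulrA -/z [_^* * z]mulrC mc2E.
  by simpc.
rewrite mcM exprMn.
suff -> : mc t%:C ^+ 2 = t ^+ 2 by ring.
by apply: complexI; rewrite -mc2E rmorphXn /= expr2; simpc.
Qed.

Lemma cauchy_schwarz f g : mc (dotp f g) <= nm f * nm g.
Proof.
have [g0|g0] := eqVneq (nm g) 0.
  by rewrite (nm_eq0 g0) dot0r nm0 /mc normr0 mulr0.
have gp : 0 < nm g by rewrite lt0r g0 nm_ge0.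
rewrite -(@ler_pXn2r _ 2) ?nnegrE ?mulr_ge0 ?nm_ge0 ?mc_ge0 // exprMn.
rewrite -ler_pdivrMr ?exprn_gt0 // -subr_ge0.
have := sqr_ge0 (nm (f - ((nm g ^- 2)%:C * dotp f g) *: g)).
rewrite nm_proj; congr (0 <= _); by field.
Qed.

Lemma rdot_le f g : rdot f g <= nm f * nm g.
Proof. exact: le_trans (Re_le_mc _) (cauchy_schwarz f g). Qed.

Lemma dot_eq0_min f g : (forall a, nm f <= nm (f - a *: g)) -> dotp f g = 0.
Proof.
move=> fmin; apply: mc_eq0; set z := dotp f g.
have g1 : 0 < nm g ^+ 2 + 1 by rewrite ltr_wpDl ?sqr_ge0.
(* The cost [t ^+ 2 * nm g ^+ 2 = t - t ^+ 2] stays below the gain [2 * t]; the added 1 covers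
   [g = 0]. *)
pose t := (nm g ^+ 2 + 1)^-1.
have t0 : 0 < t by rewrite invr_gt0.
have := fmin (t%:C * z).
rewrite -(@ler_pXn2r _ 2) ?nnegrE ?nm_ge0 // nm_proj -/z.
have -> : nm g ^+ 2 = t^-1 - 1 by rewrite invrK addrK.
have -> : t ^+ 2 * mc z ^+ 2 * (t^-1 - 1) = (t - t^+2) * mc z ^+ 2.
  by field; rewrite gt_eqF.
have := sqr_ge0 (mc z) => h h'.
have : mc z ^+ 2 <= 0 by nra.
by rewrite real_exprn_even_le0 ?num_real //= => /eqP.
Qed.

Lemma subspace0 (M : set H) : subspace M -> M 0.
Proof. by case=> /set_mem. Qed.
Lemma subspaceZD (M : set H) a f g : subspace M -> M f -> M g -> M (a *: f + g).
Proof. by case=> _ h /mem_set Mf /mem_set Mg; apply/set_mem/h. Qed.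
Lemma subspaceZ (M : set H) a f : subspace M -> M f -> M (a *: f).
Proof. by move=> sM Mf; rewrite -[_ *: _]addr0; apply: subspaceZD => //; exact: subspace0. Qed.
Lemma subspaceD (M : set H) f g : subspace M -> M f -> M g -> M (f + g).
Proof. by move=> sM Mf; rewrite -[f]scale1r; exact: subspaceZD. Qed.
Lemma subspaceN (M : set H) f : subspace M -> M f -> M (- f).
Proof. by move=> sM Mf; rewrite -scaleN1r; exact: subspaceZ. Qed.
Lemma subspaceB (M : set H) f g : subspace M -> M f -> M g -> M (f - g).
Proof. by move=> sM Mf Mg; apply: subspaceD => //; exact: subspaceN. Qed.
Lemma mk_subspace (M : set H) : M 0 ->
  (forall a f g, M f -> M g -> M (a *: f + g)) -> subspace M.
Proof.
move=> M0 MD; split; first exact/mem_set.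
by move=> a f g /set_mem Mf /set_mem Mg; apply/mem_set/MD.
Qed.

Lemma orthogonal_projection (M : set H) f : subspace M -> closed M ->
  exists2 g, M g & forall h, M h -> dotp (f - g) h = 0.
Proof.
move=> sM cM; have M0 := subspace0 sM.
pose D := [set nm (f - g) ^+ 2 | g in M].
have hD : has_inf D.
  split; first by exists (nm (f - 0) ^+ 2), 0.
  by exists 0 => _ [g _ <-]; exact: sqr_ge0.
have dle g : M g -> inf D <= nm (f - g) ^+ 2.
  by move=> Mg; apply: ge_inf; [case: hD | exists g].
have d0 : 0 <= inf D.
  by apply: lb_le_inf; [case: hD | move=> _ [g _ <-]; exact: sqr_ge0].
have /choice[u uP] n : exists g, M g /\ nm (f - g) ^+ 2 < inf D + n.+1%:R^-1.
  have [|_ [g Mg <-] ?] := @inf_adherent _ D n.+1%:R^-1 _ hD; last by exists g.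
  by rewrite invr_gt0 ltr0Sn.
have sqr_lt (x e : R) : 0 < e -> x ^+ 2 < e ^+ 2 -> x < e.
  by move=> e0 ?; nra.
have [g ug] : exists g, ncvg u g.
  apply: nm_complete => e e0.
  (* The midpoint of [u m] and [u n] lies in [M], so the parallelogram law bounds
     [nm (u m - u n) ^+ 2] by 2/(m+1) + 2/(n+1); hence the 4. *)
  have [|N NP] := @natSinv_small R (e ^+ 2 / 4); first by rewrite divr_gt0 ?exprn_gt0.
  exists N => m n /NP mN /NP nN; apply: sqr_lt => //.
  have [[Mm um] [Mn un]] := (uP m, uP n).
  have := parallelogram (f - u m) (f - u n).
  have -> : f - u m - (f - u n) = - (u m - u n).
    by rewrite !opprB addrC addrA subrK.
  have -> : f - u m + (f - u n) = 2%:C *: (f - 2^-1%:C *: (u m + u n)).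
    rewrite scalerBr scalerA -rmorphM /= divff ?pnatr_eq0 // scale1r.
    by rewrite addrACA -opprD rmorphMn /= scaler_nat.
  have := dle (2^-1%:C *: (u m + u n)) (subspaceZ _ sM (subspaceD sM Mm Mn)).
  rewrite nmN nmZR exprMn; have -> : `|2 : R| ^+ 2 = 4 by rewrite ger0_norm //; ring.
  move: um un mN nN.
  move: (nm (f - u m) ^+ 2) (nm (f - u n) ^+ 2) (nm (u m - u n) ^+ 2) => x y z.
  move: (nm (f - _) ^+ 2) => t.
  move: (m.+1%:R^-1) (n.+1%:R^-1) (inf D) (e ^+ 2) => *; lra.
have Mg : M g.
  apply: (nm_closed cM) => e /ug[N /(_ N (leqnn N)) uN].
  by exists (u N); [case: (uP N) | rewrite nmBC].
exists g => // h Mh; apply: dot_eq0_min => a.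
rewrite -[_ - _ - _]addrA -opprD.
apply/ler_addgt0Pr => e e0.
have e2 : 0 < e / 2 by lra.
have [N1 N1P] := ug _ e2.
have [|N2 N2P] := @natSinv_small R ((e / 2) ^+ 2); first exact: exprn_gt0.
have N1u := N1P _ (leq_maxl N1 N2); have N2u := N2P _ (leq_maxr N1 N2).
have [Mu uu] := uP (maxn N1 N2).
have := dle (g + a *: h) (subspaceD sM Mg (subspaceZ _ sM Mh)).
have := nmBD f (u (maxn N1 N2)) g.
move: N1u N2u uu; set w := u _; move: ((maxn N1 N2).+1%:R^-1) => b.
have := nm_ge0 (f - w); have := nm_ge0 (f - (g + a *: h)).
move: (nm (f - w)) (nm (w - g)) (nm (f - g)) (nm (f - (g + a *: h))) (inf D).
move=> B C F A d A0 B0 hC hb hB hF hd.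
have ? : B < A + e / 2.
  apply: sqr_lt; first lra.
  have -> : (A + e / 2) ^+ 2 = A ^+ 2 + (e / 2) ^+ 2 + A * e by field.
  have := mulr_ge0 A0 (ltW e0); move: hb hB hd; move: (A * e) (A ^+ 2) (B ^+ 2) ((e / 2) ^+ 2).
  by move=> *; lra.
lra.
Qed.

Lemma closed_subspace_dense (M : set H) : subspace M -> closed M ->
  (forall f, (forall g, M g -> dotp f g = 0) -> f = 0) -> forall f, M f.
Proof.
move=> sM cM h f; have [g Mg fg] := orthogonal_projection f sM cM.
by move: Mg; rewrite -(subr0_eq (h _ fg)).
Qed.

(** Continuity of [phi] enters through its closed kernel: the representing vector is a multiple of
    the component of some [x] orthogonal to that kernel. *)
Lemma riesz (phi : H -> R[i]) :
  (forall a f g, phi (a *: f + g) = a * phi f + phi g) ->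
  closed [set f | phi f = 0] -> exists g, forall f, phi f = dotp f g.
Proof.
move=> lin cK.
have phi0 : phi 0 = 0.
  by have := lin 1 0 0; rewrite scaler0 addr0 mul1r => /eqP; rewrite -subr_eq subrr => /eqP.
have sK : subspace [set f | phi f = 0].
  by apply: mk_subspace => //= a f g pf pg; rewrite lin pf pg mulr0 addr0.
have [K|/existsNP[x xK]] := pselect (forall f, phi f = 0).
  by exists 0 => f; rewrite K dot0r.
have [y Ky xy] := orthogonal_projection x sK cK.
set z := x - y in xy.
have pz : phi z != 0.
  by rewrite /z addrC -scaleN1r lin Ky mulr0 add0r; apply/eqP.
have z0 : nm z ^+ 2 != 0.
  rewrite sqrf_eq0; apply: contra_neq pz => /nm_eq0 ->; exact: phi0.
have z0C : (nm z ^+ 2)%:C != 0 by rewrite (inj_eq (@complexI R)).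
exists ((phi z / (nm z ^+ 2)%:C)^*%C *: z) => f.
have : dotp z (f - (phi f / phi z) *: z) = 0.
  by apply: xy => /=; rewrite addrC -scaleNr lin mulNr divfK // addNr.
rewrite dotC => /(congr1 (@conjc R)); rewrite conjcK conjc0 dotBl dotZl.
move/subr0_eq => e; rewrite dotZr conjcK e dotpE'.
by move: (_%:C) z0C => N z0C; field; rewrite pz z0C.
Qed.

End Inner.

(** * Bounded operators *)

Section Operators.
Context {R : realType} {H : hilbertType R}.
Local Notation L := (bounded_op H).
Implicit Types (S T U X Y : L) (f g h : H) (a : R[i]).

Lemma opnm_ge T f : nm (T f) <= nm T * nm f.
Proof.
have := opnorm_ge T f; rewrite -[opnorm T]/(`|T|) !nmE -rmorphM /=.
by rewrite lecR.
Qed.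

Lemma opnm_le T (M : R) : 0 <= M -> (forall f, nm (T f) <= M * nm f) -> nm T <= M.
Proof.
move=> M0 TM; rewrite -lecR -nmE -[`|T|]/(opnorm T).
apply: opnorm_le => [|f]; first by rewrite lecR.
rewrite !nmE => f1; rewrite lecR (le_trans (TM f)) // ler_piMr //.
by move: f1; rewrite lecR.
Qed.

Lemma opnmM S T : nm (S * T) <= nm S * nm T.
Proof.
apply: opnm_le => [|f]; first by rewrite mulr_ge0 ?nm_ge0.
by rewrite (le_trans (opnm_ge S (T f))) // -mulrA ler_wpM2l ?nm_ge0 // opnm_ge.
Qed.

Lemma opnm1 : nm (1 : L) <= 1.
Proof. by apply: opnm_le => // f; rewrite mul1r. Qed.

Lemma bounded_op_of (F : H -> H) (M : R) : linear F ->
  (forall f, nm (F f) <= M * nm f) -> exists T : L, forall f, T f = F f.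
Proof.
move=> lF FM; suff FL : F \in bounded_linear H by exists (BoundedOp FL).
apply/mem_set; split=> //; exists M%:C => f.
by rewrite !nmE -rmorphM /= lecR.
Qed.

Lemma op0E f : (0 : L) f = 0. Proof. by []. Qed.
Lemma op1E f : (1 : L) f = f. Proof. by []. Qed.
Lemma opDE S T f : (S + T) f = S f + T f. Proof. by []. Qed.
Lemma opNE T f : (- T) f = - T f. Proof. by []. Qed.
Lemma opBE S T f : (S - T) f = S f - T f. Proof. by []. Qed.
Lemma opME S T f : (S * T) f = S (T f). Proof. by []. Qed.
Lemma opZE a T f : (a *: T) f = a *: T f. Proof. by []. Qed.
Definition opE := (op0E, op1E, opDE, opNE, opME, opZE).

Lemma opZl a S T : (a *: S) * T = a *: (S * T).
Proof. exact: bounded_op_ext. Qed.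
Lemma opZr a S T : S * (a *: T) = a *: (S * T).
Proof. by apply: bounded_op_ext => f; rewrite !opE linearZ. Qed.

Lemma op_ncvg T (u : nat -> H) f : ncvg u f -> ncvg (fun n => T (u n)) (T f).
Proof.
move=> uf e e0; have T0 := nm_ge0 T; have T1 : 0 < nm T + 1 by lra.
have [N uN] := uf (e / (nm T + 1)) (divr_gt0 e0 T1).
exists N => n /uN; rewrite -linearB ltr_pdivlMr // => h.
by have := opnm_ge T (u n - f); have := nm_ge0 (u n - f); nra.
Qed.

Lemma dot_injr f g : (forall h, dotp h f = dotp h g) -> f = g.
Proof.
move=> fg; apply: subr0_eq; apply: nm_eq0; apply/eqP.
by rewrite -sqrf_eq0 -rdotE /rdot dotBr fg subrr.
Qed.

Lemma dot_injl f g : (forall h, dotp f h = dotp g h) -> f = g.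
Proof. by move=> fg; apply: dot_injr => h; rewrite dotC fg -dotC. Qed.

(** Covers three cases: the functionals fed to Riesz ([B] a singleton), kernels ([B] everything) and
    [J]-orthogonal complements ([T = J]). *)
Lemma closed_dot_op T (B : set H) :
  closed [set f | forall g, B g -> dotp (T f) g = 0].
Proof.
move=> f /nm_closureP cf g Bg; apply: mc_eq0; apply/eqP.
rewrite eq_le mc_ge0 andbT; apply/ler_addgt0Pr => e e0; rewrite add0r.
have T0 := nm_ge0 T; have g0 := nm_ge0 g.
have Tg : 0 < nm T * nm g + 1 by nra.
have [h hK fh] := cf (e / (nm T * nm g + 1)) (divr_gt0 e0 Tg).
have -> : dotp (T f) g = dotp (T (f - h)) g by rewrite linearB dotBl hK // subr0.
apply: le_trans (cauchy_schwarz _ _) _.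
move: fh; rewrite ltr_pdivlMr // => fh.
apply: le_trans (ler_wpM2r g0 (opnm_ge T _)) _.
have := nm_ge0 (f - h); move: fh T0 g0 {Tg}.
move: (nm (f - h)) (nm T) (nm g) => x t y; rewrite mulrDr mulr1 mulrA [x * t]mulrC.
by move: (_ * y) => *; lra.
Qed.

Lemma adjoint_ex T : exists T', forall f g, dotp (T f) g = dotp f (T' g).
Proof.
have /choice[F FP] g : exists g', forall f, dotp (T f) g = dotp f g'.
  apply: riesz => [a f h|].
    by rewrite linearP dotDl dotZl.
  have := @closed_dot_op T [set g]; congr closed; apply/seteqP; split=> f /=.
    by apply.
  by move=> h _ ->.
have [||T' T'E] := @bounded_op_of F (nm T).
- move=> a f g; apply: dot_injr => h.
  by rewrite -FP !dotDr !dotZr -!FP.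
- move=> f; have [F0|F0] := eqVneq (nm (F f)) 0.
    by rewrite F0 mulr_ge0 ?nm_ge0.
  have Fp : 0 < nm (F f) by rewrite lt0r F0 nm_ge0.
  rewrite -(ler_pM2l Fp) -expr2 -rdotE /rdot -FP.
  rewrite (le_trans (rdot_le (T (F f)) f)) // mulrCA mulrA ler_wpM2r ?nm_ge0 //.
  exact: opnm_ge.
by exists T' => f g; rewrite T'E.
Qed.

Lemma adjopE T f g : dotp (T f) g = dotp f (adjoint T g).
Proof.
rewrite /adjoint; case: xgetP => [T' _ /= -> //|].
by have [T' T'P] := adjoint_ex T => /(_ T')[].
Qed.

Lemma adjopE' T f g : dotp f (T g) = dotp (adjoint T f) g.
Proof. by rewrite dotC adjopE -dotC. Qed.

Lemma adjop_uniq T T' : (forall f g, dotp (T f) g = dotp f (T' g)) -> adjoint T = T'.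
Proof.
by move=> h; apply: bounded_op_ext => g; apply: dot_injr => f; rewrite -adjopE.
Qed.

Lemma adjopK T : adjoint (adjoint T) = T.
Proof. by apply: adjop_uniq => f g; rewrite adjopE'. Qed.
Lemma adjopM S T : adjoint (S * T) = adjoint T * adjoint S.
Proof. by apply: adjop_uniq => f g; rewrite !opE !adjopE. Qed.
Lemma adjopD S T : adjoint (S + T) = adjoint S + adjoint T.
Proof. by apply: adjop_uniq => f g; rewrite !opE dotDl dotDr !adjopE. Qed.
Lemma adjopN T : adjoint (- T) = - adjoint T.
Proof. by apply: adjop_uniq => f g; rewrite !opE dotNl dotNr !adjopE. Qed.
Lemma adjopB S T : adjoint (S - T) = adjoint S - adjoint T.
Proof. by rewrite adjopD adjopN. Qed.
Lemma adjop1 : adjoint (1 : L) = 1. Proof. exact: adjop_uniq. Qed.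
Lemma adjop0 : adjoint (0 : L) = 0.
Proof. by apply: adjop_uniq => f g; rewrite !opE dot0l dot0r. Qed.
Lemma adjopZ a T : adjoint (a *: T) = a^*%C *: adjoint T.
Proof. by apply: adjop_uniq => f g; rewrite !opE dotZl dotZr conjcK adjopE. Qed.

Lemma nm_adj_le T : nm (adjoint T) <= nm T.
Proof.
apply: opnm_le (nm_ge0 _) _ => f.
have [F0|F0] := eqVneq (nm (adjoint T f)) 0.
  by rewrite F0 mulr_ge0 ?nm_ge0.
have Fp : 0 < nm (adjoint T f) by rewrite lt0r F0 nm_ge0.
rewrite -(ler_pM2l Fp) -expr2 -rdotE /rdot -adjopE.
rewrite (le_trans (rdot_le _ f)) // mulrCA mulrA ler_wpM2r ?nm_ge0 //.
exact: opnm_ge.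
Qed.

Lemma nm_adj T : nm (adjoint T) = nm T.
Proof. by apply/eqP; rewrite eq_le nm_adj_le -{1}[T]adjopK nm_adj_le. Qed.

Lemma rdot_adj T f g : rdot (T f) g = rdot f (adjoint T g).
Proof. by rewrite /rdot adjopE. Qed.

Lemma op_complete (u : nat -> L) : ncauchy u -> exists T, ncvg u T.
Proof.
move=> cu.
have /choice[F FP] f : exists g, ncvg (fun n => u n f) g.
  apply: nm_complete => e e0; have f0 := nm_ge0 f.
  have f1 : 0 < nm f + 1 by lra.
  have [N NP] := cu _ (divr_gt0 e0 f1); exists N => m n mN nN.
  have := NP m n mN nN; rewrite ltr_pdivlMr // -opBE => h.
  by have := opnm_ge (u m - u n) f; have := nm_ge0 (u m - u n); nra.
have [N0 N0P] := cu 1 ltr01.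
(* Being uniform in [f] up to the factor [nm f], this estimate both bounds the pointwise limit (with
   [e = 1]) and upgrades the convergence to the operator norm. *)
have Fbound (e : R) N : (forall m n, (N <= m)%N -> (N <= n)%N -> nm (u m - u n) < e) ->
    forall n f, (N <= n)%N -> nm (F f - u n f) <= e * nm f.
  move=> NP n f nN; apply: (@nm_cvg_bound _ _ _ _ _ _ N (FP f)) => m mN.
  rewrite -opBE (le_trans (opnm_ge _ _)) // ler_wpM2r ?nm_ge0 //.
  exact/ltW/NP.
have [||T TE] := @bounded_op_of F (1 + nm (u N0)).
- move=> a f g; apply: ncvg_uniq (FP _) _.
  apply: ncvg_ext (ncvgD (ncvgZ a (FP f)) (FP g)) => n /=.
  by rewrite linearP.
- move=> f; have := Fbound 1 N0 N0P N0 f (leqnn _); rewrite mul1r.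
  by have := opnm_ge (u N0) f; have := nmD (F f - u N0 f) (u N0 f); rewrite subrK; lra.
exists T => e e0; have e2 : 0 < e / 2 by lra.
have [N NP] := cu _ e2; exists N => n nN; rewrite nmBC.
suff : nm (T - u n) <= e / 2 by lra.
apply: opnm_le => [|f]; first exact: ltW.
by rewrite opBE TE; exact: (Fbound _ N).
Qed.

Lemma nm_ncvgMl S (u : nat -> L) T : ncvg u T -> ncvg (fun n => S * u n) (S * T).
Proof.
move=> uT e e0; have S0 := nm_ge0 S; have S1 : 0 < nm S + 1 by lra.
have [N uN] := uT _ (divr_gt0 e0 S1); exists N => n /uN.
rewrite ltr_pdivlMr // -mulrBr => h.
by have := opnmM S (u n - T); have := nm_ge0 (u n - T); nra.
Qed.

Lemma nm_ncvgMr S (u : nat -> L) T : ncvg u T -> ncvg (fun n => u n * S) (T * S).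
Proof.
move=> uT e e0; have S0 := nm_ge0 S; have S1 : 0 < nm S + 1 by lra.
have [N uN] := uT _ (divr_gt0 e0 S1); exists N => n /uN.
rewrite ltr_pdivlMr // -mulrBl => h.
by have := opnmM (u n - T) S; have := nm_ge0 (u n - T); nra.
Qed.

(* Lax-Milgram: [T] is bounded below, and its range is dense because the
   adjoint satisfies the same estimate. *)
Lemma coercive_inverse (c : R) T : 0 < c ->
  (forall f, c * nm f ^+ 2 <= rdot (T f) f) ->
  exists T', [/\ T * T' = 1, T' * T = 1 & nm T' <= c^-1].
Proof.
move=> c0 Tc.
have below f : c * nm f <= nm (T f).
  have [->|f0] := eqVneq f 0; first by rewrite linear0 !nm0 mulr0.
  have fp : 0 < nm f by rewrite lt0r nm_ge0 andbT; apply: contra_neq f0; exact: nm_eq0.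
  by rewrite -(ler_pM2r fp) -mulrA -expr2 (le_trans (Tc f)) // rdot_le.
have onto : forall g, [set T f | f in setT] g.
  apply: closed_subspace_dense => [||g gT].
  - apply: mk_subspace => [|a _ _ [f _ <-] [g _ <-]]; first by exists 0; rewrite ?linear0.
    by exists (a *: f + g) => //; rewrite linearP.
  - move=> g /nm_closureP cg.
    have /choice[v vP] n : exists f, nm (g - T f) < n.+1%:R^-1.
      have [|_ [f _ <-] ?] := cg (n.+1%:R^-1); last by exists f.
      by rewrite invr_gt0 ltr0Sn.
    have Tv : ncvg (fun n => T (v n)) g.
      move=> e /natSinv_small[N NP]; exists N => n /NP; rewrite nmBC.
      exact: lt_trans.
    have [|f vf] := @nm_complete _ _ v.
      move=> e e0; have ce : 0 < c * e / 2 by rewrite divr_gt0 // mulr_gt0.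
      have [N NP] := Tv _ ce; exists N => m n /NP mN /NP nN.
      rewrite -(ltr_pM2l c0) (le_lt_trans (below _)) // linearB.
      by have := nmBD (T (v m)) g (T (v n)); rewrite [nm (g - _)]nmBC; lra.
    exists f => //; apply: ncvg_uniq Tv; exact: op_ncvg.
  - have := Tc g; rewrite rdotC /rdot gT; last by exists g.
    move=> h; apply: nm_eq0; apply/eqP; rewrite -sqrf_eq0 eq_le sqr_ge0 andbT.
    by rewrite -(ler_pM2l c0) mulr0.
have /choice[F FP] g : exists f, T f = g by have [f _ <-] := onto g; exists f.
have inj f g : T f = T g -> f = g.
  move=> fg; apply: subr0_eq; apply: nm_eq0; apply/eqP; rewrite eq_le nm_ge0 andbT.
  by rewrite -(ler_pM2l c0) mulr0 (le_trans (below _)) // linearB /= fg subrr nm0.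
have [||T' T'E] := @bounded_op_of F c^-1.
- by move=> a f g; apply: inj; rewrite linearP /= !FP.
- by move=> f; rewrite -(ler_pM2l c0) mulrA mulfV ?gt_eqF // mul1r -{2}[f]FP.
exists T'; split.
- by apply: bounded_op_ext => f; rewrite !opE T'E FP.
- by apply: bounded_op_ext => f; rewrite !opE T'E; apply: inj; rewrite FP.
- apply: opnm_le => [|f]; first by rewrite invr_ge0 ltW.
  by rewrite T'E -(ler_pM2l c0) mulrA mulfV ?gt_eqF // mul1r -{2}[f]FP.
Qed.

End Operators.

(** * Square roots and spectral signs *)

Section SquareRoot.
Context {R : realType} {H : hilbertType R}.
Local Notation L := (bounded_op H).
Implicit Types (S T U X Y J : L) (f g h : H) (a : R[i]).

(** Writing a root of [T = 1 - X] as [1 - Y], the equation [(1 - Y) * (1 - Y) = T] becomes Y = (X +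
    Y^2)/2, which is iterated here from 0. *)
Fixpoint sqrt_iter X n : L :=
  if n is m.+1 then 2^-1%:C *: (X + sqrt_iter X m * sqrt_iter X m) else 0.

Fixpoint sqrt_bound n : R :=
  if n is m.+1 then 2^-1 * (1 + sqrt_bound m * sqrt_bound m) else 0.

Lemma sqrt_bound01 n : 0 <= sqrt_bound n <= 1.
Proof.
elim: n => [|n /andP[h0 h1]] /=; first by rewrite lexx ler01.
by apply/andP; split; nra.
Qed.

Lemma sqrt_bound_homo m n : (m <= n)%N -> sqrt_bound m <= sqrt_bound n.
Proof.
apply: (homo_leq (@lexx _ _) (@le_trans _ _)) => {m n}.
move=> n /=; have := sqr_ge0 (1 - sqrt_bound n); move: (sqrt_bound n) => x.
by rewrite expr2; lra.
Qed.

Lemma nm_half X : nm (2^-1%:C *: X) = 2^-1 * nm X.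
Proof. by rewrite nmZR ger0_norm // invr_ge0. Qed.

Lemma nm_sqrB X Y : nm (X * X - Y * Y) <= (nm X + nm Y) * nm (X - Y).
Proof.
have -> : X * X - Y * Y = X * (X - Y) + (X - Y) * Y.
  by rewrite mulrBr mulrBl addrA subrK.
have := nmD (X * (X - Y)) ((X - Y) * Y).
by have := opnmM X (X - Y); have := opnmM (X - Y) Y; lra.
Qed.

(* The iterates and their increments are dominated by those of the scalar
   sequence started from [nm X = 1], which increases and stays below [1]. *)
Lemma sqrt_iter_dom X : nm X <= 1 ->
  (forall n, nm (sqrt_iter X n) <= sqrt_bound n) /\
  (forall n, nm (sqrt_iter X n.+1 - sqrt_iter X n) <= sqrt_bound n.+1 - sqrt_bound n).
Proof.
move=> X1.
have dom n : nm (sqrt_iter X n) <= sqrt_bound n.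
  elim: n => [|n IH] /=; first by rewrite nm0.
  rewrite nm_half; have := nmD X (sqrt_iter X n * sqrt_iter X n).
  by have := opnmM (sqrt_iter X n) (sqrt_iter X n); have := nm_ge0 (sqrt_iter X n); nra.
split=> // n; elim: n => [|n IH].
  by rewrite /= !mulr0 !addr0 !subr0 nm_half; lra.
have -> : sqrt_iter X n.+2 - sqrt_iter X n.+1 = 2^-1%:C *:
    (sqrt_iter X n.+1 * sqrt_iter X n.+1 - sqrt_iter X n * sqrt_iter X n).
  by rewrite -[in LHS]/(2^-1%:C *: _) [in X in _ - X]/= -scalerBr opprD addrACA subrr add0r.
have -> : sqrt_bound n.+2 - sqrt_bound n.+1 =
    2^-1 * ((sqrt_bound n.+1 + sqrt_bound n) * (sqrt_bound n.+1 - sqrt_bound n)).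
  have E k : sqrt_bound k.+1 = 2^-1 * (1 + sqrt_bound k * sqrt_bound k) by [].
  by rewrite [sqrt_bound n.+2]E [sqrt_bound n.+1]E; field.
rewrite nm_half ler_pM2l ?invr_gt0 // (le_trans (nm_sqrB _ _)) //.
by apply: ler_pM; rewrite ?addr_ge0 ?nm_ge0 // lerD.
Qed.

Lemma sqrt_iter_cauchy X : nm X <= 1 -> ncauchy (sqrt_iter X).
Proof.
move=> X1; have [_ inc] := sqrt_iter_dom X1.
have le_dist m n : (m <= n)%N ->
    nm (sqrt_iter X n - sqrt_iter X m) <= sqrt_bound n - sqrt_bound m.
  move=> /subnK <-; elim: (n - m)%N => [|k IH]; first by rewrite !subrr nm0.
  have := nmBD (sqrt_iter X (k + m).+1) (sqrt_iter X (k + m)) (sqrt_iter X m).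
  rewrite addSn; move: IH (inc (k + m)%N).
  move: (nm _) (nm _) (nm _) (sqrt_bound _) (sqrt_bound _) (sqrt_bound _).
  by move=> *; lra.
move=> e e0.
have [|N NP] := monotone_bounded_cauchy sqrt_bound_homo _ e0 (b := 1).
  by move=> n; case/andP: (sqrt_bound01 n).
exists N => m n mN nN.
wlog mn : m n mN nN / (m <= n)%N.
  by move=> W; have [/W|/ltnW/W] := leqP m n; [|rewrite nmBC]; apply.
by rewrite nmBC (le_lt_trans (le_dist m n mn)) // NP.
Qed.

(** The second clause is an induction principle for the limit [Y]: every sequentially closed set
    that contains 0 and is stable under the iteration contains [Y]. The norm bound, commutation and
    [J]-selfadjointness of the root are instances of it. *)
Lemma sqrt_ex T : nm (1 - T) <= 1 ->
  exists Y, (1 - Y) * (1 - Y) = T /\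
    forall C : set L, C 0 ->
      (forall Z, C Z -> C (2^-1%:C *: ((1 - T) + Z * Z))) ->
      (forall u Z, ncvg u Z -> (forall n, C (u n)) -> C Z) -> C Y.
Proof.
move=> X1; set X := 1 - T in X1 *.
have [Y uY] := op_complete (sqrt_iter_cauchy X1); exists Y; split; last first.
  move=> C C0 CS Ccl; apply: Ccl uY _; elim=> [|n IH] //=; exact: CS.
have [dom _] := sqrt_iter_dom X1.
have b1 n : nm (sqrt_iter X n) <= 1.
  by rewrite (le_trans (dom n)) //; case/andP: (sqrt_bound01 n).
have Y1 : nm Y <= 1 := ncvg_le uY b1.
have YE : Y = 2^-1%:C *: (X + Y * Y).
  apply: (ncvg_uniq (ncvgS uY)).
  apply: ncvgZ; apply: ncvgD (ncvg_cst X) _ => e e0.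
  have [N NP] := uY (e / 2) ltac:(by lra).
  exists N => n /NP h; apply: le_lt_trans (nm_sqrB _ _) _.
  have := nm_ge0 (sqrt_iter X n - Y); move: (b1 n) h (nm_ge0 Y).
  by move: (nm _) (nm _) (nm _) Y1 => d w y; nra.
have Y2 : Y + Y = X + Y * Y.
  by rewrite {1 2}YE -scalerDl -rmorphD /= -[2^-1]mul1r -splitr scale1r.
have -> : (1 - Y) * (1 - Y) = 1 - (Y + Y) + Y * Y.
  by rewrite mulrBl mul1r mulrBr mulr1 opprB opprD !addrA -addrA [Y * Y - _]addrC addrA.
by rewrite Y2 opprD addrA subrK opprB addrC subrK.
Qed.

(* [J] is any self-adjoint involution, [J = 1] being the case of [adjoint]. *)
Lemma sqrt_ops T : nm (1 - T) <= 1 ->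
  exists D, [/\ D * D = T, nm (1 - D) <= 1,
    forall X, X * T = T * X -> X * D = D * X &
    forall J, adjoint J = J -> J * J = 1 -> Jadjoint J T = T -> Jadjoint J D = D].
Proof.
move=> T1; have [Y [YT Yind]] := sqrt_ex T1.
exists (1 - Y); split=> //.
- rewrite subKr; apply: (Yind [set Z | nm Z <= 1]) => /= [|Z Z1|u Z].
  + by rewrite nm0.
  + rewrite nm_half; have := nmD (1 - T) (Z * Z); have := opnmM Z Z.
    by move: (nm_ge0 Z) T1 Z1; move: (nm _) (nm _) (nm _) (nm _) => *; nra.
  + exact: ncvg_le.
- move=> X XT; rewrite mulrBr mulrBl mulr1 mul1r; congr (_ - _).
  apply: (Yind [set Z | X * Z = Z * X]) => /= [|Z XZ|u Z uZ Xu].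
  + by rewrite mulr0 mul0r.
  + rewrite opZr opZl mulrDr mulrDl mulrBr mulrBl mulr1 mul1r XT.
    by rewrite mulrA XZ -mulrA XZ mulrA.
  + apply: ncvg_uniq (nm_ncvgMl X uZ) _.
    by apply: ncvg_ext (nm_ncvgMr X uZ) => n; rewrite Xu.
- move=> J aJ JJ JT.
  have JM Z W : Jadjoint J (Z * W) = Jadjoint J W * Jadjoint J Z.
    rewrite /Jadjoint adjopM -!mulrA; congr (_ * (_ * _)).
    by rewrite [J * (J * _)]mulrA JJ mul1r.
  have JB Z W : Jadjoint J (Z - W) = Jadjoint J Z - Jadjoint J W.
    by rewrite /Jadjoint adjopB mulrBr mulrBl.
  have J1 : Jadjoint J 1 = 1 by rewrite /Jadjoint adjop1 mulr1.
  rewrite JB J1; congr (_ - _).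
  apply: (Yind [set Z | Jadjoint J Z = Z]) => /= [|Z JZ|u Z uZ Ju].
  + by rewrite /Jadjoint adjop0 mulr0 mul0r.
  + rewrite /Jadjoint adjopZ conjc_real opZr opZl; congr (_ *: _).
    rewrite adjopD mulrDr mulrDl -!/(Jadjoint J _); congr (_ + _).
      by rewrite JB J1 JT.
    by rewrite JM JZ.
  + apply: ncvg_uniq (uZ) => e e0.
    have JZu n : nm (u n - Jadjoint J Z) <= nm J * nm (u n - Z) * nm J.
      have -> : u n - Jadjoint J Z = Jadjoint J (u n - Z) by rewrite JB Ju.
      apply: le_trans (opnmM _ _) _; rewrite ler_wpM2r ?nm_ge0 //.
      by apply: le_trans (opnmM _ _) _; rewrite nm_adj.
    have J0 := nm_ge0 J; have J2 : 0 < nm J * nm J + 1 by nra.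
    have [N NP] := uZ _ (divr_gt0 e0 J2); exists N => n /NP.
    rewrite ltr_pdivlMr //; have := JZu n; have := nm_ge0 (u n - Z).
    move: (nm _) (nm _) (nm _) J0 => x y z *; nra.
Qed.

(** Square [nm (f - T f) <= nm f] and expand. Applied to a root produced by [sqrt_ops], it is the
    source of the quantitative positivity of the modulus. *)
Lemma near_one_pos T f : nm (1 - T) <= 1 -> nm (T f) ^+ 2 <= 2 * rdot (T f) f.
Proof.
move=> T1; have := nmB2 f (T f); rewrite rdotC.
have : nm (f - T f) <= nm f.
  by rewrite (le_trans (opnm_ge (1 - T) f)) // ler_piMl ?nm_ge0.
rewrite -(@ler_pXn2r _ 2) ?nnegrE ?nm_ge0 //.
by move: (_ ^+ 2) (_ ^+ 2) (_ ^+ 2) (rdot _ _) => *; lra.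
Qed.

Lemma modulus_ex S : exists D, [/\ D * D = adjoint S * S, adjoint D = D,
  exists2 c : R, 0 < c & forall f, c * nm (D f) ^+ 2 <= rdot (D f) f &
  forall X, X * (adjoint S * S) = (adjoint S * S) * X -> X * D = D * X].
Proof.
(* Scaling to [nm X <= 1] puts [adjoint X * X] within distance 1 of the identity, since then
   [nm (adjoint X (X f)) <= nm (X f)]; the added 1 keeps [b] positive when [S = 0]. *)
pose b := nm S + 1; have b0 : 0 < b by rewrite ltr_wpDl ?nm_ge0.
pose X := (b^-1)%:C *: S.
have X1 : nm X <= 1.
  rewrite nmZR ger0_norm ?invr_ge0 ?(ltW b0) // ler_pdivrMl // mulr1.
  by rewrite lerDl ler01.
have XE : adjoint X * X = (b^-2)%:C *: (adjoint S * S).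
  by rewrite adjopZ conjc_real opZl opZr scalerA -rmorphM /= -invfM.
have T1 : nm (1 - adjoint X * X) <= 1.
  apply: opnm_le => // f; rewrite mul1r opBE op1E opME.
  rewrite -(@ler_pXn2r _ 2) ?nnegrE ?nm_ge0 // nmB2.
  have -> : rdot f (adjoint X (X f)) = nm (X f) ^+ 2 by rewrite -rdot_adj rdotE.
  have h1 : nm (adjoint X (X f)) <= nm (X f).
    rewrite (le_trans (opnm_ge _ _)) // nm_adj ler_piMl ?nm_ge0 //.
  have := nm_ge0 (X f); have := nm_ge0 (adjoint X (X f)); move: h1.
  by move: (nm (adjoint _ _)) (nm (X f)) (nm f) => x y z *; nra.
have [D [DD D1 Dc Da]] := sqrt_ops T1.
exists (b%:C *: D); split.
- rewrite opZl opZr DD XE !scalerA -!rmorphM /=.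
  by rewrite -expr2 mulfV ?expf_neq0 ?gt_eqF // scale1r.
- rewrite adjopZ conjc_real; congr (_ *: _).
  have := Da 1; rewrite /Jadjoint adjop1 !mul1r !mulr1; apply=> //.
  by rewrite adjopM adjopK.
(* The factor 2 comes from [near_one_pos], the factor [b] from undoing the scaling. *)
- exists (2 * b)^-1; first by rewrite invr_gt0 mulr_gt0.
  move=> f; rewrite opZE nmZR rdotZl (gtr0_norm b0) exprMn.
  have := near_one_pos f D1; move: (nm (D f) ^+ 2) (rdot _ _) => x y xy.
  have -> : (2 * b)^-1 * (b ^+ 2 * x) = b * (x / 2) by field; rewrite gt_eqF.
  by rewrite ler_pM2l //; lra.
- move=> Y; rewrite opZr opZl => Yc; congr (_ *: _); apply: Dc.
  by rewrite XE opZr opZl Yc.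
Qed.

Lemma projection_op (M : set H) : subspace M -> closed M ->
  exists p, [/\ adjoint p = p, p * p = p & forall f, M f <-> p f = f].
Proof.
move=> sM cM.
have /choice[F FP] f : exists g, M g /\ forall h, M h -> dotp (f - g) h = 0.
  by have [g] := orthogonal_projection f sM cM; exists g.
have uniq f g : M g -> (forall h, M h -> dotp (f - g) h = 0) -> F f = g.
  move=> Mg fg; have [MF fF] := FP f; apply: subr0_eq; apply: nm_eq0.
  apply/eqP; rewrite -sqrf_eq0 -rdotE.
  have MB := subspaceB sM MF Mg.
  rewrite {1}(_ : F f - g = (f - g) - (f - F f)); last first.
    by rewrite opprB [RHS]addrC addrA subrK.
  by rewrite /rdot dotBl fg // fF // subrr.
have lF : linear F.
  move=> a f g; have [Mf fF] := FP f; have [Mg gF] := FP g.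
  apply: uniq; first exact: subspaceZD.
  by move=> h Mh; rewrite opprD addrACA -scalerBr dotDl dotZl fF // gF // mulr0 addr0.
have bF f : nm (F f) <= 1 * nm f.
  have [Mf fF] := FP f; rewrite mul1r -(@ler_pXn2r _ 2) ?nnegrE ?nm_ge0 //.
  have := nmD2 (f - F f) (F f); rewrite /rdot fF // subrK mulr0 addr0 => ->.
  by rewrite lerDr sqr_ge0.
have [p pE] := bounded_op_of lF bF; exists p.
have MpE f : M f -> F f = f.
  by move=> Mf; apply: uniq => // h _; rewrite subrr dot0l.
split.
- apply: adjop_uniq => f g; rewrite !pE; have [Mf fF] := FP f; have [Mg gF] := FP g.
  have -> : dotp (F f) g = dotp (F f) (F g).
    by apply: subr0_eq; rewrite -dotBr dotC gF // conjc0.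
  by apply: subr0_eq; rewrite -opprB -dotBl fF // oppr0.
- apply: bounded_op_ext => f; rewrite !opE !pE; apply: MpE; exact: (FP f).1.
- by move=> f; rewrite pE; split=> [/MpE //|<-]; exact: (FP f).1.
Qed.

Lemma closed_ker T : closed [set f | T f = 0].
Proof.
have := @closed_dot_op _ _ T setT; congr closed; apply/seteqP; split=> f /=.
  by move=> h; apply: dot_injl => g; rewrite h // dot0l.
by move=> -> g _; rewrite dot0l.
Qed.

Lemma subspace_ker T : subspace [set f | T f = 0].
Proof.
apply: mk_subspace => /= [|a f g f0 g0]; first exact: linear0.
by rewrite linearP /= f0 g0 scaler0 addr0.
Qed.

(* [p] is the spectral projection of [S] for the half-line [0, +oo[; it projects
   onto the kernel of [D - S], where [D] is the modulus of [S]. *)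
Lemma sign_ex S : adjoint S = S -> exists D p,
  [/\ adjoint p = p /\ p * p = p, S * p = D * p, S * (1 - p) = - (D * (1 - p)),
      exists2 c : R, 0 < c & forall f, c * nm (D f) ^+ 2 <= rdot (D f) f &
      forall X, X * S = S * X -> X * D = D * X /\ X * p = p * X].
Proof.
move=> aS; have [D [DD aD Dpos Dc]] := modulus_ex S; rewrite aS in DD Dc.
have cD X : X * S = S * X -> X * D = D * X.
  by move=> XS; apply: Dc; rewrite mulrA XS -mulrA XS mulrA.
have [p [ap pp pK]] := projection_op (subspace_ker (D - S)) (closed_ker (T:=D - S)).
rewrite /mkset in pK.
exists D, p; split=> //.
- apply: bounded_op_ext => f; rewrite !opE; apply/esym/subr0_eq.
  have /pK : p (p f) = p f by rewrite -opME pp.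
  by [].
- have SD := cD S erefl.
  (* Since [(D - S) * (D + S) = D * D - S * S = 0], the range of [D + S] lies in that of [p]; taking
     adjoints, [D + S] vanishes on the range of [1 - p]. *)
  have h : p * (D + S) = D + S.
    apply: bounded_op_ext => f; rewrite opME; apply/pK; rewrite -opME.
    by rewrite mulrDr !mulrBl DD SD addrA subrK subrr.
  have h' : (D + S) * p = D + S.
    by have := congr1 (@adjoint _ _) h; rewrite adjopM ap adjopD aD aS.
  apply/eqP; rewrite -addr_eq0 addrC -mulrDl mulrBr mulr1 h' subrr; exact/eqP.
- move=> X XS; split; first exact: cD.
  have aXS : adjoint X * S = S * adjoint X.
    by have := congr1 (@adjoint _ _) XS; rewrite !adjopM aS.
  (* The range of [p] is invariant under whatever commutes with [S]. Applied to both [X] and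
     [adjoint X], this makes [p] commute with [X]. *)
  have inv Y : Y * S = S * Y -> p * (Y * p) = Y * p.
    move=> YS; apply: bounded_op_ext => f; rewrite opME; apply/pK.
    have /pK K : p (p f) = p f by rewrite -opME pp.
    rewrite -opME mulrA mulrBl -(cD _ YS) -YS -mulrBr -mulrA !opME.
    by rewrite K linear0.
  have := congr1 (@adjoint _ _) (inv _ aXS).
  rewrite !adjopM ap adjopK -mulrA => h; by rewrite -[LHS](inv _ XS) h.
Qed.

End SquareRoot.

(** * The group of J-unitaries and its connectedness *)

Section KreinAlgebra.
Context {R : realType} {H : hilbertType R}.
Local Notation L := (bounded_op H).
Implicit Types (S T U V W X Y : L) (f g h : H) (a : R[i]).

(* Locked, so that rewriting with [mulrA] does not unfold the product. *)
Fact jad_key : unit. Proof. by []. Qed.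
Definition jad (J T : L) : L := locked_with jad_key (Jadjoint J T).

Lemma jadE J : Jadjoint J = jad J.
Proof. by apply/funext => T; rewrite /jad unlock. Qed.

Variables (J : L) (aJ : adjoint J = J) (JJ : J * J = 1).
Local Notation "T ^#" := (jad J T) (at level 2, format "T ^#").

Lemma jadP T : T^# = J * adjoint T * J.
Proof. by rewrite -jadE. Qed.

Lemma jadM S T : (S * T)^# = T^# * S^#.
Proof.
rewrite !jadP adjopM -!mulrA; congr (_ * (_ * _)).
by rewrite [J * (J * _)]mulrA JJ mul1r.
Qed.
Lemma jadD S T : (S + T)^# = S^# + T^#.
Proof. by rewrite !jadP adjopD mulrDr mulrDl. Qed.
Lemma jadN T : (- T)^# = - T^#.
Proof. by rewrite !jadP adjopN mulrN mulNr. Qed.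
Lemma jadB S T : (S - T)^# = S^# - T^#.
Proof. by rewrite jadD jadN. Qed.
Lemma jadZ a T : (a *: T)^# = a^*%C *: T^#.
Proof. by rewrite !jadP adjopZ opZr opZl. Qed.
Lemma jad1 : (1 : L)^# = 1.
Proof. by rewrite !jadP adjop1 mulr1. Qed.
Lemma jadK T : (T^#)^# = T.
Proof.
by rewrite !jadP !adjopM aJ adjopK !mulrA JJ mul1r -mulrA JJ mulr1.
Qed.

Lemma nm_jad T : nm T^# <= nm J * nm J * nm T.
Proof.
rewrite jadP; apply: le_trans (opnmM _ _) _; rewrite mulrC -mulrA ler_wpM2l ?nm_ge0 //.
by apply: le_trans (opnmM _ _) _; rewrite nm_adj.
Qed.

Lemma kdot_jad T f g : kdot J (T f) g = kdot J f (T^# g).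
Proof.
by rewrite jadP /kdot !opE !adjopE aJ -[J (J _)]opME JJ.
Qed.

Lemma kdotC f g : kdot J f g = (kdot J g f)^*%C.
Proof. by rewrite /kdot adjopE aJ dotC. Qed.

Lemma JunitaryE U : Junitary J U <-> U * U^# = 1 /\ U^# * U = 1.
Proof. by rewrite /Junitary jadE. Qed.

Lemma Jnormal_projectionE Q :
  Jnormal_projection J Q <-> Q * Q = Q /\ Q * Q^# = Q^# * Q.
Proof. by rewrite /Jnormal_projection jadE. Qed.

Lemma JorbitE Q0 Q :
  Jorbit J Q0 Q <-> exists2 U, Junitary J U & U * Q0 * U^# = Q.
Proof. by rewrite /Jorbit jadE. Qed.

Lemma Junitary1 : Junitary J 1.
Proof. by apply/JunitaryE; rewrite jad1 mulr1. Qed.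

Lemma JunitaryM U V : Junitary J U -> Junitary J V -> Junitary J (U * V).
Proof.
move=> /JunitaryE[U1 U2] /JunitaryE[V1 V2]; apply/JunitaryE; split; rewrite jadM.
  by rewrite mulrA -[U * V * _]mulrA V1 mulr1.
by rewrite mulrA -[_ * U^# * _]mulrA U2 mulr1.
Qed.

Lemma JunitaryV U : Junitary J U -> Junitary J U^#.
Proof. by move=> /JunitaryE[U1 U2]; apply/JunitaryE; split; rewrite jadK. Qed.

Lemma JconjM U X Y : Junitary J U ->
  U * X * U^# * (U * Y * U^#) = U * (X * Y) * U^#.
Proof.
by move=> /JunitaryE[_ U2]; rewrite !mulrA -[U * X * U^# * U]mulrA U2 mulr1.
Qed.

Lemma JconjA U X : (U * X * U^#)^# = U * X^# * U^#.
Proof. by rewrite !jadM jadK mulrA. Qed.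

Lemma Jorbit_normal Q0 Q :
  Jnormal_projection J Q0 -> Jorbit J Q0 Q -> Jnormal_projection J Q.
Proof.
move=> /Jnormal_projectionE[QQ Qn] /JorbitE[U UJ <-].
by apply/Jnormal_projectionE; rewrite JconjA !JconjM // QQ Qn.
Qed.

Lemma Jorbit_refl Q : Jorbit J Q Q.
Proof.
by apply/JorbitE; exists 1; [exact: Junitary1 | rewrite jad1 mul1r mulr1].
Qed.

Lemma Jorbit_sym Q0 Q : Jorbit J Q0 Q -> Jorbit J Q Q0.
Proof.
move=> /JorbitE[U UJ <-]; apply/JorbitE; exists U^#; first exact: JunitaryV.
have /JunitaryE[_ U2] := UJ.
by rewrite jadK !mulrA U2 mul1r -mulrA U2 mulr1.
Qed.

Lemma Jorbit_trans Q1 Q0 Q : Jorbit J Q0 Q1 -> Jorbit J Q1 Q -> Jorbit J Q0 Q.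
Proof.
move=> /JorbitE[U UJ <-] /JorbitE[V VJ <-]; apply/JorbitE.
exists (V * U); first exact: JunitaryM.
by rewrite jadM !mulrA.
Qed.

End KreinAlgebra.

(** * Lipschitz paths and connected components *)

Section Paths.
Context {R : realType}.

Lemma nm_continuous (V W : normedModType R[i]) (F : V -> W) :
  (forall x (e : R), 0 < e -> exists2 d, 0 < d &
    forall y, nm (x - y) < d -> nm (F x - F y) < e) -> continuous F.
Proof.
move=> cF x; apply/cvgrPdist_lt => e e0.
have eR : e = (complex.Re e)%:C by rewrite RRe_real// gtr0_real.
have [|d d0 dF] := cF x (complex.Re e); first by rewrite -ltcR -eR.
apply/nbhs_ballP; exists d%:C; first by rewrite /= ltcR.
by move=> y; rewrite -ball_normE /= nmE ltcR => /dF; rewrite nmE eR ltcR.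
Qed.

Lemma lipschitz_path_connected (V : normedModType R[i]) (F : R -> V) (K : R) :
  (forall s t, 0 <= s <= 1 -> 0 <= t <= 1 -> nm (F s - F t) <= K * `|s - t|) ->
  connected (F @` `[0, 1]).
Proof.
move=> FK; apply: connected_continuous_connected.
  exact: segment_connected.
apply/subspace_continuousP => x; rewrite /= in_itv /= => x01.
apply/cvgrPdist_lt => e e0.
have eR : e = (complex.Re e)%:C by rewrite RRe_real// gtr0_real.
have ep : 0 < complex.Re e by rewrite -ltcR -eR.
have K1 : 0 < `|K| + 1 by rewrite ltr_wpDl.
apply/nbhs_ballP; exists (complex.Re e / (`|K| + 1)); first exact: divr_gt0.
move=> y; rewrite -ball_normE /= => xy; rewrite in_itv /= => y01.
rewrite nmE eR ltcR; apply: le_lt_trans (FK _ _ x01 y01) _.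
move: xy; rewrite ltr_pdivlMr //.
have := ler_norm K; have := normr_ge0 (x - y); move: (`|x - y|) => d; nra.
Qed.

Lemma connected_component_image (T T' : topologicalType) (F : T -> T')
    (A : set T) (B : set T') x y : continuous F -> F @` A `<=` B ->
  connected_component A x y -> connected_component B (F x) (F y).
Proof.
move=> cF FA [C [Cx CA cC] Cy]; exists (F @` C); last by exists y.
split; first by exists x.
  by move=> _ [z /CA Az <-]; apply: FA; exists z.
by apply: connected_continuous_connected => //; exact: continuous_subspaceT.
Qed.

End Paths.

(** * Connectedness of the group of [J]-unitaries *)

Section JunitaryConnected.
Context {R : realType} {H : hilbertType R}.
Local Notation L := (bounded_op H).
Implicit Types (S T U V W X Y : L) (f g h : H).
Variables (J : L) (aJ : adjoint J = J) (JJ : J * J = 1).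
Local Notation "T ^#" := (jad J T) (at level 2, format "T ^#").

Let pencil U (a b : R) : L := a%:C *: U + b%:C *: (1 : L).

(** For a [J]-unitary [U] both products are symmetric functions of [a] and [b]; hence the quotient
    of [pencil U a b] by [pencil U b a] is [J]-unitary whenever it exists. *)
Let pencil_swap U a b : Junitary J U ->
  (pencil U a b)^# * pencil U a b = (pencil U b a)^# * pencil U b a /\
  pencil U a b * (pencil U a b)^# = pencil U b a * (pencil U b a)^#.
Proof.
move=> /JunitaryE[U1 U2].
pose N c d : L := (c * c + d * d)%:C *: (1 : L) + (c * d)%:C *: (U^# + U).
have NC : N a b = N b a by rewrite /N [b * b + a * a]addrC [b * a]mulrC.
have E1 c d : (pencil U c d)^# * pencil U c d = N c d.
  rewrite /N /pencil jadD !jadZ (jad1 JJ) !conjc_real mulrDl !mulrDr.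
  rewrite !(opZl, opZr) U2 !scalerA -!rmorphM /= !mulr1 mul1r.
  rewrite rmorphD scalerDl scalerDr [d * c]mulrC -!addrA; congr (_ + _).
  by rewrite addrA addrC.
have E2 c d : pencil U c d * (pencil U c d)^# = N c d.
  rewrite /N /pencil jadD !jadZ (jad1 JJ) !conjc_real mulrDl !mulrDr.
  rewrite !(opZl, opZr) U1 !scalerA -!rmorphM /= !mulr1 mul1r.
  rewrite rmorphD scalerDl scalerDr [d * c]mulrC -!addrA; congr (_ + _).
  by rewrite addrCA addrA addrC.
split; first exact: etrans (E1 a b) (etrans NC (esym (E1 b a))).
exact: etrans (E2 a b) (etrans NC (esym (E2 b a))).
Qed.

Let pencilC U a b c d : pencil U a b * pencil U c d = pencil U c d * pencil U a b.
Proof.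
rewrite /pencil !mulrDl !mulrDr !(opZl, opZr) !scalerA -!rmorphM /= !mulr1 !mul1r.
rewrite [c * a]mulrC [c * b]mulrC [d * a]mulrC [d * b]mulrC -!addrA; congr (_ + _).
by rewrite addrCA.
Qed.

(* The Cayley-type path [((1 + t) U + (1 - t)) ((1 - t) U + (1 + t))^-1]. *)
Lemma accretive_connected U : Junitary J U ->
  (forall f, 0 <= rdot (U f) f) -> connected_component (Junitary J) 1 U.
Proof.
move=> UJ Upos.
(* The denominator is coercive with the same constant 1 for every [t], so its inverse has norm at
   most 1; this uniformity gives the Lipschitz bound on the path. *)
have pos t f : 0 <= t <= 1 -> 1 * nm f ^+ 2 <= rdot (pencil U (1 - t) (1 + t) f) f.
  move=> /andP[t0 t1]; rewrite /pencil !opE rdotDl !rdotZl rdotE.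
  by have := Upos f; have := sqr_ge0 (nm f); nra.
have /choice[F FP] t : exists X, 0 <= t <= 1 ->
    [/\ pencil U (1 - t) (1 + t) * X = 1, X * pencil U (1 - t) (1 + t) = 1 & nm X <= 1].
  have [t01|t01] := pselect (0 <= t <= 1); last by exists 0.
  have [X [X1 X2 X3]] := coercive_inverse ltr01 (fun f => pos t f t01).
  by rewrite invr1 in X3; exists X.
pose G t := pencil U (1 + t) (1 - t) * F t.
have GJ t : 0 <= t <= 1 -> Junitary J (G t).
  move=> /FP[X1 X2 _]; apply/JunitaryE; rewrite /G.
  have jX : (F t)^# * (pencil U (1 - t) (1 + t))^# = 1.
    by rewrite -(jadM JJ) X1 jad1.
  have G2 : (pencil U (1 + t) (1 - t) * F t)^# * (pencil U (1 + t) (1 - t) * F t) = 1.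
    rewrite (jadM JJ) -mulrA [(pencil U (1 + t) _)^# * _]mulrA (pencil_swap _ _ UJ).1.
    by rewrite !mulrA jX mul1r.
  split=> //.
  have PF : pencil U (1 + t) (1 - t) * F t = F t * pencil U (1 + t) (1 - t).
    rewrite -[LHS]mul1r -X2 -!mulrA; congr (_ * _).
    by rewrite mulrA pencilC -mulrA X1 mulr1.
  rewrite PF (jadM JJ) mulrA -[_ * _ * (pencil _ _ _)^#]mulrA.
  rewrite (pencil_swap _ _ UJ).2 mulrA X2 mul1r.
  by rewrite -(jadM JJ) X2 jad1.
have pencilB a b c d : pencil U a b - pencil U c d = pencil U (a - c) (b - d).
  by rewrite /pencil opprD addrACA -!scalerBl -!rmorphB.
have nm_pencil (r : R) : nm (pencil U r (- r)) <= `|r| * nm (U - 1).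
  by rewrite /pencil rmorphN scaleNr -scalerBr nmZR.
have GL : connected (G @` `[0, 1]).
  pose k := nm (U - 1).
  apply: (@lipschitz_path_connected _ _ _ (k + (2 * nm U + 1) * k)).
  move=> s t s01 t01; have [Xs1 Xs2 Xs] := FP s s01; have [Xt1 Xt2 Xt] := FP t t01.
  (* The second summand is the resolvent identity for [F s - F t]. Numerator and denominator both
     vary through [pencil U (s - t) (t - s)], which is [s - t] times [U - 1]. *)
  have -> : G s - G t = pencil U (s - t) (t - s) * F s +
      pencil U (1 + t) (1 - t) * (F s * pencil U (s - t) (t - s) * F t).
    have -> : F s * pencil U (s - t) (t - s) * F t = F s - F t.
      have -> : pencil U (s - t) (t - s) =
          pencil U (1 - t) (1 + t) - pencil U (1 - s) (1 + s).
        by rewrite pencilB; congr pencil; ring.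
      by rewrite mulrBr Xs2 mulrBl mul1r -mulrA Xt1 mulr1.
    have -> : pencil U (s - t) (t - s) =
        pencil U (1 + s) (1 - s) - pencil U (1 + t) (1 - t).
      by rewrite pencilB; congr pencil; ring.
    by rewrite mulrBl mulrBr addrA subrK.
  have hk : nm (pencil U (s - t) (t - s)) <= `|s - t| * k.
    by rewrite -[t - s]opprB; exact: nm_pencil.
  have hP : nm (pencil U (1 + t) (1 - t)) <= 2 * nm U + 1.
    rewrite /pencil (le_trans (nmD _ _)) // !nmZR.
    have /andP[t0 t1] := t01; have := opnm1 (H := H); have := nm_ge0 U.
    rewrite !ger0_norm ?subr_ge0 ?addr_ge0 //.
    by have := nm_ge0 (1 : L); move: (nm U) (nm (1 : L)) => u v *; nra.
  have hXF : nm (F s * pencil U (s - t) (t - s)) <= k * `|s - t|.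
    apply: le_trans (opnmM _ _) _; rewrite [leRHS]mulrC.
    by apply: le_trans hk; rewrite ler_piMl ?nm_ge0.
  apply: le_trans (nmD _ _) _; rewrite [leRHS]mulrDl; apply: lerD.
    apply: le_trans (opnmM _ _) _; rewrite [leRHS]mulrC.
    by apply: le_trans hk; rewrite ler_piMr ?nm_ge0.
  apply: le_trans (opnmM _ _) _; rewrite -[leRHS]mulrA.
  apply: ler_pM => //; [exact: nm_ge0|exact: nm_ge0|].
  apply: le_trans (opnmM _ _) _; apply: le_trans hXF.
  by rewrite ler_piMr ?nm_ge0.
have i0 : 0 <= (0 : R) <= 1 by rewrite lexx ler01.
have i1 : 0 <= (1 : R) <= 1 by rewrite lexx ler01.
exists (G @` `[0, 1]); first split=> //.
- exists 0; first by rewrite /= in_itv.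
  have [X1 _ _] := FP 0 i0; rewrite /G.
  by move: X1; rewrite subr0 addr0.
- by move=> _ [t + <-]; rewrite /= in_itv; exact: GJ.
- exists 1; first by rewrite /= in_itv /= lexx ler01.
  have [_ X2 _] := FP 1 i1; rewrite /G.
  have -> : pencil U (1 + 1) (1 - 1) = U * pencil U (1 - 1) (1 + 1).
    rewrite /pencil subrr !rmorph0 !scale0r add0r addr0.
    by rewrite opZr mulr1.
  by have [X1 _ _] := FP 1 i1; rewrite -mulrA X1 mulr1.
Qed.

Lemma Junitary_mulr_continuous V : continuous (fun U : L => V * U).
Proof.
apply: nm_continuous => U e e0; have V0 := nm_ge0 V; have V1 : 0 < nm V + 1 by lra.
exists (e / (nm V + 1)); first exact: divr_gt0.
move=> W; rewrite ltr_pdivlMr // -mulrBr => h; apply: le_lt_trans (opnmM _ _) _.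
by have := nm_ge0 (U - W); move: (nm _) (nm _) V0 h => *; nra.
Qed.

Lemma JunitaryM_component U V : Junitary J U ->
  connected_component (Junitary J) 1 U -> connected_component (Junitary J) 1 V ->
  connected_component (Junitary J) 1 (U * V).
Proof.
move=> UJ c1U c1V; apply: connected_component_trans c1U _.
rewrite -[X in connected_component _ X _]mulr1.
apply: connected_component_image (@Junitary_mulr_continuous U) _ c1V.
by move=> _ [W WJ <-]; exact: JunitaryM.
Qed.

Lemma nm_J f : nm (J f) = nm f.
Proof.
have : nm (J f) ^+ 2 = nm f ^+ 2.
  by rewrite -!rdotE rdot_adj aJ -[J (J f)]opME JJ.
by move/eqP; rewrite eqrXn2 ?nm_ge0 // => /eqP.
Qed.

(** For [g = (S - T) f], commutation gives [S g + T g = 0]. Both terms have nonnegative pairing with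
    [g], so [rdot (S g) g = 0], and the quantitative bound forces [S g = 0], hence [T g = 0] and
    [g = 0]. *)
Lemma positive_sqrt_uniq S T (c : R) : adjoint S = S -> adjoint T = T ->
  S * T = T * S -> S * S = T * T ->
  0 < c -> (forall f, c * nm (S f) ^+ 2 <= rdot (S f) f) ->
  (forall f, 0 <= rdot (T f) f) -> S = T.
Proof.
move=> aS aT ST SS c0 Sp Tp; apply: bounded_op_ext => f.
apply: subr0_eq; rewrite -opBE; set g := (S - T) f.
have ST0 : S g + T g = 0.
  rewrite -opDE /g -[(S + T) _]opME mulrBr !mulrDl SS ST.
  by rewrite [T * S + T * T]addrC subrr.
have Sg : S g = 0.
  apply: nm_eq0; apply/eqP; rewrite -sqrf_eq0 eq_le sqr_ge0 andbT.
  rewrite -(ler_pM2l c0) mulr0 (le_trans (Sp g)) //.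
  have := Tp g; have : rdot (S g + T g) g = 0 by rewrite ST0 rdot0l.
  by rewrite rdotDl; lra.
have Tg : T g = 0 by rewrite -ST0 Sg add0r.
apply: nm_eq0; apply/eqP; rewrite -sqrf_eq0 -rdotE {1}/g rdot_adj adjopB aS aT.
by rewrite opBE Sg Tg subrr rdot0r.
Qed.

Lemma comm_inverse X S T : S * T = 1 -> T * S = 1 -> X * S = S * X -> X * T = T * X.
Proof.
move=> ST TS XS; rewrite -[LHS]mul1r -TS -mulrA [S * (X * T)]mulrA -XS.
by rewrite -[X * S * T]mulrA ST mulr1.
Qed.

(* Polar decomposition; [D^#] and [D^-1] are positive square roots of the same
   operator. *)
Lemma Junitary_polar U : Junitary J U -> exists V D,
  [/\ U = V * D, Junitary J D, Junitary J V, adjoint V = V^# &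
      forall f, 0 <= rdot (D f) f].
Proof.
move=> UJ; have /JunitaryE[U1 U2] := UJ; set A := adjoint U.
(* By [J]-unitarity this is the inverse of [A * U], and it equals [J * (A * U) * J]; so the inverse
   of [D] and [J * D * J] are both roots of it. *)
pose T' := U^# * adjoint U^#.
have TT' : A * U * T' = 1.
  by rewrite /T' mulrA -[A * U * _]mulrA U1 mulr1 /A -adjopM U2 adjop1.
have T'T : T' * (A * U) = 1.
  by rewrite /T' mulrA -[U^# * _ * A]mulrA /A -adjopM U1 adjop1 mulr1.
have aUs : adjoint U^# = J * U * J by rewrite jadP !adjopM aJ adjopK mulrA.
have JTJ : J * (A * U) * J = T'.
  by rewrite /T' aUs jadP -/A !mulrA -[J * A * J * J]mulrA JJ mulr1.
have aT' : adjoint T' = T' by rewrite /T' adjopM adjopK.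
have [D [DD aD [c c0 Dp] Dc]] := modulus_ex U; rewrite -/A in DD Dc.
have Dpos f : 0 <= rdot (D f) f.
  by apply: le_trans (Dp f); rewrite mulr_ge0 ?sqr_ge0 // ltW.
move: (T') TT' T'T JTJ aT' => {}T' TT' T'T JTJ aT'.
have DT' : D * T' = T' * D.
  by apply: comm_inverse TT' T'T _; rewrite -DD mulrA.
pose D' := D * T'.
have DD' : D * D' = 1 by rewrite mulrA DD TT'.
have D'D : D' * D = 1 by rewrite /D' DT' -mulrA DD T'T.
have D'D' : D' * D' = T' by rewrite {1}/D' DT' -mulrA DD' mulr1.
have aD' : adjoint D' = D' by rewrite /D' adjopM aT' aD DT'.
pose B := J * D * J.
have aB : adjoint B = B by rewrite /B !adjopM aJ aD mulrA.
have BB : B * B = T'.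
  by rewrite /B !mulrA -[J * D * J * J]mulrA JJ mulr1 -[J * D * D]mulrA DD JTJ.
have BT' : B * T' = T' * B by rewrite -BB mulrA.
have BT : B * (A * U) = A * U * B.
  exact: comm_inverse T'T TT' BT'.
have BD := Dc B BT.
have JDJ : J * D * J = D'.
  apply: (@positive_sqrt_uniq B D' c) => //.
  - by rewrite /D' mulrA BD -mulrA BT' mulrA.
  - by rewrite BB D'D'.
  - move=> f; rewrite /B !opME nm_J //.
    have -> : rdot (J (D (J f))) f = rdot (D (J f)) (J f) by rewrite rdot_adj aJ.
    exact: Dp.
  - move=> f; rewrite -[X in rdot _ X]op1E -DD' opME rdotC; exact: Dpos.
have Ds : D^# = D' by rewrite jadP aD.
have DJ : Junitary J D by apply/JunitaryE; rewrite Ds.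
have VJ : Junitary J (U * D') by rewrite -Ds; apply: JunitaryM (JunitaryV _ _ DJ).
exists (U * D'), D; split=> //; first by rewrite -mulrA D'D mulr1.
have /JunitaryE[V1 _] := VJ.
rewrite -[LHS]mulr1 -V1 mulrA adjopM aD' -/A mulrA -[D' * A * U]mulrA -DD.
by rewrite mulrA D'D mul1r DD' mul1r.
Qed.

(* With [s] the sign of the imaginary part of the unitary [V], both factors of
   [V = (V (is)^-1) (is)] have nonnegative real part. *)
Lemma Junitary_connected U : Junitary J U -> connected_component (Junitary J) 1 U.
Proof.
move=> /Junitary_polar[V [D [-> DJ VJ aVE Dpos]]].
apply: JunitaryM_component => //; last exact: accretive_connected.
have /JunitaryE[] := VJ; rewrite -aVE => V1 V2.
(* [adjoint V = V^#] means that [V] commutes with [J]. The sign [s] below then does too, so that [W]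
   is [J]-unitary as well as unitary. *)
have JaV : J * adjoint V = adjoint V * J.
  by rewrite {2}aVE jadP -!mulrA JJ mulr1.
have JV : J * V = V * J.
  by have := congr1 (@adjoint _ _) JaV; rewrite !adjopM adjopK aJ.
pose ii : R[i] := 0 +i* 1.
have cii : ii^*%C = - ii by apply/eqP; rewrite eq_complex /= oppr0 !eqxx.
have iiN : ii * - ii = 1.
  by apply/eqP; rewrite eq_complex /=; apply/andP; split; apply/eqP; ring.
(* Twice the imaginary part of [V]. *)
pose C := ii *: (adjoint V - V).
have aC : adjoint C = C.
  by rewrite adjopZ adjopB adjopK cii scaleNr -scalerN opprB.
have [D2 [p [[ap pp] Cp Cq [c c0 Dp] cC]]] := sign_ex aC.
have [_ Jp] : J * D2 = D2 * J /\ J * p = p * J.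
  by apply: cC; rewrite /C opZr opZl mulrBr mulrBl JV JaV.
have [_ Vp] : V * D2 = D2 * V /\ V * p = p * V.
  by apply: cC; rewrite /C opZr opZl mulrBr mulrBl V1 V2.
have aVp : adjoint V * p = p * adjoint V.
  by have := congr1 (@adjoint _ _) Vp; rewrite !adjopM ap.
pose s := p - (1 - p).
have Xs X : X * p = p * X -> X * s = s * X.
  by move=> Xp; rewrite /s !mulrBr !mulrBl mulr1 mul1r Xp.
have ss : s * s = 1.
  have ps : p * s = p by rewrite /s !mulrBr mulr1 pp subrr subr0.
  by rewrite {1}/s !mulrBl mul1r ps opprB /s subKr addrC subrK.
have as_ : adjoint s = s by rewrite /s !adjopB adjop1 ap.
pose W := ii *: s.
have aW : adjoint W = - W by rewrite adjopZ cii as_ scaleNr.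
have aWW : adjoint W * W = 1.
  by rewrite aW mulNr /W opZl opZr ss scalerA -scaleNr -mulrN iiN scale1r.
have WaW : W * adjoint W = 1.
  by rewrite aW mulrN /W opZl opZr ss scalerA -scaleNr -mulrN iiN scale1r.
have Ws : W^# = adjoint W.
  rewrite jadP aW mulrN mulNr /W opZr opZl; congr (- (_ *: _)).
  by rewrite (Xs _ Jp) -mulrA JJ mulr1.
have WJ : Junitary J W by apply/JunitaryE; rewrite Ws.
have VE : V = V * adjoint W * W by rewrite -mulrA aWW mulr1.
rewrite VE; have ZJ : Junitary J (V * adjoint W).
  by rewrite -Ws; apply: JunitaryM (JunitaryV _ _ WJ).
apply: JunitaryM_component => //; last first.
  (* [W] is skew-adjoint, so its real part is zero. *)
  apply: accretive_connected => // f; have := rdot_adj W f f.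
  by rewrite aW opNE rdotNr [rdot f _]rdotC; lra.
apply: accretive_connected => // f.
(* Twice the real part of [V * adjoint W] is [s * C], the modulus of [C]. *)
have ZD : V * adjoint W + adjoint (V * adjoint W) = D2.
  rewrite adjopM adjopK aW mulrN /W opZl opZr -scalerN -scalerDr -Xs //.
  rewrite addrC -mulrBl -opZl -/C /s mulrBr Cp Cq opprK -mulrDr.
  by rewrite addrC subrK mulr1.
have : 0 <= rdot (D2 f) f.
  by apply: le_trans (Dp f); rewrite mulr_ge0 ?sqr_ge0 // ltW.
rewrite -ZD opDE rdotDl; set Z := V * adjoint W.
by rewrite [rdot (adjoint Z f) _]rdot_adj adjopK [rdot f _]rdotC; lra.
Qed.

Lemma Jconj_continuous Q : continuous (fun U : L => U * Q * U^#).
Proof.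
apply: nm_continuous => U e e0.
pose k := nm Q * (nm J * nm J).
have k0 : 0 <= k by rewrite !mulr_ge0 ?nm_ge0.
have bound X Y : nm (X * Q * Y^#) <= k * (nm X * nm Y).
  apply: le_trans (opnmM _ _) _.
  have h1 := opnmM X Q; have h2 := nm_jad J Y.
  apply: le_trans (ler_pM (nm_ge0 _) (nm_ge0 _) h1 h2) _.
  by rewrite /k; move: (nm X) (nm Y) (nm Q) (nm J) => x y q j; lra.
pose m := k * (2 * nm U + 1).
have m0 : 0 <= m by rewrite mulr_ge0 // addr_ge0 // mulr_ge0 // nm_ge0.
have m1 : 0 < m + 1 by lra.
exists (Num.min 1 (e / (m + 1))); first by rewrite lt_min ltr01 divr_gt0.
move=> V; rewrite lt_min ltr_pdivlMr // => /andP[d1 d2].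
have -> : U * Q * U^# - V * Q * V^# = (U - V) * Q * U^# + V * Q * (U - V)^#.
  by rewrite jadB mulrBr !mulrBl addrA subrK.
have := nmD ((U - V) * Q * U^#) (V * Q * (U - V)^#).
have := bound (U - V) U; have := bound V (U - V).
have : nm V <= nm U + nm (U - V) by rewrite -{1}[V](subKr U) nmB.
have := nm_ge0 (U - V); have := nm_ge0 U; have := nm_ge0 V.
move: d1 d2; rewrite /m; move: (nm (U - V)) (nm U) (nm V) => d u v d1 d2 v0 u0 d0 vu.
move: (nm _) (nm _) (nm _) => x y z hx hy hz.
have : k * (v * d) <= k * ((u + 1) * d).
  by apply: ler_wpM2l => //; apply: ler_wpM2r => //; lra.
by move: d2; rewrite mulrDr mulr1 mulrCA; lra.
Qed.

Lemma Jorbit_sub_component Q0 : Jnormal_projection J Q0 ->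
  Jorbit J Q0 `<=` connected_component (Jnormal_projection J) Q0.
Proof.
move=> Q0n _ /JorbitE[U UJ <-].
have {1}-> : Q0 = 1 * Q0 * 1^# by rewrite (jad1 JJ) mulr1 mul1r.
apply: (connected_component_image (@Jconj_continuous Q0)) (Junitary_connected UJ).
by move=> _ [W WJ <-]; apply: (Jorbit_normal aJ JJ Q0n); apply/JorbitE; exists W.
Qed.

End JunitaryConnected.

(** * Openness of the orbits *)

Section OrbitOpen.
Context {R : realType} {H : hilbertType R}.
Local Notation L := (bounded_op H).
Implicit Types (S T U V W X Y Q : L) (f g h : H).
Variables (J : L) (aJ : adjoint J = J) (JJ : J * J = 1).
Local Notation "T ^#" := (jad J T) (at level 2, format "T ^#").

(** By coercivity with constant 1 - 1/2. *)
Lemma near_one_inverse T : nm (1 - T) <= 2^-1 ->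
  exists T', T * T' = 1 /\ T' * T = 1.
Proof.
move=> T1; have [|T' [? ? _]] := @coercive_inverse _ _ 2^-1 T ltac:(by rewrite invr_gt0).
  move=> f; have := rdot_le ((1 - T) f) f; rewrite opBE op1E rdotDl rdotNl rdotE.
  have : nm (f - T f) <= 2^-1 * nm f.
    by rewrite (le_trans (opnm_ge (1 - T) f)) // ler_wpM2r ?nm_ge0.
  by have := nm_ge0 f; rewrite expr2; nra.
by exists T'.
Qed.

(* [G] intertwines [Q1], [Q1^#] with [Q], [Q^#]; the unitary factor of its
   [J]-polar decomposition still does. *)
Lemma Jorbit_intertwine Q1 Q (G : L) :
  nm (1 - G) <= 2^-1 -> nm (1 - G^# * G) <= 2^-1 ->
  Q * G = G * Q1 -> Q^# * G = G * Q1^# -> Jorbit J Q1 Q.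
Proof.
move=> G1 T1 QG QsG; set T := G^# * G in T1.
have [G' [GG' _]] := near_one_inverse G1.
have [T' [TT' T'T]] := near_one_inverse T1.
have Ts : T^# = T by rewrite /T (jadM JJ) (jadK aJ JJ).
have [|D [DD _ Dc Da]] := @sqrt_ops _ _ T.
  by apply: le_trans T1 _; rewrite invf_le1 // ler1n.
have Ds : D^# = D by rewrite -jadE; apply: Da => //; rewrite jadE.
(* The relation between [Q^#] and [Q1^#] is used through its [J]-adjoint: together with
   [Q * G = G * Q1] it makes [T] commute with [Q1], and so do its root and the inverse of that
   root. *)
have Q1G : Q1 * G^# = G^# * Q.
  by have := congr1 (jad J) QsG; rewrite !(jadM JJ) !(jadK aJ JJ) => <-.
have Q1T : Q1 * T = T * Q1 by rewrite /T mulrA Q1G -mulrA QG mulrA.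
have DT : D * T = T * D by rewrite -DD mulrA.
have DT' := comm_inverse TT' T'T DT.
have Q1T' := comm_inverse TT' T'T Q1T.
have Q1D := Dc _ Q1T.
have [D' [DD' D'D Q1D']] : exists D', [/\ D * D' = 1, D' * D = 1 & Q1 * D' = D' * Q1].
  exists (D * T'); split; first by rewrite mulrA DD.
    by rewrite DT' -mulrA DD.
  by rewrite mulrA Q1D -mulrA Q1T' mulrA.
have D's : D'^# = D'.
  have : D'^# * D = 1 by rewrite -Ds -(jadM JJ) DD' jad1.
  by move=> h; rewrite -[LHS]mulr1 -DD' mulrA h mul1r.
have U2 : (G * D')^# * (G * D') = 1.
  by rewrite (jadM JJ) D's mulrA -[D' * _ * _]mulrA -/T -DD mulrA D'D mul1r DD'.
have U1 : (G * D') * (G * D')^# = 1.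
  have GD : G * D' * (D * G') = 1 by rewrite mulrA -[G * D' * D]mulrA D'D mulr1.
  suff -> : (G * D')^# = D * G' by [].
  by rewrite -[LHS]mulr1 -GD mulrA U2 mul1r.
apply/JorbitE; exists (G * D'); first exact/JunitaryE.
by rewrite -[G * D' * Q1]mulrA -Q1D' mulrA -QG -[Q * G * D']mulrA -[LHS]mulrA U1 mulr1.
Qed.

(** The operator in parentheses is [x] with its off-diagonal blocks removed, relative to [b] at the
    source and [a] at the target. *)
Lemma corner_intertwine (a b x : L) : a * a = a -> b * b = b ->
  a * (a * x * b + (1 - a) * x * (1 - b)) =
  (a * x * b + (1 - a) * x * (1 - b)) * b.
Proof.
move=> aa bb; rewrite mulrDr [RHS]mulrDl !mulrA aa -[a * x * b * b]mulrA bb.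
rewrite [a * (1 - a)]mulrBr mulr1 aa subrr !mul0r addr0.
by rewrite -[_ * (1 - b) * b]mulrA [(1 - b) * b]mulrBl mul1r bb subrr mulr0 addr0.
Qed.

(** Removing off-diagonal blocks preserves an intertwining that [x] already has, if the idempotents
    commute with it. This is what lets two corner sums be nested. *)
Lemma corner_commute (a b x c d : L) : c * a = a * c -> c * x = x * d ->
  d * b = b * d -> c * (a * x * b + (1 - a) * x * (1 - b)) =
  (a * x * b + (1 - a) * x * (1 - b)) * d.
Proof.
move=> ca cx db.
have ca' : c * (1 - a) = (1 - a) * c by rewrite mulrBr mulrBl mulr1 mul1r ca.
have db' : d * (1 - b) = (1 - b) * d by rewrite mulrBr mulrBl mulr1 mul1r db.
rewrite mulrDr [RHS]mulrDl; congr (_ + _).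
  by rewrite !mulrA ca -[a * c * x]mulrA cx -!mulrA db.
by rewrite !mulrA ca' -[(1 - a) * c * x]mulrA cx -!mulrA db'.
Qed.

Lemma Jorbit_open Q1 : Jnormal_projection J Q1 ->
  exists2 d : R, 0 < d & forall Q, Jnormal_projection J Q -> nm (Q1 - Q) < d ->
    Jorbit J Q1 Q.
Proof.
move=> /Jnormal_projectionE[Q1Q1 Q1n].
have [q Eq] : exists q, nm Q1 = q by eexists.
have q0 : 0 <= q by rewrite -Eq nm_ge0.
have [j [j1 jadle]] : exists j, 1 <= j /\ forall X, nm X^# <= j * nm X.
  exists (nm J * nm J + 1); rewrite lerDr mulr_ge0 ?nm_ge0 //; split=> // X.
  by apply: le_trans (nm_jad J X) _; rewrite ler_wpM2r ?nm_ge0 // lerDl.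
have j0 : 0 <= j by lra.
(* Chosen so that [nm (1 - G) <= d * M] for the intertwiner [G] below: the first term comes from the
   outer corner sum, the second from the inner one. *)
have [M EM] : exists M,
  M = (2 * q + 1) + j * j * (2 * q + 1) * ((q + 1) * q + (q + 2) * (q + 1)) by eexists.
have a0 : 0 <= 2 * q + 1 by lra.
have b0 : 0 <= (q + 1) * q + (q + 2) * (q + 1) by nra.
have M1 : 1 <= M.
  have := mulr_ge0 (mulr_ge0 (mulr_ge0 j0 j0) a0) b0; rewrite EM.
  by move: (j * j * _ * _) => x *; lra.
have m0 : 0 < 6 * j * M by rewrite !mulr_gt0 //; lra.
(* With g for [nm (1 - G)], this radius gives [j] g <= 1/6. Then [1 - G^# * G] has norm at most [j]
   g + (3/2) [j] g <= 5/12, below the 1/2 needed. *)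
exists (6 * j * M)^-1; first by rewrite invr_gt0.
move=> Q /Jnormal_projectionE[QQ Qn] dlt.
have [d Ed] : exists d, nm (Q1 - Q) = d by eexists.
rewrite Ed in dlt; have d0 : 0 <= d by rewrite -Ed nm_ge0.
have dM : 6 * j * (d * M) <= 1.
  have : d * (6 * j * M) <= 1.
    by rewrite -ler_pdivlMr // mul1r ltW.
  by congr (_ <= _); ring.
have d1 : d <= 1 by nra.
have nm1 := @opnm1 _ H.
have Qq : nm Q <= q + 1.
  by rewrite -[Q](subKr Q1) (le_trans (nmB _ _)) // Eq Ed lerD2l.
have Q1' : nm (1 - Q1) <= q + 1 by rewrite (le_trans (nmB _ _)) // Eq addrC lerD2l.
have Q' : nm (1 - Q) <= q + 2.
  by rewrite (le_trans (nmB _ _)) //; move: (nm Q) (nm (1 : L)) Qq nm1 => *; lra.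
pose S1 := Q1 - (1 - Q1).
have S1q : nm S1 <= 2 * q + 1.
  rewrite /S1; apply: le_trans (nmB _ _) _.
  by apply: le_trans (lerD (lexx _) Q1') _; rewrite Eq addrA mulr_natl mulr2n.
(* [K] intertwines [Q^#] with [Q1^#]; taking corners by [Q] and [Q1] gives [G], whose expansion is
   the four-term intertwiner. *)
pose K := Q^# * Q1^# + (1 - Q^#) * (1 - Q1^#).
pose k := (Q - Q1)^# * S1^#.
have Q1sQ1s : Q1^# * Q1^# = Q1^# by rewrite -(jadM JJ) Q1Q1.
have QsQs : Q^# * Q^# = Q^# by rewrite -(jadM JJ) QQ.
(* Shows that a corner sum of the identity differs from 1 by a term linear in [X - Y]. *)
have idem X Y : Y * Y = Y -> X * Y + (1 - X) * (1 - Y) = 1 + (X - Y) * (Y - (1 - Y)).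
  move=> YY; rewrite [(1 - X) * _]mulrBl mul1r !mulrBr mulr1 !mulrBl mulr1 YY.
  rewrite mulr1.
  have -> : X - Y - (X * Y - Y) = X - X * Y by rewrite opprB addrA subrK.
  rewrite -!addrA; exact: addrCA.
have KE : K = 1 + k.
  by rewrite /K idem // /k /S1 !jadB jad1.
pose G := Q * K * Q1 + (1 - Q) * K * (1 - Q1).
have GE : G = 1 + ((Q - Q1) * S1 + (Q * k * Q1 + (1 - Q) * k * (1 - Q1))).
  rewrite addrA -(idem Q Q1) // /G KE mulrDr mulr1 mulrDl.
  by rewrite [(1 - Q) * (1 + k)]mulrDr mulr1 [X in _ + X = _]mulrDl addrACA.
have dC : nm (Q - Q1) = d by rewrite nmBC.
have knm : nm k <= j * j * (2 * q + 1) * d.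
  apply: le_trans (opnmM _ _) _.
  apply: le_trans (ler_pM (nm_ge0 _) (nm_ge0 _) (jadle _) (jadle _)) _.
  rewrite dC; have := nm_ge0 S1; move: (nm S1) S1q => s sq s0.
  have -> : j * d * (j * s) = (j * j * d) * s by ring.
  have -> : j * j * (2 * q + 1) * d = (j * j * d) * (2 * q + 1) by ring.
  by rewrite ler_wpM2l // !mulr_ge0.
have triple X Y (x y : R) : nm X <= x -> nm Y <= y -> nm (X * k * Y) <= nm k * (x * y).
  move=> Xx Yy; apply: le_trans (opnmM _ _) _.
  apply: le_trans (ler_pM (nm_ge0 _) (nm_ge0 _) (opnmM _ _) Yy) _.
  rewrite [nm X * _]mulrC -mulrA ler_wpM2l ?nm_ge0 // ler_wpM2r //.
  exact: le_trans (nm_ge0 _) Yy.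
have G1 : nm (1 - G) <= d * M.
  rewrite GE opprD addrA subrr sub0r nmN; apply: le_trans (nmD _ _) _.
  rewrite EM [leRHS]mulrDr; apply: lerD.
    by apply: le_trans (opnmM _ _) _; rewrite dC ler_wpM2l.
  apply: le_trans (nmD _ _) _.
  apply: le_trans (lerD (triple _ _ _ _ Qq (lexx _)) (triple _ _ _ _ Q' Q1')) _.
  rewrite -mulrDr Eq mulrA; apply: ler_wpM2r => //.
  by rewrite [leRHS]mulrC.
have [g6 gh] : 6 * j * nm (1 - G) <= 1 /\ nm (1 - G) <= 2^-1.
  move: G1 (nm_ge0 (1 - G)) dM j0 j1; move: (nm (1 - G)) (d * M).
  by clear=> g m gm g0 jm j0 j1; split; nra.
apply: (@Jorbit_intertwine Q1 Q G) => //.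
- have -> : 1 - G^# * G = (1 - G)^# + G^# * (1 - G).
    by rewrite jadB (jad1 JJ) mulrBr mulr1 addrA subrK.
  apply: le_trans (nmD _ _) _.
  have Gs : nm G^# <= j * (1 + 2^-1).
    apply: le_trans (jadle _) _; rewrite ler_wpM2l //.
    by rewrite -[G](subKr 1) (le_trans (nmB _ _)) // lerD.
  move: (jadle (1 - G)) (opnmM G^# (1 - G)) (nm_ge0 (1 - G)) g6 Gs.
  move: (nm (1 - G)^#) (nm (G^# * (1 - G))) (nm (1 - G)) (nm G^#).
  clear=> x y z w xz ywz z0 jz wj.
  have : w * z <= j * (1 + 2^-1) * z by apply: ler_wpM2r.
  by lra.
- exact: corner_intertwine.
- apply: corner_commute; [by rewrite Qn| |by rewrite Q1n].
  by have := corner_intertwine 1 QsQs Q1sQ1s; rewrite !mulr1.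
Qed.

Lemma component_sub_Jorbit Q0 : Jnormal_projection J Q0 ->
  connected_component (Jnormal_projection J) Q0 `<=` Jorbit J Q0.
Proof.
move=> Q0n; set A := connected_component _ _.
have An : A `<=` Jnormal_projection J by exact: connected_component_sub.
suff <- : A `&` Jorbit J Q0 = A by move=> Q [].
apply: (component_connected (A := Jnormal_projection J)).
- exists Q0; split; last exact: Jorbit_refl.
  exact: connected_component_refl.
(* Relative openness of the orbit: its trace on the component is cut out by the operators not
   adherent to the [J]-normal projections outside the orbit. *)
- exists (~` closure (Jnormal_projection J `\` Jorbit J Q0)).
    exact/closed_openC/closed_closure.
  apply/seteqP; split=> Q [AQ h]; split=> //.
    move=> /nm_closureP cQ; have [d d0 dP] := Jorbit_open (An _ AQ).
    have [Q' [Q'n oQ'] /(dP _ Q'n) QQ'] := cQ _ d0; apply: oQ'.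
    exact: Jorbit_trans h QQ'.
  by apply: contrapT => oQ; apply: h; apply: subset_closure; split=> //; exact: An.
- exists (closure (Jorbit J Q0)); first exact: closed_closure.
  apply/seteqP; split=> Q [AQ h]; split=> //; first exact: subset_closure.
  have [d d0 dP] := Jorbit_open (An _ AQ).
  move/nm_closureP: h => /(_ _ d0)[Q' oQ' QQ'].
  have Q'n := Jorbit_normal aJ JJ Q0n oQ'.
  by apply: Jorbit_trans oQ' _ => //; apply: Jorbit_sym => //; exact: dP.
Qed.

End OrbitOpen.

(** * Dimension and isometries *)

Section Dimension.
Context {R : realType} {H : hilbertType R}.
Local Notation L := (bounded_op H).
Implicit Types (G T p : L) (f g x y : H) (M B : set H).

Lemma kdotDl G f g x : kdot G (f + g) x = kdot G f x + kdot G g x.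
Proof. by rewrite /kdot linearD dotDl. Qed.
Lemma kdotDr G f g x : kdot G x (f + g) = kdot G x f + kdot G x g.
Proof. by rewrite /kdot dotDr. Qed.
Lemma kdotZl G a f g : kdot G (a *: f) g = a * kdot G f g.
Proof. by rewrite /kdot linearZ dotZl. Qed.
Lemma kdotZr G a f g : kdot G f (a *: g) = a^*%C * kdot G f g.
Proof. by rewrite /kdot dotZr. Qed.
Lemma kdot0l G f : kdot G 0 f = 0.
Proof. by rewrite /kdot linear0 dot0l. Qed.
Lemma kdot0r G f : kdot G f 0 = 0.
Proof. by rewrite /kdot dot0r. Qed.
Lemma kdotBl G f g x : kdot G (f - g) x = kdot G f x - kdot G g x.
Proof. by rewrite /kdot linearB dotBl. Qed.
Lemma kdotBr G f g x : kdot G x (f - g) = kdot G x f - kdot G x g.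
Proof. by rewrite /kdot dotBr. Qed.

Lemma kdot_suml G (I : Type) (r : seq I) (P : pred I) (F : I -> H) g :
  kdot G (\sum_(i <- r | P i) F i) g = \sum_(i <- r | P i) kdot G (F i) g.
Proof.
by elim/big_rec2: _ => [|i x y _ <-]; rewrite ?kdot0l ?kdotDl.
Qed.

Lemma kdot_sumr G (I : Type) (r : seq I) (P : pred I) (F : I -> H) g :
  kdot G g (\sum_(i <- r | P i) F i) = \sum_(i <- r | P i) kdot G g (F i).
Proof.
by elim/big_rec2: _ => [|i x y _ <-]; rewrite ?kdot0r ?kdotDr.
Qed.

Lemma kdot_le G f g : mc (kdot G f g) <= nm G * nm f * nm g.
Proof.
apply: le_trans (cauchy_schwarz _ _) _.
by rewrite ler_wpM2r ?nm_ge0 // opnm_ge.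
Qed.

Lemma rank_one G x y : exists T, forall f, T f = kdot G f x *: y.
Proof.
apply: (@bounded_op_of _ _ _ (nm G * nm x * nm y)) => [a f g|f].
  by rewrite kdotDl kdotZl scalerDl scalerA.
rewrite nmZ -/(mc _) mulrAC ler_wpM2r ?nm_ge0 //.
by apply: le_trans (kdot_le _ _ _) _; rewrite mulrAC.
Qed.

Lemma op_sumE (I : Type) (r : seq I) (P : pred I) (F : I -> L) f :
  (\sum_(i <- r | P i) F i) f = \sum_(i <- r | P i) F i f.
Proof. by elim/big_rec2: _ => [|i x y _ <-]. Qed.

Lemma linear_span_subspace B : subspace (linear_span B).
Proof.
apply: mk_subspace => [|a f g fB gB] M [sM BM]; first exact: subspace0.
by apply: subspaceZD; [|exact: fB|exact: gB].
Qed.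

Lemma linear_span_sub B : B `<=` linear_span B.
Proof. exact: sub_gen_smallest. Qed.

Lemma linear_span_min B M : subspace M -> B `<=` M -> linear_span B `<=` M.
Proof. exact: smallest_sub. Qed.

Lemma fixed_on_closure_span T B :
  (forall f, B f -> T f = f) -> forall f, closure (linear_span B) f -> T f = f.
Proof.
move=> TB f; have -> : (T f = f) = [set f | (T - 1) f = 0] f.
  apply/propext; rewrite /mkset opBE op1E; split=> [->|/subr0_eq //].
  exact: subrr.
move=> cf; apply: (@closed_ker _ _ (T - 1)); apply: closureS cf.
apply: linear_span_min; first exact: subspace_ker.
by move=> g /TB Tg; rewrite /mkset opBE op1E Tg subrr.
Qed.

(** Purely algebraic, so it compares bases orthonormal for different forms: the Hilbert product,
    which defines [hilbert_dim], and the indefinite one, which isometries must preserve. *)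
Definition has_indep M m := exists v : 'I_m -> H, (forall i, M (v i)) /\
  forall c : 'I_m -> R[i], \sum_i c i *: v i = 0 -> forall i, c i = 0.

Definition form_orthonormal G B :=
  (forall f, B f -> kdot G f f = 1) /\
  (forall f g, B f -> B g -> f != g -> kdot G f g = 0).

Lemma form_orthonormal_indep G B M m : form_orthonormal G B -> B `<=` M ->
  `I_m #<= B -> has_indep M m.
Proof.
move=> [B1 B0] BM /pcard_leP[v].
have vB (i : 'I_m) : B (v i) by apply: 'funS_v; exact: ltn_ord.
exists (fun i : 'I_m => v i); split=> [i|c c0 j]; first exact/BM/vB.
have := congr1 (fun x => kdot G x (v j)) c0; rewrite kdot0l kdot_suml.
rewrite (bigD1 j) //= big1 => [|i ij]; first by rewrite addr0 kdotZl B1 // mulr1.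
rewrite kdotZl B0 ?mulr0 //; apply: contra ij => /eqP vij; apply/eqP/val_inj.
by apply: 'inj_v; rewrite ?inE //=; exact: ltn_ord.
Qed.

(** With [m > N], the [m] by [N] matrix of coefficients of the [v i] has a nonzero left kernel
    vector, which is a linear relation among them. *)
Lemma form_orthonormal_span G B M N m : form_orthonormal G B -> `I_N #= B ->
  M `<=` closure (linear_span B) -> has_indep M m -> (m <= N)%N.
Proof.
move=> [B1 B0] /card_set_bijP[b [bB binj bsurj]] MB [v [vM vi]].
rewrite leqNgt; apply/negP => Nm.
have /choice[T TP] (j : 'I_N) := rank_one G (b j) (b j).
(* The finite sum of rank-one operators is bounded and fixes each [b j], hence fixes the closed
   span; the expansion is exact although [M] is only known to lie in a closure. *)
have vE x : M x -> x = \sum_(j < N) kdot G x (b j) *: b j.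
  move=> /MB cx; have : (\sum_j T j) x = x.
    apply: fixed_on_closure_span cx => _ /bsurj[j jN <-].
    rewrite op_sumE (bigD1 (Ordinal jN)) //= TP B1 ?scale1r; last exact: bB.
    rewrite big1 ?addr0 // => i ij; rewrite TP B0 ?scale0r //.
    - exact: bB.
    - by apply: bB => /=; exact: ltn_ord.
    - apply: contra ij => /eqP bij; apply/eqP/val_inj/esym.
      by apply: binj => //; rewrite inE //=; exact: ltn_ord.
  by rewrite op_sumE => {1}<-; apply: eq_bigr => j _; rewrite TP.
pose a := \matrix_(i < m, j < N) kdot G (v i) (b j).
have : kermx a != 0.
  by rewrite -mxrank_eq0 mxrank_ker subn_eq0 -ltnNge (leq_ltn_trans (rank_leq_col a)).
case/rowV0Pn => u /sub_kermxP ua; apply/negP; rewrite negbK; apply/eqP/rowP => i.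
rewrite mxE; apply: (vi (u 0)); rewrite (eq_bigr (fun i =>
    \sum_(j < N) (u 0 i * a i j) *: b j)); last first.
  move=> k _; rewrite {1}(vE (v k)) // scaler_sumr; apply: eq_bigr => j _.
  by rewrite scalerA mxE.
rewrite exchange_big big1 //= => j _; rewrite -scaler_suml.
by have /rowP/(_ j) := ua; rewrite !mxE => ->; rewrite scale0r.
Qed.

(* These are the only two cases that [hilbert_dim] distinguishes. *)
Lemma form_orthonormal_card G B M : form_orthonormal G B -> B `<=` M ->
  M `<=` closure (linear_span B) ->
  (exists N, B #= `I_N /\ forall m, has_indep M m <-> (m <= N)%N)
  \/ (infinite_set B /\ forall m, has_indep M m).
Proof.
move=> oB BM MB; have [/finite_setP[N BN]|infB] := pselect (finite_set B); [left|right].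
  exists N; split=> // m; split.
    by apply: form_orthonormal_span oB _ MB; rewrite card_eq_sym.
  by move=> mN; apply: form_orthonormal_indep oB BM _; rewrite (card_le_eqr BN) card_le_II.
split=> // m; apply: form_orthonormal_indep oB BM _.
by apply: card_le_trans (iffLR (infiniteP B) infB); exact: card_leT.
Qed.

Lemma counting_card (T : choiceType) (A : set T) N :
  A #= `I_N -> counting A = N%:R%:E :> \bar R.
Proof.
move=> AN; have fA : finite_set A by apply/finite_setP; exists N.
rewrite /counting asboolT //; congr (_%:R%:E).
by apply/card_eq_fsetP; rewrite fset_setK.
Qed.

Definition same_dim M M' := forall m, has_indep M m <-> has_indep M' m.

(** [hilbert_dim] reads off one chosen basis; the sizes of independent families determine the value,
    finite or [+oo], that any choice yields. *)
Lemma hilbert_dim_eq M M' :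
  (exists B, orthonormal_basis M B) -> (exists B, orthonormal_basis M' B) ->
  hilbert_dim M = hilbert_dim M' <-> same_dim M M'.
Proof.
have key N : (exists B, orthonormal_basis N B) ->
  (exists n, hilbert_dim N = n%:R%:E /\ forall m, has_indep N m <-> (m <= n)%N) \/
  (hilbert_dim N = +oo%E /\ forall m, has_indep N m).
  move=> [B0 oB0]; rewrite /hilbert_dim; case: xgetP => [B _ [[B1 Bo] BN]|]; last first.
    by move=> /(_ B0).
  have oB : form_orthonormal 1 B by [].
  have BsubN : B `<=` N.
    by rewrite -BN => f /linear_span_sub; exact: subset_closure.
  have NB : N `<=` closure (linear_span B) by rewrite BN.
  have [[n [Bn h]]|[iB h]] := form_orthonormal_card oB BsubN NB; [left|right].
    by exists n; split=> //; exact: counting_card.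
  by split=> //; rewrite /counting asboolF.
move=> /key [[n [-> hn]]|[-> h]] /key [[n' [-> hn']]|[-> h']]; split=> //.
- move=> /eqP; rewrite eqe eqr_nat => /eqP nn' m.
  by rewrite nn' in hn; split=> [/hn/hn'|/hn'/hn].
- move=> s; congr (_%:R%:E); apply/eqP; rewrite eqn_leq.
  by apply/andP; split; [apply/hn'/s/hn|apply/hn/s/hn'].
- by move=> s; have /s/hn : has_indep M' n.+1; rewrite ?ltnn.
- by move=> s; have /s/hn' : has_indep M n'.+1; rewrite ?ltnn.
Qed.

End Dimension.

(** * Gram-Schmidt bases for a uniformly positive form *)

Section OrthonormalSequences.
Context {R : realType} {H : hilbertType R}.
Local Notation L := (bounded_op H).
Implicit Types (T p : L) (f g x y : H) (M B : set H).

Lemma kdot_real G f : adjoint G = G -> kdot G f f = (complex.Re (kdot G f f))%:C.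
Proof.
move=> aG; have := kdotC aG f f; case: (kdot G f f) => a b /eqP.
rewrite eq_complex /= => /andP[_ /eqP bN]; have -> : b = 0 by lra.
by [].
Qed.

Lemma uniformly_positiveP G M : adjoint G = G ->
  uniformly_positive G M <-> exists2 c : R, 0 < c &
    forall f, M f -> c * nm f ^+ 2 <= complex.Re (kdot G f f).
Proof.
move=> aG; split=> -[c c0 cM]; exists c => // f /cM.
  by rewrite (kdot_real f aG) nmE -rmorphXn -rmorphM /= lecR.
by rewrite (kdot_real f aG) nmE -rmorphXn -rmorphM /= lecR.
Qed.

(** Course-of-values recursion, as Gram-Schmidt requires. *)
Lemma exists_iterated (T : Type) (F : nat -> seq T -> T) :
  exists e : nat -> T, forall n, e n = F n (mkseq e n).
Proof.
pose gs := fix gs n := if n is k.+1 then rcons (gs k) (F k (gs k)) else [::].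
exists (fun n => F n (gs n)) => n; congr (F n _).
by elim: n => [//|n IH] /=; rewrite mkseqS -IH.
Qed.

(** Project a countable dense subset of [H] onto [M]. Indices hit by no point give 0, which lies in
    [M]. *)
Lemma dense_sequence M : separable H -> subspace M -> closed M ->
  exists u : nat -> H, (forall n, M (u n)) /\ M `<=` closure (range u).
Proof.
move=> [D [/countable_injP[h hinj] dD]] sM cM.
have [p [_ pp pM]] := projection_op sM cM.
pose u n := p (xget 0 [set x | D x /\ h x = n]).
have Mp x : M (p x) by apply/pM; rewrite -opME pp.
exists u; split=> [n|x Mx]; first exact: Mp.
apply/nm_closureP => e e0; have p0 := nm_ge0 p; have p1 : 0 < nm p + 1 by lra.
have d0 : 0 < e / (nm p + 1) by exact: divr_gt0.
have [||y [xy Dy]] := dD (ball x (e / (nm p + 1))%:C).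
- by exists x; apply: ballxx; rewrite ltcR.
- by apply: ball_open; rewrite ltcR.
have uy : u (h y) = p y.
  rewrite /u; case: xgetP => [z _ [Dz hz]|/(_ y)]; last by case.
  by congr (p _); apply: hinj; rewrite ?inE.
exists (p y); first by exists (h y).
have -> : x - p y = p (x - y) by rewrite linearB; congr (_ - _); apply/esym/pM.
move: xy; rewrite -ball_normE /= nmE ltcR ltr_pdivlMr // => xy.
apply: le_lt_trans (opnm_ge _ _) _; move: xy; move: (nm _) (nm _) p0 (nm_ge0 (x - y)).
by move=> *; lra.
Qed.

(** Vectors outside the index set [A] are padded with 0, so finite and infinite bases are treated
    alike and Gram-Schmidt may discard a vector without renumbering. *)
Definition onb G M (A : set nat) (e : nat -> H) :=
  [/\ forall n, M (e n), forall n m, n <> m -> kdot G (e n) (e m) = 0,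
      forall n, A n -> kdot G (e n) (e n) = 1, forall n, ~ A n -> e n = 0 &
      M `<=` closure (linear_span (range e))].

Lemma onb_exists G M : separable H -> adjoint G = G -> subspace M -> closed M ->
  uniformly_positive G M -> exists A e, onb G M A e.
Proof.
move=> sepH aG sM cM /(uniformly_positiveP _ aG)[c c0 cP].
have [u [Mu dM]] := dense_sequence sepH sM cM.
(* On [M], uniform positivity makes a vector of zero square vanish, so the default 0 loses nothing
   from the span. *)
pose nrm r := if kdot G r r == 0 then 0
  else ((Num.sqrt (complex.Re (kdot G r r)))^-1)%:C *: r.
have nrm0 r : kdot G r r == 0 -> nrm r = 0 by rewrite /nrm => ->.
have nrm1 r : M r -> kdot G r r != 0 -> kdot G (nrm r) (nrm r) = 1.
  move=> Mr r0; rewrite /nrm (negbTE r0) kdotZl kdotZr conjc_real.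
  move: r0 (cP _ Mr); rewrite (kdot_real r aG) /=; move: (complex.Re _) => q q0 cq.
  have {}q0 : q != 0 by apply: contra q0 => /eqP ->.
  have qp : 0 < q.
    by rewrite lt0r q0 (le_trans _ cq) // mulr_ge0 ?sqr_ge0 // ltW.
  rewrite -!rmorphM /= -[1]/(1%:C); congr _%:C.
  by rewrite mulrA -invfM -expr2 sqr_sqrtr ?ltW // mulVf.
have nrmM r : M r -> M (nrm r).
  move=> Mr; rewrite /nrm; case: ifP => _; first exact: subspace0.
  exact: subspaceZ.
have nrm_span r : M r -> exists a, r = a *: nrm r.
  move=> Mr; rewrite /nrm; case: ifPn => r0.
    exists 0; rewrite scale0r; apply: nm_eq0; apply/eqP; rewrite -sqrf_eq0 eq_le.
    rewrite sqr_ge0 andbT -(ler_pM2l c0) mulr0 (le_trans (cP _ Mr)) //.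
    by rewrite (eqP r0).
  exists (Num.sqrt (complex.Re (kdot G r r)))%:C.
  rewrite scalerA -rmorphM /= divff ?scale1r // sqrtr_eq0 -ltNge.
  move: r0 (cP _ Mr); rewrite (kdot_real r aG) /=; move: (complex.Re _) => q q0 cq.
  have {}q0 : q != 0 by apply: contra q0 => /eqP ->.
  by rewrite lt0r q0 (le_trans _ cq) // mulr_ge0 ?sqr_ge0 // ltW.
have [e eE0] := exists_iterated (fun n s =>
  nrm (u n - \sum_(x <- s) kdot G (u n) x *: x)).
pose r n := u n - \sum_(i <- iota 0 n) kdot G (u n) (e i) *: e i.
have eE n : e n = nrm (r n) by rewrite eE0 /mkseq big_map.
have Me n : M (e n) /\ M (r n).
  elim/ltn_ind: n => n IH; suff Mr : M (r n) by split=> //; rewrite eE; exact: nrmM.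
  apply: subspaceB => //; rewrite big_seq_cond.
  elim/big_rec: _ => [|i x]; first exact: subspace0.
  rewrite mem_iota andbT /= => /IH[Mi _] Mx.
  by apply: subspaceD => //; exact: subspaceZ.
have e01 n : e n = 0 \/ kdot G (e n) (e n) = 1.
  rewrite eE; have [r0|r0] := eqVneq (kdot G (r n) (r n)) 0.
    by left; apply: nrm0; rewrite r0.
  by right; apply: nrm1 => //; exact: (Me n).2.
have orth n : forall j, (j < n)%N -> kdot G (e n) (e j) = 0.
  elim/ltn_ind: n => n IH j jn.
  have rj : kdot G (r n) (e j) = 0.
    rewrite /r kdotBl kdot_suml (bigD1_seq j) ?iota_uniq ?mem_iota //=.
    rewrite big_seq_cond big1 ?addr0 => [|i /andP[]].
      by rewrite kdotZl; have [->|->] := e01 j; rewrite ?kdot0r ?mul0r ?mulr1 subrr.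
    rewrite mem_iota /= add0n => i_n ij; rewrite kdotZl.
    have [ltij|ltji|eij] := ltngtP i j; last by rewrite eij eqxx in ij.
      by rewrite [kdot G (e i) _]kdotC // (IH j) // conjc0 mulr0.
    by rewrite (IH i) ?mulr0.
  rewrite eE /nrm; case: ifP => _; first by rewrite kdot0l.
  by rewrite kdotZl rj mulr0.
exists [set n | e n != 0], e; split.
- by move=> n; exact: (Me n).1.
- move=> n m nm_; have [lt|lt|//] := ltngtP n m; last exact: orth.
  by rewrite kdotC // orth // conjc0.
- by move=> n /= n0; have [n1|//] := e01 n; rewrite n1 eqxx in n0.
- by move=> n /= /negP; rewrite negbK => /eqP.
- move=> x /dM; apply: closureS => _ [n _ <-].
  have -> : u n = r n + \sum_(i <- iota 0 n) kdot G (u n) (e i) *: e i by rewrite subrK.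
  have sE := linear_span_subspace (range e).
  have eL k : linear_span (range e) (e k) by apply: linear_span_sub; exists k.
  apply: (subspaceD sE).
    have [a ->] := nrm_span (r n) (Me n).2; rewrite -eE; exact: (subspaceZ _ sE).
  elim/big_rec: _ => [|i y _ yE]; first exact: (subspace0 sE).
  by apply: (subspaceD sE) => //; exact: (subspaceZ _ sE).
Qed.

End OrthonormalSequences.

(** * Transport between two bases over the same index set *)

Section Transport.
Context {R : realType} {H : hilbertType R}.
Local Notation L := (bounded_op H).
Implicit Types (T p : L) (f g x y : H) (M B : set H).
Variables (G : L) (aG : adjoint G = G).

Lemma onb01 M A e n : onb G M A e -> e n = 0 \/ kdot G (e n) (e n) = 1.
Proof.
move=> [_ _ e1 e0 _]; have [An|An] := pselect (A n); first by right; exact: e1.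
by left; exact: e0.
Qed.

Lemma onb_kdot_sum M A e r (a : nat -> R[i]) j : onb G M A e -> uniq r -> j \in r ->
  kdot G (\sum_(i <- r) a i *: e i) (e j) = a j * kdot G (e j) (e j).
Proof.
move=> [_ orth _ _ _] ur jr; rewrite kdot_suml (bigD1_seq j) //= big1 ?addr0 ?kdotZl //.
by move=> i /eqP ij; rewrite kdotZl orth ?mulr0.
Qed.

Lemma Re_sum (I : Type) (r : seq I) (F : I -> R[i]) :
  complex.Re (\sum_(i <- r) F i) = \sum_(i <- r) complex.Re (F i).
Proof. exact: raddf_sum. Qed.

(** An inequality, since indices with [e i = 0] contribute nothing on the left. *)
Lemma onb_sqsum_le M A e r (a : nat -> R[i]) : onb G M A e -> uniq r ->
  complex.Re (kdot G (\sum_(i <- r) a i *: e i) (\sum_(i <- r) a i *: e i))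
  <= \sum_(i <- r) mc (a i) ^+ 2.
Proof.
move=> oe ur; rewrite [in X in kdot _ _ X]big_seq kdot_sumr -big_seq Re_sum.
rewrite big_seq [leRHS]big_seq; apply: ler_sum => j jr.
rewrite kdotZr (onb_kdot_sum _ oe) // mulrCA mulrA mc2E.
by have [->|->] := onb01 j oe; rewrite ?kdot0l ?mulr0 ?mulr1 //= sqr_ge0.
Qed.

Variables (c : R) (c0 : 0 < c).
Let positive M := forall f, M f -> c * nm f ^+ 2 <= complex.Re (kdot G f f).

(** With [g] the partial expansion of [f], [c * nm g ^+ 2 <= s <= nm G * nm f * nm g]; eliminating
    [nm g] bounds [s]. The vector [f] ranges over all of [H], so the transport operators are defined
    everywhere. *)
Lemma onb_bessel M A e r f : subspace M -> positive M -> onb G M A e -> uniq r ->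
  \sum_(i <- r) mc (kdot G f (e i)) ^+ 2 <= nm G ^+ 2 / c * nm f ^+ 2.
Proof.
move=> sM pM oe ur; set s := \sum_(i <- r) _; have [Me _ _ _ _] := oe.
pose g := \sum_(i <- r) kdot G f (e i) *: e i.
have Mg : M g.
  rewrite /g; elim/big_rec: _ => [|i x _ Mx]; first exact: subspace0.
  by apply: subspaceD => //; exact: subspaceZ.
have s0 : 0 <= s by apply: sumr_ge0 => i _; exact: sqr_ge0.
have sE : s = complex.Re (kdot G f g).
  rewrite /g kdot_sumr Re_sum; apply: eq_bigr => i _.
  by rewrite kdotZr mulrC mc2E.
have cg : c * nm g ^+ 2 <= s.
  by apply: le_trans (pM _ Mg) _; exact: onb_sqsum_le oe ur.
have sg : s <= nm G * nm f * nm g.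
  by rewrite sE (le_trans (Re_le_mc _)) // kdot_le.
have [->|sn0] := eqVneq s 0.
  by rewrite mulr_ge0 ?sqr_ge0 // divr_ge0 ?sqr_ge0 ?ltW.
have sp : 0 < s by rewrite lt0r sn0.
rewrite mulrAC -exprMn ler_pdivlMr // -(ler_pM2r sp).
have := mulr_ge0 (nm_ge0 G) (nm_ge0 f); move: cg sg; clear sE.
move: (nm G * nm f) (nm g) (nm_ge0 g).
move=> b x x0 cx sb b0.
have h1 : s * s <= (b * x) * (b * x) by apply: ler_pM.
have h2 : b ^+ 2 * (c * x ^+ 2) <= b ^+ 2 * s by rewrite ler_wpM2l ?sqr_ge0.
have h3 : c * (s * s) <= c * ((b * x) * (b * x)) by rewrite ler_wpM2l // ltW.
by rewrite expr2 in h2 *; nra.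
Qed.

(** Positivity on [M] bounds the increments of the vector sums by those of the Bessel sums of [f]
    along [e'], which increase and are bounded. *)
Lemma onb_shift M M' A A' e e' : subspace M -> subspace M' -> positive M -> positive M' ->
  onb G M A e -> onb G M' A' e' ->
  exists T, forall f,
    ncvg (fun n => \sum_(i <- iota 0 n) kdot G f (e' i) *: e i) (T f).
Proof.
move=> sM sM' pM pM' oe oe'; have [Me _ _ _ _] := oe.
pose S n f := \sum_(i <- iota 0 n) kdot G f (e' i) *: e i.
pose s f n := \sum_(i <- iota 0 n) mc (kdot G f (e' i)) ^+ 2.
have split_sum (V : nmodType) (F : nat -> V) m n : (m <= n)%N ->
    \sum_(i <- iota 0 n) F i = \sum_(i <- iota 0 m) F i + \sum_(i <- iota m (n - m)) F i.
  by move=> mn; rewrite -{1}(subnKC mn) iotaD add0n big_cat.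
have MS f r : M (\sum_(i <- r) kdot G f (e' i) *: e i).
  elim/big_rec: _ => [|i x _ Mx]; first exact: subspace0.
  by apply: subspaceD => //; exact: subspaceZ.
have sumle f r : uniq r -> c * nm (\sum_(i <- r) kdot G f (e' i) *: e i) ^+ 2 <=
    \sum_(i <- r) mc (kdot G f (e' i)) ^+ 2.
  by move=> ur; apply: le_trans (pM _ (MS f r)) _; exact: onb_sqsum_le oe ur.
have Sdiff f m n : (m <= n)%N -> c * nm (S n f - S m f) ^+ 2 <= s f n - s f m.
  move=> mn; rewrite /S /s !(split_sum _ _ m n mn) ![_ + _ - _]addrAC !subrr !add0r.
  by apply: sumle; exact: iota_uniq.
pose K := nm G ^+ 2 / c.
have sK f n : s f n <= K * nm f ^+ 2.
  by apply: (onb_bessel f sM' pM' oe'); exact: iota_uniq.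
have smono f : {homo s f : m n / (m <= n)%N >-> m <= n}.
  move=> m n mn; rewrite /s (split_sum _ _ m n mn) lerDl.
  by apply: sumr_ge0 => i _; exact: sqr_ge0.
have /choice[F FP] f : exists g, ncvg (fun n => S n f) g.
  apply: nm_complete => d d0.
  have d1 : 0 < c * d ^+ 2 by rewrite mulr_gt0 ?exprn_gt0.
  have [N NP] := monotone_bounded_cauchy (smono f) (sK f) d1.
  exists N => m n mN nN.
  wlog mn : m n mN nN / (m <= n)%N.
    by move=> W; have [/W|/ltnW/W] := leqP m n; [|rewrite nmBC]; apply.
  have := le_lt_trans (Sdiff f m n mn) (NP m n mN); rewrite ltr_pM2l // nmBC.
  by rewrite ltr_pXn2r // ?nnegrE ?nm_ge0 // ltW.
have K0 : 0 <= K by rewrite divr_ge0 ?sqr_ge0 ?ltW.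
have [||T TE] := @bounded_op_of _ _ F (Num.sqrt (K / c)).
- move=> a f g; apply: ncvg_uniq (FP _) _.
  apply: ncvg_ext (ncvgD (ncvgZ a (FP f)) (FP g)) => n /=.
  rewrite /S scaler_sumr -big_split; apply: eq_bigr => i _ /=.
  by rewrite kdotDl kdotZl scalerDl scalerA.
- move=> f; apply: ncvg_le (FP f) _ => n.
  rewrite -(@ler_pXn2r _ 2) ?nnegrE ?mulr_ge0 ?sqrtr_ge0 ?nm_ge0 // exprMn.
  rewrite sqr_sqrtr ?(divr_ge0 K0 (ltW c0)) // mulrAC ler_pdivlMr // mulrC.
  by apply: le_trans (sumle f _ (iota_uniq _ _)) (sK f n).
by exists T => f; rewrite TE; exact: FP.
Qed.

(** [T] and [T'] are the series sending [e'] to [e] and back. They are inverse to each other on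
    basis vectors, hence on closed spans; the adjunction holds for partial sums and passes to the
    limit. *)
Lemma onb_transport M M' A e e' : subspace M -> subspace M' -> closed M -> closed M' ->
  positive M -> positive M' -> onb G M A e -> onb G M' A e' ->
  exists T T', [/\ forall f, M (T f), forall f, M' (T' f),
    forall f, M f -> T (T' f) = f, forall f, M' f -> T' (T f) = f &
    forall f g, kdot G (T f) g = kdot G f (T' g)].
Proof.
move=> sM sM' cM cM' pM pM' oe oe'.
have [T TP] := onb_shift sM sM' pM pM' oe oe'.
have [T' T'P] := onb_shift sM' sM pM' pM oe' oe.
have range_in N N' Z e1 e2 (X : L) : subspace N -> closed N -> onb G N Z e1 ->
    (forall f, ncvg (fun n => \sum_(i <- iota 0 n) kdot G f (e2 i) *: e1 i) (X f)) ->
    onb G N' Z e2 -> forall f, N (X f).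
  move=> sN cN [Ne _ _ _ _] XP _ f; apply: (nm_closed cN) => d /(XP f)[n nP].
  exists (\sum_(i <- iota 0 n) kdot G f (e2 i) *: e1 i); last by rewrite nmBC nP.
  elim/big_rec: _ => [|i x _ Mx]; first exact: subspace0.
  by apply: subspaceD => //; exact: subspaceZ.
have on_basis N N' Z e1 e2 (X : L) : onb G N Z e1 -> onb G N' Z e2 ->
    (forall f, ncvg (fun n => \sum_(i <- iota 0 n) kdot G f (e2 i) *: e1 i) (X f)) ->
    forall n, X (e2 n) = e1 n.
  move=> [_ _ _ e10 _] [_ orth e21 e20 _] XP n; apply: ncvg_uniq (XP _) _ => d d0.
  exists n.+1 => k nk; rewrite (bigD1_seq n) ?iota_uniq ?mem_iota //= big1.
    have [Bn|Bn] := pselect (Z n); first by rewrite e21 // scale1r addr0 subrr nm0.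
    by rewrite e10 // scaler0 addr0 subrr nm0.
  by move=> i /eqP ni; rewrite orth ?scale0r //; exact/nesym.
exists T, T'; split.
- exact: (range_in M M' A e e').
- exact: (range_in M' M A e' e).
- have [_ _ _ _ Mcl] := oe; move=> f /Mcl; rewrite -opME.
  apply: fixed_on_closure_span => _ [n _ <-].
  by rewrite opME (on_basis _ _ _ _ _ _ oe' oe T'P) (on_basis _ _ _ _ _ _ oe oe' TP).
- have [_ _ _ _ Mcl] := oe'; move=> f /Mcl; rewrite -opME.
  apply: fixed_on_closure_span => _ [n _ <-].
  by rewrite opME (on_basis _ _ _ _ _ _ oe oe' TP) (on_basis _ _ _ _ _ _ oe' oe T'P).
- move=> f g; apply: subr0_eq; apply: mc_eq0; apply/eqP; rewrite eq_le mc_ge0 andbT.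
  apply/ler_addgt0Pr => d d0; rewrite add0r.
  have G0 := nm_ge0 G; have f0 := nm_ge0 f; have g0 := nm_ge0 g.
  (* The two error terms add up to at most [k] times the larger of the two distances, hence to less
     than [d]. *)
  pose k := nm G * nm g + nm G * nm f + 1.
  have k0 : 0 < k by rewrite ltr_wpDl ?addr_ge0 ?mulr_ge0.
  have [N1 N1P] := TP f _ (divr_gt0 d0 k0).
  have [N2 N2P] := T'P g _ (divr_gt0 d0 k0).
  have h1 := N1P _ (leq_maxl N1 N2); have h2 := N2P _ (leq_maxr N1 N2).
  move: h1 h2; set n := maxn N1 N2.
  set x := \sum_(i <- _) _; set y := \sum_(i <- _) _ => h1 h2.
  have xy : kdot G x g = kdot G f y.
    rewrite /x /y kdot_suml kdot_sumr; apply: eq_bigr => i _.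
    by rewrite kdotZl kdotZr mulrC -kdotC.
  have -> : kdot G (T f) g - kdot G f (T' g) =
      - kdot G (x - T f) g + kdot G f (y - T' g).
    by rewrite kdotBl kdotBr xy opprB addrA subrK.
  apply: le_trans (mcD _ _) _; rewrite mcN.
  have := kdot_le G (x - T f) g; have := kdot_le G f (y - T' g).
  move: h1 h2; rewrite !ltr_pdivlMr // /k.
  move: (nm (x - T f)) (nm (y - T' g)) (nm_ge0 (x - T f)) (nm_ge0 (y - T' g)).
  move: (mc _) (mc _) (nm G) (nm f) (nm g) G0 f0 g0 => m1 m2 u v w u0 v0 w0 a b.
  clear -u0 v0 w0; rewrite !mulrDr !mulr1 => a0 b0 h1 h2 h3 h4.
  have uw0 := mulr_ge0 u0 w0; have uv0 := mulr_ge0 u0 v0.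
  have [ab|/ltW ba] := leP a b.
    have := ler_wpM2r uw0 ab; move: h2 h3 h4.
    by lra.
  have := ler_wpM2r uv0 ba; move: h1 h3 h4.
  by lra.
Qed.

End Transport.

(** * Isometries from equality of dimensions *)

Section DimensionIsometry.
Context {R : realType} {H : hilbertType R}.
Local Notation L := (bounded_op H).
Implicit Types (G T p : L) (f g x y : H) (M B : set H).

(** Brings two bases over a common index set, so that the [n]-th vectors can be matched. *)
Lemma onb_reindex G M A A' e : subspace M -> onb G M A e -> A #= A' ->
  exists e', onb G M A' e'.
Proof.
move=> sM [Me orth e1 e0 Mcl]; rewrite card_eq_sym => /card_set_bijP[h [hA hinj hsurj]].
pose e' n := if n \in A' then e (h n) else 0.
have e'1 n : A' n -> e' n = e (h n) by move=> An; rewrite /e' mem_set.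
have e'0 n : ~ A' n -> e' n = 0 by move=> An; rewrite /e' memNset.
exists e'; split=> //.
- move=> n; have [A'n|A'n] := pselect (A' n); first by rewrite e'1.
  by rewrite e'0 //; exact: subspace0.
- move=> n m nm_; have [A'n|A'n] := pselect (A' n); last by rewrite e'0 // kdot0l.
  have [A'm|A'm] := pselect (A' m); last by rewrite [e' m]e'0 // kdot0r.
  by rewrite !e'1 // orth // => hnm; apply: nm_; apply: hinj; rewrite ?inE.
- by move=> n A'n; rewrite e'1 // e1 //; exact: hA.
- move=> f /Mcl; apply: closureS; apply: linear_span_min.
    exact: linear_span_subspace.
  move=> _ [n _ <-]; have [An|An] := pselect (A n); last first.
    rewrite e0 //; apply: subspace0; exact: linear_span_subspace.
  have [m A'm <-] := hsurj n An.
  by apply: linear_span_sub; exists m => //; rewrite e'1.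
Qed.

Lemma onb_orthonormal_set G M A e : onb G M A e ->
  [/\ form_orthonormal G (e @` A), e @` A `<=` M,
      M `<=` closure (linear_span (e @` A)) & e @` A #= A].
Proof.
move=> [Me orth e1 e0 Mcl]; split.
- split=> [_ [n An <-]|_ _ [n An <-] [m Am <-] enm]; first exact: e1.
  by apply: orth => nm_; rewrite nm_ eqxx in enm.
- by move=> _ [n _ <-].
- move=> f /Mcl; apply: closureS; apply: linear_span_min.
    exact: linear_span_subspace.
  move=> _ [n _ <-]; have [An|An] := pselect (A n); last first.
    rewrite e0 //; apply: subspace0; exact: linear_span_subspace.
  by apply: linear_span_sub; exists n.
- apply: inj_card_eq => n m; rewrite !inE => An Am enm.
  apply: contrapT => nm_; have := orth n m nm_; rewrite -enm e1 // => /eqP.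
  by rewrite oner_eq0.
Qed.

Lemma infinite_nat_card (A : set nat) : infinite_set A -> A #= [set: nat].
Proof. by move=> /infiniteP Ainf; apply/card_eqPle; split=> //; exact: card_leT. Qed.

Lemma same_dim_card G M A e G' M' A' e' :
  onb G M A e -> onb G' M' A' e' -> same_dim M M' -> A #= A'.
Proof.
move=> /onb_orthonormal_set[oB BM MB BA] /onb_orthonormal_set[oB' BM' MB' BA'] s.
have [[N [BN hN]]|[Binf h]] := form_orthonormal_card oB BM MB;
  have [[N' [BN' hN']]|[Binf' h']] := form_orthonormal_card oB' BM' MB'.
- have NN' : N = N'.
    by apply/eqP; rewrite eqn_leq; apply/andP; split; [apply/hN'/s/hN|apply/hN/s/hN'].
  rewrite -(card_eql BA) -(card_eqr BA') (card_eql BN) (card_eqr BN') NN'.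
  exact: card_eqxx.
- by have /s/hN : has_indep M' N.+1 by []; rewrite ltnn.
- by have /s/hN' : has_indep M N'.+1 by []; rewrite ltnn.
- have Ainf : infinite_set A by rewrite -(eq_finite_set BA).
  have Ainf' : infinite_set A' by rewrite -(eq_finite_set BA').
  by rewrite (card_eql (infinite_nat_card Ainf)) card_eq_sym infinite_nat_card.
Qed.

Lemma closed_subspace_basis M : separable H -> subspace M -> closed M ->
  exists B, orthonormal_basis M B.
Proof.
move=> sepH sM cM; have [|A [e oe]] := @onb_exists _ _ 1 M sepH (adjop1 (H := H)) sM cM.
  by exists 1 => // f _; rewrite mul1r /kdot op1E dotpE.
have [oB BM MB _] := onb_orthonormal_set oe; exists (e @` A); split=> //.
apply/seteqP; split=> // f /nm_closureP cf; apply: (nm_closed cM) => d /cf[g gB fg].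
by exists g => //; exact: linear_span_min gB.
Qed.

(** Used with [G = J] and [G = - J] on definite parts, and with [G = 1] on neutral ranges, where a
    mere isomorphism is wanted. *)
Lemma dim_isometry G M M' : separable H -> adjoint G = G ->
  subspace M -> subspace M' -> closed M -> closed M' ->
  uniformly_positive G M -> uniformly_positive G M' ->
  hilbert_dim M = hilbert_dim M' ->
  exists T T', [/\ forall f, M (T f), forall f, M' (T' f),
    forall f, M f -> T (T' f) = f, forall f, M' f -> T' (T f) = f &
    forall f g, kdot G (T f) g = kdot G f (T' g)].
Proof.
move=> sepH aG sM sM' cM cM' pM pM'.
move=> /(hilbert_dim_eq (closed_subspace_basis sepH sM cM)
                        (closed_subspace_basis sepH sM' cM')) s.
have [A [e oe]] := onb_exists sepH aG sM cM pM.
have [A' [e1 oe1]] := onb_exists sepH aG sM' cM' pM'.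
have [e' oe'] := onb_reindex sM oe (same_dim_card oe oe1 s).
have /(uniformly_positiveP _ aG)[c c0 cP] := pM.
have /(uniformly_positiveP _ aG)[c' c'0 cP'] := pM'.
have m0 : 0 < Num.min c c' by rewrite lt_min c0 c'0.
apply: (onb_transport aG m0 sM sM' cM cM' _ _ oe' oe1) => f.
  move=> /cP; apply: le_trans; apply: ler_wpM2r; first exact: sqr_ge0.
  by rewrite ge_min lexx.
move=> /cP'; apply: le_trans; apply: ler_wpM2r; first exact: sqr_ge0.
by rewrite ge_min lexx orbT.
Qed.

End DimensionIsometry.

(** * Signatures *)

Section KreinDecomposition.
Context {R : realType} {H : hilbertType R}.
Local Notation L := (bounded_op H).
Implicit Types (G T X Y Q E p : L) (f g x y : H) (M N B S Mp Mn : set H).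

Lemma range_subspace T : subspace (range T).
Proof.
apply: mk_subspace => [|a _ _ [f _ <-] [g _ <-]]; first by exists 0; rewrite ?linear0.
by exists (a *: f + g) => //; rewrite linearP.
Qed.

Lemma range_idemP T f : T * T = T -> range T f <-> T f = f.
Proof. by move=> TT; split=> [[g _ <-]|<-]; [rewrite -opME TT | exists f]. Qed.

Lemma range_idem_closed T : T * T = T -> closed (range T).
Proof.
move=> TT; have -> : range T = [set f | (1 - T) f = 0].
  apply/seteqP; split=> f; rewrite /mkset opBE op1E.
    by move=> /(range_idemP f TT) ->; rewrite subrr.
  by move=> /subr0_eq fT; apply/(range_idemP f TT).
exact: closed_ker.
Qed.

Lemma kdotN G f g : kdot (- G) f g = - kdot G f g.
Proof. by rewrite /kdot opNE dotNl. Qed.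

Lemma kdot_eq0C G f g : adjoint G = G -> kdot G f g = 0 -> kdot G g f = 0.
Proof. by move=> aG fg; rewrite kdotC // fg conjc0. Qed.

Lemma Jorthocomp_closed G S : closed (Jorthocomp G S).
Proof. exact: closed_dot_op. Qed.

Lemma Jorthocomp_subspace G S : subspace (Jorthocomp G S).
Proof.
apply: mk_subspace => [g _|a f g fS gS h Sh]; first by rewrite kdot0l.
by rewrite kdotDl kdotZl fS // gS // mulr0 addr0.
Qed.

Lemma isotropic_subspace G S : subspace S -> subspace (isotropic_part G S).
Proof.
move=> sS; have sO := Jorthocomp_subspace G S.
apply: mk_subspace => [|a f g [Sf Of] [Sg Og]].
  by split; [exact: subspace0 | exact: (subspace0 sO)].
by split; [exact: subspaceZD | exact: (subspaceZD _ sO)].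
Qed.

Lemma JorthocompN G : Jorthocomp (- G) = Jorthocomp G.
Proof.
apply/funext => S; apply/seteqP; split=> f fS g Sg; have := fS g Sg;
  by rewrite kdotN => /eqP; rewrite ?oppr_eq0 => /eqP // ->; rewrite ?oppr0.
Qed.

Lemma Jdirect_sumN G M N S : Jdirect_sum G M N S -> Jdirect_sum (- G) M N S.
Proof. by move=> [h ? ?]; split=> // f g Mf Ng; rewrite kdotN h // oppr0. Qed.

Lemma Jdirect_sumC G M N S : adjoint G = G -> Jdirect_sum G M N S -> Jdirect_sum G N M S.
Proof.
move=> aG [h MN ->]; split.
- by move=> f g Nf Mg; apply: kdot_eq0C => //; exact: h.
- by rewrite setIC.
- apply/seteqP; split=> _ [f Mf [g Ng <-]];
    by exists g => //; exists f => //; rewrite addrC.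
Qed.

(** Passing to [- G] exchanges the two definite parts, so results on positive parts transfer to
    negative ones. *)
Lemma signature_decompositionN G S Mp Mn : adjoint G = G ->
  signature_decomposition G S Mp Mn -> signature_decomposition (- G) S Mn Mp.
Proof.
move=> aG [[sp [c c0 cP]] [sn [d d0 dP]] [M [pnM [sM cM HM] SM]]]; split.
- by split=> //; exists d => // f /dP; rewrite kdotN.
- by split=> //; exists c => // f /cP; rewrite kdotN opprK.
exists M; rewrite /isotropic_part JorthocompN; split.
- exact/Jdirect_sumN/Jdirect_sumC.
- by split=> //; rewrite JorthocompN; exact: Jdirect_sumN.
- exact: Jdirect_sumN.
Qed.

(** [Mp] is the intersection of [M] with the orthogonal complement of [Mn]: a vector orthogonal to
    [Mn] has a negative component of zero square, which vanishes by definiteness. *)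
Lemma definite_part_closed G S Mp Mn : adjoint G = G ->
  signature_decomposition G S Mp Mn -> closed Mp.
Proof.
move=> aG [[sp _] [sn [d d0 dP]] [M [[pn _ ME] [sM cM _] _]]].
suff -> : Mp = M `&` Jorthocomp G Mn by apply: closedI => //; exact: Jorthocomp_closed.
apply/seteqP; split=> f.
  move=> Mf; split=> [|g Mg]; last exact: pn.
  by rewrite ME; exists f => //; exists 0; rewrite ?addr0 //; exact: subspace0.
rewrite ME => -[[g Mg [h Mh <-]]] /(_ h Mh); rewrite kdotDl pn // add0r => hh.
have := dP h Mh; rewrite hh oppr0 nmE -rmorphXn -rmorphM /= lecR => dh.
suff -> : h = 0 by rewrite addr0.
apply: nm_eq0; apply/eqP; rewrite -sqrf_eq0 eq_le sqr_ge0 andbT.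
by rewrite -(ler_pM2l d0) mulr0.
Qed.

Lemma has_indep_image T M M' m : (forall f, M f -> M' (T f)) ->
  (forall f, M f -> T f = 0 -> f = 0) -> subspace M -> has_indep M m -> has_indep M' m.
Proof.
move=> TM Tinj sM [v [vM vi]]; exists (fun i => T (v i)); split=> [i|c c0].
  exact: TM.
apply: vi; apply: Tinj.
  elim/big_rec: _ => [|i x _ Mx]; first exact: subspace0.
  by apply: subspaceD => //; exact: subspaceZ.
by rewrite linear_sum -[RHS]c0; apply: eq_bigr => i _; rewrite linearZ.
Qed.

(* The projection of one positive part onto another is injective: an element
   of the kernel is both positive and nonpositive. *)
Lemma positive_part_indep G S Mp Mn Mp' Mn' m : adjoint G = G -> subspace S ->
  signature_decomposition G S Mp Mn -> signature_decomposition G S Mp' Mn' ->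
  has_indep Mp m -> has_indep Mp' m.
Proof.
move=> aG sS [[sp /(uniformly_positiveP _ aG)[c c0 cP]] [sn _] [M [[_ _ ME] _ [_ _ SE]]]].
move=> [[sp' _] [sn' [d d0 dP]] [M' [[_ _ ME'] [sM' _ _] [_ _ SE']]]].
have sI := isotropic_subspace G sS.
have MpS f : Mp f -> S f.
  move=> Mf; rewrite SE; exists 0; first exact: (subspace0 sI).
  exists f; rewrite ?add0r // ME; exists f => //; exists 0; rewrite ?addr0 //.
  exact: subspace0.
have MnS f : Mn' f -> S f.
  move=> Mf; rewrite SE'; exists 0; first exact: (subspace0 sI).
  exists f; rewrite ?add0r // ME'; exists 0; first exact: subspace0.
  by exists f; rewrite ?add0r.
move=> [v [vM vi]].
have /choice[w wP] i : exists w, Mp' w /\ exists s n,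
    [/\ isotropic_part G S s, Mn' n & v i = s + n + w].
  have := MpS _ (vM i); rewrite {1}SE' => -[s Is [x]]; rewrite ME' => -[w Mw [n Mn_ <-]] sE.
  by exists w; split=> //; exists s, n; split=> //; rewrite -sE [w + n]addrC addrA.
have /choice[s /choice[n snP]] := fun i => (wP i).2.
exists w; split=> [i|a a0]; first exact: (wP i).1.
have sumM N (F : 'I_m -> H) : subspace N -> (forall i, N (F i)) -> N (\sum_i a i *: F i).
  move=> sN NF; elim/big_rec: _ => [|i x _ Nx]; first exact: subspace0.
  by apply: subspaceD => //; exact: subspaceZ.
(* A relation among the [w i] leaves [x = t + y] with [t] isotropic and [y] in [Mn'], so [x] has the
   same square as [y]. *)
apply: vi; set x := \sum_i _; set t := \sum_i a i *: s i; set y := \sum_i a i *: n i.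
have xE : x = t + y.
  rewrite -[RHS]addr0 -a0 /x /t /y -!big_split; apply: eq_bigr => i _ /=.
  by have [_ _ ->] := snP i; rewrite !scalerDr.
have Mx : Mp x by exact: sumM.
have [St It] : isotropic_part G S t by apply: (sumM _ _ sI) => i; have [] := snP i.
have My : Mn' y by apply: sumM => // i; have [] := snP i.
have xx : kdot G x x = kdot G y y.
  rewrite xE !kdotDl !kdotDr It // It ?add0r; last exact: MnS.
  by rewrite (kdot_eq0C aG (It _ (MnS _ My))) add0r.
apply: nm_eq0; apply/eqP; rewrite -sqrf_eq0 eq_le sqr_ge0 andbT -(ler_pM2l c0) mulr0.
apply: le_trans (cP _ Mx) _; rewrite xx; have := dP y My.
rewrite nmE -rmorphXn -rmorphM /= (kdot_real y aG) -rmorphN lecR /= lerNr => h.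
by apply: le_trans h _; rewrite oppr_le0 mulr_ge0 ?sqr_ge0 // ltW.
Qed.

Lemma positive_part_dim G S Mp Mn Mp' Mn' : separable H -> adjoint G = G ->
  subspace S -> signature_decomposition G S Mp Mn ->
  signature_decomposition G S Mp' Mn' -> hilbert_dim Mp = hilbert_dim Mp'.
Proof.
move=> sepH aG sS D D'; have [[sp _] _ _] := D; have [[sp' _] _ _] := D'.
apply/hilbert_dim_eq.
- exact: closed_subspace_basis sepH sp (definite_part_closed aG D).
- exact: closed_subspace_basis sepH sp' (definite_part_closed aG D').
- by move=> m; split; [exact: positive_part_indep D D' | exact: positive_part_indep D' D].
Qed.

Lemma kappaE G S Mp Mn : separable H -> adjoint G = G -> subspace S ->
  signature_decomposition G S Mp Mn ->
  kappa_pos G S = hilbert_dim Mp /\ kappa_neg G S = hilbert_dim Mn.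
Proof.
move=> sepH aG sS D; rewrite /kappa_pos /kappa_neg /definite_parts.
case: xgetP => [[Np Nn] _ /= D'|/(_ (Mp, Mn))]; last by [].
split; first exact: positive_part_dim sepH aG sS D' D.
have aGN : adjoint (- G) = - G by rewrite adjopN aG.
apply: (positive_part_dim sepH aGN sS); apply: signature_decompositionN aG _.
  exact: D'.
exact: D.
Qed.

End KreinDecomposition.

(** * Splitting a [J]-selfadjoint projection into definite parts *)

Section DefiniteSplitting.
Context {R : realType} {H : hilbertType R}.
Local Notation L := (bounded_op H).
Implicit Types (T X Y Q E p : L) (f g x y : H).
Variables (J : L) (aJ : adjoint J = J) (JJ : J * J = 1).
Local Notation "T ^#" := (jad J T) (at level 2, format "T ^#").

Lemma uniformly_negativeN M : uniformly_negative J M <-> uniformly_positive (- J) M.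
Proof.
by split=> -[c c0 cP]; exists c => // f /cP; rewrite kdotN.
Qed.

(* For [f = C h] in the range of [C = E J] one has [f, f] = <C h, h>: the
   Hilbert spectral projections of [C] split [E]. *)
Lemma definite_splitting E : E^# = E -> E * E = E -> exists Ep En,
  [/\ Ep^# = Ep /\ En^# = En, Ep * Ep = Ep /\ En * En = En,
      Ep * En = 0 /\ En * Ep = 0, Ep + En = E &
      uniformly_positive J (range Ep) /\ uniformly_positive (- J) (range En)].
Proof.
move=> Es EE; pose C := E * J.
have aE : J * adjoint E = E * J.
  by rewrite -[in RHS]Es jadP -!mulrA JJ mulr1.
have aC : adjoint C = C by rewrite /C adjopM aJ.
have [D [p [[ap pp] Cp Cq [c c0 Dp] cC]]] := sign_ex aC.
have [_ Cpc] := cC C erefl.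
(* As [E = C * J] and [p] commutes with [C], [p * E = C * p * J], whose range lies in that of
   [E]. *)
have EpE : E * (p * E) = p * E.
  have pE : p * E = E * J * p * J by rewrite -[E * J * p]/(C * p) Cpc /C mulrA -mulrA JJ mulr1.
  by rewrite pE !mulrA EE.
have ps : p^# = J * p * J by rewrite jadP ap.
have Eps : (p * E)^# = p * E.
  by rewrite (jadM JJ) Es ps !mulrA -[E * J * p]/(C * p) Cpc /C mulrA -mulrA JJ mulr1.
have EpEp : p * E * (p * E) = p * E by rewrite -mulrA EpE mulrA pp.
have q_pp : (1 - p) * p = 0 by rewrite mulrBl mul1r pp subrr.
exists (p * E), (E - p * E); split.
- by rewrite jadB Eps Es.
- split=> //; rewrite mulrBr !mulrBl EE EpE EpEp -mulrA EE.
  by rewrite subrr subr0.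
- by split; [rewrite mulrBr EpEp -mulrA EE subrr|rewrite mulrBl EpE EpEp subrr].
- by rewrite addrC subrK.
have CJ h : C (J h) = E h by rewrite /C opME -[J (J h)]opME JJ.
have key f h : C h = f -> E f = f -> complex.Re (kdot J f f) = rdot f h.
  move=> Chf Ef; rewrite /kdot -{2}Chf -/(rdot _ _).
  by rewrite rdotC rdot_adj aC CJ Ef rdotC.
split.
- apply/(uniformly_positiveP _ aJ); exists c => // _ [x _ <-].
  set f := (p * E) x.
  have Ef : E f = f by rewrite /f -opME EpE.
  have pf : p f = f by rewrite /f -opME mulrA pp.
  (* With h for [p (J f)], on which [C] acts as [D], the square of [f] is [rdot (D h) h], at least
     [c * nm (D h) ^+ 2 = c * nm f ^+ 2]. *)
  have Ch : C (p (J f)) = f by rewrite -opME Cpc opME CJ Ef.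
  have Dh : D (p (J f)) = f.
    rewrite -[RHS]Ch -[p in LHS]pp -[(p * p) _]/(p (p (J f))).
    by rewrite -[D (p _)]opME -Cp -[LHS]/(C (p (p (J f)))) -[p (p _)]opME pp.
  by rewrite (key _ _ Ch Ef) -{2}Dh -[f in c * nm f ^+ 2]Dh; exact: Dp.
have aJN : adjoint (- J) = - J by rewrite adjopN aJ.
apply/(uniformly_positiveP _ aJN); exists c => // _ [x _ <-].
have -> : (E - p * E) x = ((1 - p) * E) x by rewrite mulrBl mul1r.
set f := ((1 - p) * E) x.
have Ef : E f = f.
  by rewrite /f -opME mulrBl mul1r mulrBr EE EpE.
have qq : (1 - p) * (1 - p) = 1 - p by rewrite mulrBr mulr1 q_pp subr0.
have qf : (1 - p) f = f by rewrite /f -opME mulrA qq.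
have Ch : C ((1 - p) (J f)) = f.
  have Cqc : C * (1 - p) = (1 - p) * C by rewrite mulrBr mulrBl mulr1 mul1r Cpc.
  by rewrite -opME Cqc opME CJ Ef.
set h := (1 - p) (J f) in Ch.
have qh : (1 - p) h = h by rewrite /h -opME qq.
(* On the range of [1 - p], [C] acts as [- D]; this reverses the sign of the form. *)
have Dh : D h = - f.
  by rewrite -Ch -qh -[C _]opME Cq opNE opprK qh opME qh.
have := Dp h; rewrite Dh nmN rdotNl => hle.
by rewrite kdotN raddfN /= (key _ _ Ch Ef).
Qed.

End DefiniteSplitting.

(** * Signatures of the range of a [J]-normal projection and their invariance *)

Section Signatures.
Context {R : realType} {H : hilbertType R}.
Local Notation L := (bounded_op H).
Implicit Types (G T U X Y Q E p a b : L) (f g x y : H) (M N B S Mp Mn : set H).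
Variables (J : L) (aJ : adjoint J = J) (JJ : J * J = 1).
Local Notation "T ^#" := (jad J T) (at level 2, format "T ^#").

Lemma kdot_nondegl f : (forall g, kdot J f g = 0) -> f = 0.
Proof.
move=> f0; rewrite -[f]op1E -JJ opME; have -> : J f = 0; last exact: linear0.
by apply: dot_injl => g; rewrite dot0l; exact: f0.
Qed.

Lemma kdot_nondegr f g : (forall h, kdot J h f = kdot J h g) -> f = g.
Proof.
move=> fg; apply: subr0_eq; apply: kdot_nondegl => h.
by apply: kdot_eq0C => //; rewrite kdotBr fg subrr.
Qed.

Definition definite_split E Ep En :=
  [/\ Ep^# = Ep /\ En^# = En, Ep * Ep = Ep /\ En * En = En,
      Ep * En = 0 /\ En * Ep = 0, Ep + En = E &
      uniformly_positive J (range Ep) /\ uniformly_positive (- J) (range En)].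

Lemma Jorthocomp_range Q : Q * Q = Q -> Jorthocomp J (range Q) = range (1 - Q^#).
Proof.
move=> QQ; have ss : Q^# * Q^# = Q^# by rewrite -(jadM JJ) QQ.
have idem : (1 - Q^#) * (1 - Q^#) = 1 - Q^#.
  by rewrite mulrBr mulr1 mulrBl mul1r ss subrr subr0.
apply/seteqP; split=> f.
  move=> fO; apply/(range_idemP _ idem); rewrite opBE op1E.
  suff -> : Q^# f = 0 by rewrite subr0.
  apply: kdot_nondegl => g; rewrite (kdot_jad aJ JJ) (jadK aJ JJ); apply: fO; by exists g.
move=> /(range_idemP _ idem) fE _ [g _ <-]; rewrite -fE.
by rewrite (kdot_jad aJ JJ) jadB (jad1 JJ) (jadK aJ JJ) -opME mulrBl mul1r QQ subrr kdot0r.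
Qed.

(** The intersection of the ranges of two commuting projections is the range of their product. *)
Lemma isotropic_range Q : Jnormal_projection J Q ->
  isotropic_part J (range Q) = range (Q * (1 - Q^#)).
Proof.
move=> /Jnormal_projectionE[QQ Qn]; rewrite /isotropic_part Jorthocomp_range //.
have ss : Q^# * Q^# = Q^# by rewrite -(jadM JJ) QQ.
have idem : (1 - Q^#) * (1 - Q^#) = 1 - Q^#.
  by rewrite mulrBr mulr1 mulrBl mul1r ss subrr subr0.
have cm : Q * (1 - Q^#) = (1 - Q^#) * Q by rewrite mulrBr mulrBl mulr1 mul1r Qn.
apply/seteqP; split=> f.
  move=> [/(range_idemP _ QQ) Qf /(range_idemP _ idem) cf].
  by exists f => //; rewrite opME cf Qf.
by move=> [g _ <-]; split; [exists ((1 - Q^#) g) | rewrite cm; exists (Q g)].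
Qed.

Lemma signature_decomposition_split Q Ep En : Jnormal_projection J Q ->
  definite_split (Q * Q^#) Ep En ->
  signature_decomposition J (range Q) (range Ep) (range En).
Proof.
move=> Qnorm; have /Jnormal_projectionE[QQ Qn] := Qnorm.
move=> [[ps ns] [pp nn] [pn np] EE [upos uneg]].
have ss : Q^# * Q^# = Q^# by rewrite -(jadM JJ) QQ.
set E := Q * Q^# in EE.
have Es : E^# = E by rewrite /E (jadM JJ) (jadK aJ JJ).
have Eidem : E * E = E by rewrite /E mulrA -[Q * Q^# * Q]mulrA -Qn mulrA QQ -mulrA ss.
have QE : Q * E = E by rewrite /E mulrA QQ.
have QsQ : Q^# * Q = E by rewrite -Qn.
have EQ : E * Q = E by rewrite /E -mulrA -Qn mulrA QQ.
clearbody E.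
have EEp : E * Ep = Ep by rewrite -EE mulrDl pp np addr0.
have EEn : E * En = En by rewrite -EE mulrDl nn pn add0r.
split; [by split=> //; exact: range_subspace| |].
  by split; [exact: range_subspace | apply/uniformly_negativeN].
exists (range E); split.
- split.
  + by move=> _ _ [f _ <-] [g _ <-]; rewrite (kdot_jad aJ JJ) ps -opME pn kdot0r.
  + apply/seteqP; split=> [f [/(range_idemP _ pp) fp /(range_idemP _ nn) fn]|_ ->].
      by rewrite /= -fp -fn -opME pn.
    by split; exact: (subspace0 (range_subspace _)).
  + apply/seteqP; split=> [_ [f _ <-]|_ [_ [f _ <-] [_ [g _ <-] <-]]].
      by exists (Ep f); [exists f | exists (En f); [exists f | rewrite -EE]].
    exists (Ep f + En g) => //.
    by rewrite linearD /= -![E (_ _)]opME EEp EEn.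
- split; [exact: range_subspace | exact: range_idem_closed |].
  rewrite Jorthocomp_range // Es; split.
  + move=> _ _ [f _ <-] [g _ <-]; rewrite (kdot_jad aJ JJ) Es -opME mulrBr mulr1 Eidem.
    by rewrite subrr kdot0r.
  + apply/seteqP; split=> [f [/(range_idemP _ Eidem) fE [g _ gf]]|_ ->].
      by rewrite /= -fE -gf -opME mulrBr mulr1 Eidem subrr.
    by split; exact: (subspace0 (range_subspace _)).
  + apply/seteqP; split=> // f _; exists (E f); first by exists f.
    by exists ((1 - E) f); [exists f | rewrite opBE op1E addrC subrK].
- split.
  + move=> f _ [_ fO] [g _ <-]; apply: fO.
    by exists (E g) => //; rewrite -opME QE.
  + apply/seteqP; split=> [f [[_ fO] /(range_idemP _ Eidem) fE]|_ ->].
      apply: kdot_nondegl => g; rewrite -fE (kdot_jad aJ JJ) Es; apply: fO.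
      by exists (E g) => //; rewrite -opME QE.
    split; last exact: (subspace0 (range_subspace _)).
    by split; [exact: (subspace0 (range_subspace _)) | move=> g _; rewrite kdot0l].
  + apply/seteqP; split=> [f /(range_idemP _ QQ) Qf|_ [f [[g _ <-] _] [_ [h _ <-] <-]]].
      exists (f - E f).
        split.
          by exists (f - E f) => //; rewrite linearB /= Qf -opME QE.
        move=> _ [g _ <-]; have -> : f - E f = (Q - E) f by rewrite opBE Qf.
        by rewrite (kdot_jad aJ JJ) jadB Es -opME mulrBl EQ QsQ subrr kdot0r.
      by exists (E f); [exists f | rewrite subrK].
    exists (Q g + E h) => //.
    by rewrite linearD /= -![Q (_ _)]opME QQ QE.
Qed.

(** Makes the cosignatures of R(Q) the signatures of another [J]-normal projection, by
    [Jorthocomp_range]. *)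
Lemma Jnormal_compl Q : Jnormal_projection J Q -> Jnormal_projection J (1 - Q^#).
Proof.
move=> /Jnormal_projectionE[QQ Qn]; apply/Jnormal_projectionE.
have ss : Q^# * Q^# = Q^# by rewrite -(jadM JJ) QQ.
split; first by rewrite mulrBr mulr1 mulrBl mul1r ss subrr subr0.
rewrite jadB (jad1 JJ) (jadK aJ JJ) [LHS]mulrBl [RHS]mulrBr mul1r mulr1.
by congr (_ - _); rewrite mulrBr mulrBl mulr1 mul1r Qn.
Qed.

Lemma definite_split_ex Q : Jnormal_projection J Q ->
  exists Ep En, definite_split (Q * Q^#) Ep En.
Proof.
move=> /Jnormal_projectionE[QQ Qn]; apply: definite_splitting => //.
  by rewrite (jadM JJ) (jadK aJ JJ).
have ss : Q^# * Q^# = Q^# by rewrite -(jadM JJ) QQ.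
by rewrite mulrA -[Q * Q^# * Q]mulrA -Qn mulrA QQ -mulrA ss.
Qed.

Lemma kappa_split (sepH : separable H) Q Ep En : Jnormal_projection J Q ->
  definite_split (Q * Q^#) Ep En ->
  kappa_pos J (range Q) = hilbert_dim (range Ep) /\
  kappa_neg J (range Q) = hilbert_dim (range En).
Proof.
move=> Qn D; apply: kappaE => //; first exact: range_subspace.
exact: signature_decomposition_split.
Qed.

(** [U] need not preserve Hilbert norms or orthogonality, but it preserves linear independence, and
    that determines [hilbert_dim]. *)
Lemma hilbert_dim_Jconj (sepH : separable H) U X : Junitary J U -> X * X = X ->
  hilbert_dim (range (U * X * U^#)) = hilbert_dim (range X).
Proof.
move=> UJ XX; have /JunitaryE[U1 U2] := UJ.
have YY : U * X * U^# * (U * X * U^#) = U * X * U^# by rewrite JconjM // XX.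
apply/hilbert_dim_eq.
- exact: closed_subspace_basis sepH (range_subspace _) (range_idem_closed YY).
- exact: closed_subspace_basis sepH (range_subspace _) (range_idem_closed XX).
have inj (V W : L) : V * W = 1 -> forall f, W f = 0 -> f = 0.
  by move=> VW f Wf; rewrite -[f]op1E -VW opME Wf linear0.
move=> m; split.
  apply: (has_indep_image (T := U^#)) (range_subspace _) => [_ [f _ <-]|f _].
    by exists (U^# f) => //; rewrite -!opME !mulrA U2 mul1r.
  exact: inj U1 f.
apply: (has_indep_image (T := U)) (range_subspace _) => [_ [f _ <-]|f _].
  by exists (U f) => //; rewrite -!opME -!mulrA U2 mulr1.
exact: inj U2 f.
Qed.

Lemma uniformly_positive_Jconj G U X : adjoint G = G -> Junitary J U ->
  (forall f g, kdot G (U f) (U g) = kdot G f g) ->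
  uniformly_positive G (range X) -> uniformly_positive G (range (U * X * U^#)).
Proof.
move=> aG UJ GU /(uniformly_positiveP _ aG)[c c0 cP]; apply/(uniformly_positiveP _ aG).
have u0 := nm_ge0 U; have u1 : 0 < nm U + 1 by lra.
(* [nm (U g) <= (nm U + 1) * nm g], with 1 added to keep the divisor positive. *)
exists (c / (nm U + 1) ^+ 2); first by rewrite divr_gt0 // exprn_gt0.
move=> _ [f _ <-]; rewrite !opME GU; set g := X (U^# f).
apply: le_trans (cP g _); last by exists (U^# f).
rewrite -mulrA ler_pM2l // mulrC ler_pdivrMr ?exprn_gt0 // -exprMn.
rewrite ler_pXn2r ?nnegrE ?nm_ge0 ?mulr_ge0 ?nm_ge0 ?(ltW u1) //.
have := opnm_ge U g; have := nm_ge0 g; move: (nm (U g)) (nm U) (nm g) => x y z.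
by move=> *; lra.
Qed.

Lemma definite_split_Jconj E Ep En U : Junitary J U -> definite_split E Ep En ->
  definite_split (U * E * U^#) (U * Ep * U^#) (U * En * U^#).
Proof.
move=> UJ [[ps ns] [pp nn] [pn np] EE [upos uneg]].
have JU f g : kdot J (U f) (U g) = kdot J f g.
  by have /JunitaryE[_ U2] := UJ; rewrite (kdot_jad aJ JJ) -opME U2.
split.
- by rewrite !(JconjA aJ JJ) ps ns.
- by rewrite !JconjM // pp nn.
- by rewrite !JconjM // pn np !mulr0 !mul0r.
- by rewrite -mulrDl -mulrDr EE.
split; first exact: uniformly_positive_Jconj.
apply: uniformly_positive_Jconj => //; first by rewrite adjopN aJ.
by move=> f g; rewrite !kdotN JU.
Qed.

Lemma Jconj_kappa (sepH : separable H) Q0 U : Jnormal_projection J Q0 -> Junitary J U ->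
  kappa_pos J (range (U * Q0 * U^#)) = kappa_pos J (range Q0) /\
  kappa_neg J (range (U * Q0 * U^#)) = kappa_neg J (range Q0).
Proof.
move=> Q0n UJ; have Qn : Jnormal_projection J (U * Q0 * U^#).
  by apply: Jorbit_normal aJ JJ _ _ Q0n _; apply/JorbitE; exists U.
have [Ep [En D]] := definite_split_ex Q0n.
have [-> ->] := kappa_split sepH Q0n D.
have := definite_split_Jconj UJ D; rewrite -JconjM // -(JconjA aJ JJ) => D'.
have [-> ->] := kappa_split sepH Qn D'.
by have [_ [pp nn] _ _ _] := D; rewrite !hilbert_dim_Jconj.
Qed.

Lemma Jorbit_signatures (sepH : separable H) Q0 Q :
  Jnormal_projection J Q0 -> Jorbit J Q0 Q ->
  [/\ kappa_pos J (range Q) = kappa_pos J (range Q0),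
      kappa_neg J (range Q) = kappa_neg J (range Q0),
      kappa_iso J (range Q) = kappa_iso J (range Q0),
      cokappa_pos J (range Q) = cokappa_pos J (range Q0) &
      cokappa_neg J (range Q) = cokappa_neg J (range Q0)].
Proof.
move=> Q0n oQ; have Qn := Jorbit_normal aJ JJ Q0n oQ.
have /Jnormal_projectionE[QQ _] := Qn; have /Jnormal_projectionE[Q0Q0 Q0c] := Q0n.
have /JorbitE[U UJ QE] := oQ; have /JunitaryE[U1 _] := UJ.
have [kp kn] := Jconj_kappa sepH Q0n UJ.
have compl : U * (1 - Q0^#) * U^# = 1 - Q^#.
  by rewrite mulrBr mulr1 [LHS]mulrBl U1 -(JconjA aJ JJ) QE.
have [cp cn] := Jconj_kappa sepH (Jnormal_compl Q0n) UJ.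
have OQ := Jorthocomp_range QQ; have OQ0 := Jorthocomp_range Q0Q0.
split; [by rewrite -QE; exact: kp|by rewrite -QE; exact: kn| |
  by rewrite /cokappa_pos OQ OQ0 -compl; exact: cp|
  by rewrite /cokappa_neg OQ OQ0 -compl; exact: cn].
rewrite /kappa_iso (isotropic_range Qn) (isotropic_range Q0n) -compl -{1}QE.
rewrite (JconjM _ _ UJ).
apply: (hilbert_dim_Jconj sepH UJ).
have ss : Q0^# * Q0^# = Q0^# by rewrite -(jadM JJ) Q0Q0.
have cm : Q0 * (1 - Q0^#) = (1 - Q0^#) * Q0 by rewrite mulrBr mulrBl mulr1 mul1r Q0c.
rewrite {2}cm mulrA -[Q0 * (1 - Q0^#) * _]mulrA.
have -> : (1 - Q0^#) * (1 - Q0^#) = 1 - Q0^#.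
  by rewrite mulrBr mulr1 mulrBl mul1r ss subrr subr0.
by rewrite cm -mulrA Q0Q0.
Qed.

End Signatures.

(** * Assembling a [J]-unitary from isometries between atoms *)

Section PartialIsometries.
Context {R : realType} {H : hilbertType R}.
Local Notation L := (bounded_op H).
Implicit Types (G T U X Y Q E p a b : L) (f g x y : H) (M N B S Mp Mn : set H).
Variables (J : L) (aJ : adjoint J = J) (JJ : J * J = 1).
Local Notation "T ^#" := (jad J T) (at level 2, format "T ^#").

(* [a : range Y -> range X] and [b : range X -> range Y] are mutually inverse
   and extended by zero. *)
Definition inverse_pair X Y a b :=
  [/\ X * a = a /\ a * Y = a, Y * b = b /\ b * X = b, a * b = X & b * a = Y].

(** The cross products vanish because the idempotents are mutually orthogonal on both sides. *)
Lemma inverse_pairD X Y a b X' Y' a' b' :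
  inverse_pair X Y a b -> inverse_pair X' Y' a' b' ->
  X * X' = 0 /\ X' * X = 0 -> Y * Y' = 0 /\ Y' * Y = 0 ->
  inverse_pair (X + X') (Y + Y') (a + a') (b + b').
Proof.
move=> [[Xa aY] [Yb bX] ab ba] [[Xa' aY'] [Yb' bX'] ab' ba'] [XX X'X] [YY Y'Y].
have zero (x y z w : L) : x * z = x -> w * y = y -> z * w = 0 -> x * y = 0.
  by move=> xz wy zw; rewrite -xz -wy mulrA -[x * z * w]mulrA zw mulr0 mul0r.
have zl (x y z : L) : x * y = 0 -> y * z = z -> x * z = 0.
  by move=> xy <-; rewrite mulrA xy mul0r.
have zr (x y z : L) : x * y = x -> y * z = 0 -> x * z = 0.
  by move=> <- yz; rewrite -mulrA yz mulr0.
split.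
- split; rewrite mulrDl !mulrDr.
    by rewrite Xa Xa' (zl _ _ _ XX Xa') (zl _ _ _ X'X Xa) addr0 add0r.
  by rewrite aY aY' (zr _ _ _ aY YY) (zr _ _ _ aY' Y'Y) addr0 add0r.
- split; rewrite mulrDl !mulrDr.
    by rewrite Yb Yb' (zl _ _ _ YY Yb') (zl _ _ _ Y'Y Yb) addr0 add0r.
  by rewrite bX bX' (zr _ _ _ bX XX) (zr _ _ _ bX' X'X) addr0 add0r.
- rewrite mulrDl !mulrDr ab ab' (zero a b' Y Y') // (zero a' b Y' Y) //.
  by rewrite addr0 add0r.
- rewrite mulrDl !mulrDr ba ba' (zero b a' X X') // (zero b' a X' X) //.
  by rewrite addr0 add0r.
Qed.

(** The adjoint for [- J] is also the [J]-adjoint, so both signs yield an inverse of the form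
    [a^#]. *)
Lemma definite_isometry (sepH : separable H) G X Y : G = J \/ G = - J ->
  X * X = X -> Y * Y = Y -> X^# = X -> Y^# = Y ->
  uniformly_positive G (range X) -> uniformly_positive G (range Y) ->
  hilbert_dim (range X) = hilbert_dim (range Y) ->
  exists a, inverse_pair X Y a a^#.
Proof.
move=> GJ XX YY Xs Ys pX pY XY.
have aG : adjoint G = G by case: GJ => ->; rewrite ?adjopN aJ.
have [a [a' [aX aY aa' a'a adj]]] := dim_isometry sepH aG (range_subspace X)
  (range_subspace Y) (range_idem_closed XX) (range_idem_closed YY) pX pY XY.
have a'E : a' = a^#.
  apply: bounded_op_ext => g; apply: (kdot_nondegr aJ JJ) => f.
  rewrite -(kdot_jad aJ JJ); have := adj f g; case: GJ => -> //.
  by rewrite !kdotN => /oppr_inj.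
exists a; rewrite -a'E.
have Xa : X * a = a.
  by apply: bounded_op_ext => f; exact: iffLR (range_idemP _ XX) (aX f).
have Ya' : Y * a' = a'.
  by apply: bounded_op_ext => f; exact: iffLR (range_idemP _ YY) (aY f).
(* The extension by zero is automatic: it is the [J]-adjoint of [Y * a' = a'], [Y] being
   [J]-selfadjoint. *)
have aY' : a * Y = a by have := congr1 (jad J) Ya'; rewrite (jadM JJ) a'E (jadK aJ JJ) Ys.
have a'X : a' * X = a' by have := congr1 (jad J) Xa; rewrite (jadM JJ) -a'E Xs.
split=> //; apply: bounded_op_ext => f.
  by rewrite -a'X mulrA opME; apply: aa'; exists f.
by rewrite -aY' mulrA opME; apply: a'a; exists f.
Qed.

Lemma neutral_isomorphism (sepH : separable H) X Y : X * X = X -> Y * Y = Y ->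
  hilbert_dim (range X) = hilbert_dim (range Y) -> exists a b, inverse_pair X Y a b.
Proof.
move=> XX YY XY.
have p1 M : uniformly_positive (1 : L) M.
  by exists 1 => // f _; rewrite mul1r /kdot op1E dotpE.
have [a [b [aX bY ab ba _]]] := dim_isometry sepH (adjop1 (H := H)) (range_subspace X)
  (range_subspace Y) (range_idem_closed XX) (range_idem_closed YY) (p1 _) (p1 _) XY.
have Xa : X * a = a.
  by apply: bounded_op_ext => f; exact: iffLR (range_idemP _ XX) (aX f).
have Yb : Y * b = b.
  by apply: bounded_op_ext => f; exact: iffLR (range_idemP _ YY) (bY f).
exists (a * Y), (b * X); split.
- by rewrite mulrA Xa -mulrA YY.
- by rewrite mulrA Yb -mulrA XX.
- rewrite mulrA -[a * Y * b]mulrA Yb -mulrA.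
  by apply: bounded_op_ext => f; rewrite !opME ab //; exists f.
- rewrite mulrA -[b * X * a]mulrA Xa -mulrA.
  by apply: bounded_op_ext => f; rewrite !opME ba //; exists f.
Qed.

Lemma inverse_pair_jad X Y a b : inverse_pair X Y a b ->
  inverse_pair X^# Y^# b^# a^#.
Proof.
by move=> [[Xa aY] [Yb bX] ab ba]; split; rewrite -!(jadM JJ) ?Xa ?aY ?Yb ?bX ?ab ?ba.
Qed.

Lemma commuting_mul (x y x' y' : L) : y * x' = x' * y ->
  x * y * (x' * y') = x * x' * (y * y').
Proof. by move=> h; rewrite !mulrA -[x * y * x']mulrA h mulrA. Qed.

Lemma complement_idem (x x' : L) : x * x = x -> x + x' = 1 ->
  [/\ x * x' = 0, x' * x = 0, x' * x' = x' &
      forall y : L, x * y = y * x -> x' * y = y * x'].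
Proof.
move=> xx s1; have x'E : x' = 1 - x by rewrite -s1 addrAC subrr add0r.
have e1 : x * x' = 0 by rewrite x'E mulrBr mulr1 xx subrr.
have e2 : x' * x = 0 by rewrite x'E mulrBl mul1r xx subrr.
split=> //; first by rewrite {1}x'E mulrBl mul1r e1 subr0.
by move=> y xy; rewrite x'E mulrBr mulrBl mulr1 mul1r xy.
Qed.

(** For [q = Q] and [r = Q^#] the atoms [q * r], [q' * r'], [q * r'], [q' * r] are E, F, P and P^#.
    They are grouped as E + F and P + P^#, the order in which the [J]-unitary is summed. *)
Lemma commuting_atoms (q q' r r' : L) : q * q = q -> r * r = r -> q * r = r * q ->
  q + q' = 1 -> r + r' = 1 ->
  [/\ [/\ q * r * (q' * r') = 0 /\ q' * r' * (q * r) = 0,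
          q * r' * (q' * r) = 0 /\ q' * r * (q * r') = 0,
          (q * r + q' * r') * (q * r' + q' * r) = 0 /\
          (q * r' + q' * r) * (q * r + q' * r') = 0 &
          (q * r + q' * r') + (q * r' + q' * r) = 1],
      [/\ q * r * (q * r) = q * r, q * r' * (q * r') = q * r' & q' * r' = r' * q'],
      [/\ q * (q * r) = q * r, q * (q' * r') = 0, q * (q * r') = q * r' &
          q * (q' * r) = 0] &
      [/\ q * r * q = q * r, q' * r' * q = 0, q * r' * q = q * r' & q' * r * q = 0]].
Proof.
move=> qq rr qr q1 r1.
have [qq' q'q q'q' q'c] := complement_idem qq q1.
have [rr' r'r r'r' r'c] := complement_idem rr r1.
have rq := esym qr; have r'q := r'c _ rq; have rq' := esym (q'c _ qr).
have r'q' := r'c _ rq'.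
have m (x y x' y' : L) : y * x' = x' * y -> x * x' = 0 \/ y * y' = 0 ->
    x * y * (x' * y') = 0.
  by move=> h; rewrite commuting_mul // => -[] ->; rewrite ?mul0r ?mulr0.
split.
- split.
  + by split; apply: m; tauto.
  + by split; apply: m; tauto.
  + split; rewrite mulrDl !mulrDr !m ?addr0 //; tauto.
  + by rewrite addrACA -!mulrDr [r' + r]addrC r1 !mulr1.
- split; last exact: esym.
    by rewrite (commuting_mul _ _ rq) qq rr.
  by rewrite (commuting_mul _ _ r'q) qq r'r'.
- split.
  + by rewrite mulrA qq.
  + by rewrite mulrA qq' mul0r.
  + by rewrite mulrA qq.
  + by rewrite mulrA qq' mul0r.
- split.
  + by rewrite -mulrA rq mulrA qq.
  + by rewrite -mulrA r'q mulrA q'q mul0r.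
  + by rewrite -mulrA r'q mulrA qq.
  + by rewrite -mulrA rq mulrA q'q mul0r.
Qed.

(* [U] is assembled from isometries between the corresponding atoms of the two
   projections; on the skew-linked pair of neutral ranges [P], [P^#] it is the
   sum of an arbitrary isomorphism and of the [J]-adjoint of its inverse. *)
Lemma signatures_Jorbit (sepH : separable H) Q0 Q :
  Jnormal_projection J Q0 -> Jnormal_projection J Q ->
  [/\ kappa_pos J (range Q) = kappa_pos J (range Q0),
      kappa_neg J (range Q) = kappa_neg J (range Q0),
      kappa_iso J (range Q) = kappa_iso J (range Q0),
      cokappa_pos J (range Q) = cokappa_pos J (range Q0) &
      cokappa_neg J (range Q) = cokappa_neg J (range Q0)] -> Jorbit J Q0 Q.
Proof.
move=> Q0n Qn; have /Jnormal_projectionE[QQ Qc] := Qn.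
have /Jnormal_projectionE[Q0Q0 Q0c] := Q0n.
(* Applied to [Q], and then to [1 - Q^#], whose signatures are the cosignatures of R(Q). *)
have def_iso X Y E F (Xn : Jnormal_projection J X) (Yn : Jnormal_projection J Y) :
    X * X^# = E -> Y * Y^# = F ->
    kappa_pos J (range X) = kappa_pos J (range Y) ->
    kappa_neg J (range X) = kappa_neg J (range Y) ->
    exists a, inverse_pair E F a a^#.
  move=> <- <-.
  have [Xp [Xm XD]] := definite_split_ex aJ JJ Xn.
  have [Yp [Ym YD]] := definite_split_ex aJ JJ Yn.
  have [-> ->] := kappa_split aJ JJ sepH Xn XD.
  have [-> ->] := kappa_split aJ JJ sepH Yn YD => hp hm.
  have [[Xps Xms] [Xpp Xmm] Xo XE [Xpos Xneg]] := XD.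
  have [[Yps Yms] [Ypp Ymm] Yo YE [Ypos Yneg]] := YD.
  have [a1 a1P] := definite_isometry sepH (or_introl erefl) Xpp Ypp Xps Yps Xpos Ypos hp.
  have [a2 a2P] := definite_isometry sepH (or_intror erefl) Xmm Ymm Xms Yms Xneg Yneg hm.
  exists (a1 + a2); rewrite jadD -XE -YE; exact: inverse_pairD.
move=> [kp kn ki cp cn].
have [a aP] := def_iso _ _ _ _ Qn Q0n erefl erefl kp kn.
have ss : Q^# * Q^# = Q^# by have := jadM JJ Q Q; rewrite QQ => <-.
have ss0 : Q0^# * Q0^# = Q0^# by have := jadM JJ Q0 Q0; rewrite Q0Q0 => <-.
have [[z1 z2 z3 z4] [_ PP FC] [i1 i2 i3 i4] _] :=
  commuting_atoms QQ ss Qc (subrKC _ _) (subrKC _ _).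
have [[z1' z2' z3' z4'] [_ PP' FC'] _ [j1 j2 j3 j4]] :=
  commuting_atoms Q0Q0 ss0 Q0c (subrKC _ _) (subrKC _ _).
have [b bP] : exists b, inverse_pair ((1 - Q) * (1 - Q^#)) ((1 - Q0) * (1 - Q0^#)) b b^#.
  have cp' : kappa_pos J (range (1 - Q^#)) = kappa_pos J (range (1 - Q0^#)).
    by rewrite -(Jorthocomp_range aJ JJ QQ) -(Jorthocomp_range aJ JJ Q0Q0); exact: cp.
  have cn' : kappa_neg J (range (1 - Q^#)) = kappa_neg J (range (1 - Q0^#)).
    by rewrite -(Jorthocomp_range aJ JJ QQ) -(Jorthocomp_range aJ JJ Q0Q0); exact: cn.
  have compl X : (1 - X) * (1 - X^#) = (1 - X^#) * (1 - X) ->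
      (1 - X^#) * (1 - X^#)^# = (1 - X) * (1 - X^#).
    have e : (1 - X^#)^# = 1 - X by rewrite jadB (jad1 JJ) (jadK aJ JJ).
    by move=> h; exact: etrans (congr1 ( *%R (1 - X^#)) e) (esym h).
  exact: def_iso _ _ _ _ (Jnormal_compl aJ JJ Qn) (Jnormal_compl aJ JJ Q0n)
    (compl _ FC) (compl _ FC') cp' cn'.
have [v [w vP]] : exists v w, inverse_pair (Q * (1 - Q^#)) (Q0 * (1 - Q0^#)) v w.
  apply: (neutral_isomorphism sepH PP PP').
  by move: ki; rewrite /kappa_iso (isotropic_range aJ JJ Qn) (isotropic_range aJ JJ Q0n).
have vPs := inverse_pair_jad vP.
have jP X : (X * (1 - X^#))^# = (1 - X) * X^# by rewrite (jadM JJ) jadB (jad1 JJ) (jadK aJ JJ).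
rewrite !jP in vPs.
have := inverse_pairD (inverse_pairD aP bP z1 z1') (inverse_pairD vP vPs z2 z2') z3 z3'.
rewrite z4 z4'; set U := _ + _ + _; set U' := _ + _ + _ => -[_ _ U1 U2].
(* On the neutral part the [J]-adjoint of [v + w^#] is [w + v^#], its inverse with the summands
   exchanged. *)
have U'E : U' = U^#.
  by rewrite /U /U' !jadD (jadK aJ JJ); congr (_ + _); rewrite addrC.
have QU : Q * U = U * Q0.
  have l1 (X c d : L) : X * c = c -> Q * X = d -> Q * c = d * c.
    by move=> Xc <-; rewrite -mulrA Xc.
  have r1 (X c d : L) : c * X = c -> X * Q0 = d -> c * Q0 = c * d.
    by move=> cX <-; rewrite mulrA cX.
  have [[aX aY] _ _ _] := aP; have [[bX bY] _ _ _] := bP.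
  have [[vX vY] _ _ _] := vP; have [[wX wY] _ _ _] := vPs.
  rewrite /U !mulrDr !mulrDl.
  rewrite (l1 _ _ _ aX i1) (l1 _ _ _ bX i2) (l1 _ _ _ vX i3) (l1 _ _ _ wX i4).
  rewrite (r1 _ _ _ aY j1) (r1 _ _ _ bY j2) (r1 _ _ _ vY j3) (r1 _ _ _ wY j4).
  by rewrite aX aY vX vY !mul0r !mulr0.
apply/JorbitE; exists U; first by apply/JunitaryE; rewrite -U'E; exact: conj U1 U2.
by rewrite -QU -mulrA -U'E U1 mulr1.
Qed.

End PartialIsometries.

Theorem proposition3p10 (R : realType) (H : hilbertType R)
    (sepH : separable H) (J : bounded_op H) (symJ : symmetry J)
    (Q0 : bounded_op H) (Q0_Jnormal : Jnormal_projection J Q0) :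
  (forall Q : bounded_op H, Jnormal_projection J Q ->
     (Jorbit J Q0 Q <->
      [/\ kappa_pos J (range Q) = kappa_pos J (range Q0),
          kappa_neg J (range Q) = kappa_neg J (range Q0),
          kappa_iso J (range Q) = kappa_iso J (range Q0),
          cokappa_pos J (range Q) = cokappa_pos J (range Q0) &
          cokappa_neg J (range Q) = cokappa_neg J (range Q0)])) /\
  connected_component (Jnormal_projection J) Q0 = Jorbit J Q0.
Proof.
case: symJ => /esym aJ JJ; split=> [Q Qn|].
  split; first exact: Jorbit_signatures.
  exact: signatures_Jorbit.
apply/seteqP; split; first exact: component_sub_Jorbit.
exact: Jorbit_sub_component.
Qed.
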